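(* Let $k\in\mathbb{N}$. For every $\mathcal{M}\in H_{2-2k}^{\mathrm{cusp}}$, every discriminant $D>0$, and every $Q\in\mathcal{Q}_D$, the (regularized) cycle integrals satisfy $$ \mathcal{C}\left(\xi_{2-2k}(\mathcal{M});Q\right)=-\frac{(4\pi)^{2k-1}}{(2k-2)!}\,\overline{\mathcal{C}\left(\mathcal{D}^{2k-1}(\mathcal{M});Q\right)}. $$
   Context: Throughout, $k\in\mathbb{N}=\{1,2,\dots\}$ is fixed, $\mathbb{H}$ is the upper half-plane, $z=x+iy\in\mathbb{H}$, $q=e^{2\pi i z}$, and all modular objects are for $\mathrm{SL}_2(\mathbb{Z})$. Modular objects. $M_{w}^!$ is the space of weakly holomorphic modular forms of weight $w$ (meromorphic modular forms whose only possible poles are at the cusps), $S_{2k}$ the space of cusp forms of weight $2k$. A harmonic weak Maass form of weight $2-2k$ is a smooth $\mathcal{M}:\mathbb{H}\to\mathbb{C}$ with (i) $\mathcal{M}|_{2-2k}\gamma=\mathcal{M}$ for all $\gamma\in\mathrm{SL}_2(\mathbb{Z})$; (ii) $\Delta_{2-2k}(\mathcal{M})=0$, where $\Delta_{2-2k}=-y^2\left(\frac{\partial^2}{\partial x^2}+\frac{\partial^2}{\partial y^2}\right)+i(2-2k)y\left(\frac{\partial}{\partial x}+i\frac{\partial}{\partial y}\right)$; (iii) $\mathcal{M}$ has at most linear exponential growth at $i\infty$. Put $\xi_{2-2k}(\mathcal{M})=2iy^{2-2k}\overline{\frac{\partial \mathcal{M}}{\partial\overline{z}}}$ and $\mathcal{D}=\frac{1}{2\pi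 i}\frac{\partial}{\partial z}$. $H_{2-2k}^{\mathrm{cusp}}$ is the space of harmonic weak Maass forms $\mathcal{M}$ of weight $2-2k$ with $\xi_{2-2k}(\mathcal{M})\in S_{2k}$. For such $\mathcal{M}$, $\mathcal{D}^{2k-1}(\mathcal{M})$ is a weakly holomorphic modular form of weight $2k$. Regularized integral. If $f:\mathbb{H}\to\mathbb{C}$ is continuous with $f(z)=O(e^{c\,\mathrm{Im}(z)})$ for some $c>0$, uniformly in $\mathrm{Re}(z)$, as $\mathrm{Im}(z)\to\infty$, then for $z_0\in\mathbb{H}$ the integral $\int_{z_0}^{i\infty}e^{uiw}f(w)\,dw$ (path in a vertical strip) converges for $\mathrm{Re}(u)\gg0$; if it has an analytic continuation to $u=0$, $R.\int_{z_0}^{i\infty}f(w)\,dw$ is the value of this continuation at $u=0$. For a cusp $\mathfrak{a}=\sigma_{\mathfrak{a}}(i\infty)$, $\sigma_{\mathfrak{a}}\in\mathrm{SL}_2(\mathbb{Z})$, put $R.\int_{z_0}^{\mathfrak{a}}f(w)\,dw=R.\int_{\sigma_{\mathfrak{a}}^{-1}z_0}^{i\infty}(f|_2\sigma_{\mathfrak{a}})(w)\,dw$, with $(f|_2\left(\begin{smallmatrix}\alpha&\beta\\ \gamma&\delta\end{smallmatrix}\right))(w)=(\gamma w+\delta)^{-2}f\left(\frac{\alpha w+\beta}{\gamma w+\delta}\right)$, and for cusps $\mathfrak{a},\mathfrak{b}$ put $R.\int_{\mathfrak{a}}^{\mathfrak{b}}f=R.\int_{z_0}^{\mathfrak{b}}f+R.\int_{\mathfrak{a}}^{z_0}f$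 for any $z_0\in\mathbb{H}$, where $R.\int_{\mathfrak{a}}^{z_0}=-R.\int_{z_0}^{\mathfrak{a}}$ (independent of $z_0$). Cycle integrals. A discriminant is an integer $\equiv0,1\pmod4$. For a discriminant $D>0$, $\mathcal{Q}_D$ is the set of integral binary quadratic forms $Q=[a,b,c]$, $Q(X,Y)=aX^2+bXY+cY^2$, with $b^2-4ac=D$. If $a\neq0$, $S_Q$ is the semicircle $\{z\in\mathbb{H}: a|z|^2+bx+c=0\}$, directed counterclockwise if $a>0$ and clockwise if $a<0$; if $a=0$, $S_Q$ is the vertical line given by the same equation, directed up from the real axis. If $D$ is not a square and $\gcd(a,b,c)=1$, let $g_Q=\left(\begin{smallmatrix}\frac{t+bu}{2}&cu\\-au&\frac{t-bu}{2}\end{smallmatrix}\right)$, where $(t,u)$ is the smallest positive solution of $t^2-Du^2=4$; if $\gcd(a,b,c)=g>1$, let $g_Q=g_{Q/g}$ (so $g_Q$ generates, up to sign, the group of automorphs of $Q$ in $\mathrm{SL}_2(\mathbb{Z})$). If $D$ is not a square, $C_Q$ is the directed arc of $S_Q$ from $z$ to $g_Qz$ for any $z\in S_Q$; if $D$ is a square, $C_Q=S_Q$. For $F$ continuous of weight $2k$ modularity, $\mathcal{C}(F;Q)=R.\int_{C_Q}F(z)Q(z,1)^{k-1}\,dz$; for non-square $D$ this is an ordinary integral over a compact arc and is independent of the choice of $z$; for square $D$ it is the regularized integral between the two cusps that are the endpoints of $S_Q$. *)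

(* Defs.v *)
(* Stdlib reals with Coquelicot; C is Coquelicot's type of complex numbers. *)
From Stdlib Require Import Reals ZArith.
From Coquelicot Require Import Coquelicot.

Open Scope C_scope.

(** * Complex-analytic preliminaries *)

(* Functions on the upper half-plane are total functions [C -> C] whose values
   off [upper] play no role. *)
Definition upper (z : C) : Prop := (0 < Im z)%R.

Definition Cexp (z : C) : C :=
  (exp (Re z) * cos (Im z), exp (Re z) * sin (Im z))%R.

Definition CpowZ (z : C) (n : Z) : C :=
  match n with
  | Z0 => 1
  | Zpos p => Cpow z (Pos.to_nat p)
  | Zneg p => / Cpow z (Pos.to_nat p)
  end.

Definition holomorphic_on (U : C -> Prop) (f : C -> C) : Prop :=
  forall z, U z -> @ex_derive C_AbsRing C_NormedModule f z.

Definition connected_open (U : C -> Prop) : Prop :=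
  open U /\
  forall V W : C -> Prop, open V -> open W ->
    (forall u, U u -> V u \/ W u) ->
    (exists u, U u /\ V u) -> (exists u, U u /\ W u) ->
    exists u, U u /\ V u /\ W u.

Definition partial_x (f : C -> C) (z : C) : C :=
  (Derive (fun t => Re (f (t, Im z))) (Re z),
   Derive (fun t => Im (f (t, Im z))) (Re z)).

Definition partial_y (f : C -> C) (z : C) : C :=
  (Derive (fun t => Re (f (Re z, t))) (Im z),
   Derive (fun t => Im (f (Re z, t))) (Im z)).

Definition ex_partials (f : C -> C) (z : C) : Prop :=
  ex_derive (fun t : R => Re (f (t, Im z))) (Re z) /\
  ex_derive (fun t : R => Im (f (t, Im z))) (Re z) /\
  ex_derive (fun t : R => Re (f (Re z, t))) (Im z) /\
  ex_derive (fun t : R => Im (f (Re z, t))) (Im z).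

(* [f] is n times continuously differentiable on the upper half-plane, as a
   function of the two real variables x and y. *)
Fixpoint Cn_upper (n : nat) (f : C -> C) : Prop :=
  (forall z, upper z -> continuous f z) /\
  match n with
  | O => True
  | S m => (forall z, upper z -> ex_partials f z) /\
           Cn_upper m (partial_x f) /\ Cn_upper m (partial_y f)
  end.

Definition smooth_upper (f : C -> C) : Prop := forall n, Cn_upper n f.

Definition partial_z (f : C -> C) (z : C) : C :=
  / 2 * (partial_x f z - Ci * partial_y f z).

Definition partial_zbar (f : C -> C) (z : C) : C :=
  / 2 * (partial_x f z + Ci * partial_y f z).

(** * Integral matrices and the slash action *)

Record mat2 : Set := Mat2 { m11 : Z; m12 : Z; m21 : Z; m22 : Z }.

Definition SL2Z (g : mat2) : Prop :=
  (m11 g * m22 g - m12 g * m21 g = 1)%Z.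

(* The inverse of a matrix of determinant 1. *)
Definition mat2_inv (g : mat2) : mat2 :=
  Mat2 (m22 g) (- m12 g) (- m21 g) (m11 g).

Definition ZtoC (n : Z) : C := RtoC (IZR n).

Definition autfactor (g : mat2) (z : C) : C := ZtoC (m21 g) * z + ZtoC (m22 g).

Definition moebius (g : mat2) (z : C) : C :=
  (ZtoC (m11 g) * z + ZtoC (m12 g)) / autfactor g z.

Definition slash (w : Z) (f : C -> C) (g : mat2) (z : C) : C :=
  CpowZ (autfactor g z) (- w) * f (moebius g z).

Definition modular (w : Z) (f : C -> C) : Prop :=
  forall g, SL2Z g -> forall z, upper z -> slash w f g z = f z.

(** * Cusp forms and harmonic weak Maass forms *)

Definition cusp_form (w : Z) (f : C -> C) : Prop :=
  holomorphic_on upper f /\ modular w f /\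
  forall eps : R, (0 < eps)%R ->
    exists A : R, forall z, (0 < Im z)%R -> (A <= Im z)%R -> (Cmod (f z) < eps)%R.

Definition Laplacian (w : Z) (f : C -> C) (z : C) : C :=
  - RtoC (Im z ^ 2)%R *
      (partial_x (partial_x f) z + partial_y (partial_y f) z)
  + Ci * ZtoC w * RtoC (Im z) * (partial_x f z + Ci * partial_y f z).

Definition linear_exponential_growth (f : C -> C) : Prop :=
  exists A B c : R, forall z, (0 < Im z)%R -> (A <= Im z)%R ->
    (Cmod (f z) <= B * exp (c * Im z))%R.

Definition harmonic_weak_Maass_form (w : Z) (f : C -> C) : Prop :=
  smooth_upper f /\ modular w f /\
  (forall z, upper z -> Laplacian w f z = 0) /\
  linear_exponential_growth f.

Definition xi (w : Z) (f : C -> C) (z : C) : C :=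
  2 * Ci * RtoC (powerRZ (Im z) w) * Cconj (partial_zbar f z).

Definition Dop (f : C -> C) (z : C) : C :=
  / (2 * RtoC PI * Ci) * partial_z f z.

Definition Dop_iter (n : nat) (f : C -> C) : C -> C := Nat.iter n Dop f.

(* The space H_{2-2k}^cusp. *)
Definition Hcusp (k : nat) (f : C -> C) : Prop :=
  let w := (2 - 2 * Z.of_nat k)%Z in
  harmonic_weak_Maass_form w f /\
  cusp_form (2 * Z.of_nat k) (xi w f).

(** * Path integrals and regularized integrals *)

(* The integrand f(gamma(t)) gamma'(t) of the integral of f(w) dw along gamma. *)
Definition pullback (f : C -> C) (gamma : R -> C) (t : R) : C :=
  f (gamma t) *
  (Derive (fun s => Re (gamma s)) t, Derive (fun s => Im (gamma s)) t).

Definition is_path_integral (f : C -> C) (gamma : R -> C) (a b : R) (v : C) : Prop :=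
  @is_RInt C_R_NormedModule (pullback f gamma) a b v.

Definition vertical_ray (z0 : C) (t : R) : C := z0 + Ci * RtoC t.

Definition is_integral_to_ioo (f : C -> C) (z0 v : C) : Prop :=
  @is_RInt_gen C_R_NormedModule (pullback f (vertical_ray z0))
    (at_point 0%R) (Rbar_locally p_infty) v.

(* R.int_{z0}^{i oo} f(w) dw = v : the integral of e^{uiw} f(w), which converges
   for Re u > A, continues holomorphically along a connected open set U from
   that half-plane to u = 0, where the continuation Phi takes the value v. *)
Definition is_reg_integral_ioo (f : C -> C) (z0 v : C) : Prop :=
  exists (A : R) (U : C -> Prop) (Phi : C -> C),
    connected_open U /\
    (forall u : C, (A < Re u)%R -> U u) /\
    U 0 /\
    holomorphic_on U Phi /\
    (forall u : C, (A < Re u)%R ->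
       is_integral_to_ioo (fun w => Cexp (u * Ci * w) * f w) z0 (Phi u)) /\
    Phi 0 = v.

Inductive cusp : Set :=
  | Cusp_ioo : cusp
  | Cusp_real : R -> cusp.

Definition maps_ioo_to (s : mat2) (a : cusp) : Prop :=
  SL2Z s /\
  match a with
  | Cusp_ioo => m21 s = 0%Z
  | Cusp_real x => m21 s <> 0%Z /\ (IZR (m11 s) / IZR (m21 s) = x)%R
  end.

Definition is_reg_integral_to (f : C -> C) (z0 : C) (a : cusp) (v : C) : Prop :=
  forall s, maps_ioo_to s a ->
    is_reg_integral_ioo (slash 2 f s) (moebius (mat2_inv s) z0) v.

Definition is_reg_integral (f : C -> C) (a b : cusp) (v : C) : Prop :=
  forall z0, upper z0 ->
    exists va vb : C,
      is_reg_integral_to f z0 a va /\ is_reg_integral_to f z0 b vb /\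
      v = vb - va.

(** * Binary quadratic forms and cycle integrals *)

Record bqf : Set := BQF { qa : Z; qb : Z; qc : Z }.

Definition qdisc (Q : bqf) : Z := (qb Q * qb Q - 4 * qa Q * qc Q)%Z.

Definition discriminant (D : Z) : Prop :=
  (D mod 4 = 0)%Z \/ (D mod 4 = 1)%Z.

Definition is_square (D : Z) : Prop := exists n : Z, D = (n * n)%Z.

(* Q(z,1) *)
Definition qeval (Q : bqf) (z : C) : C :=
  ZtoC (qa Q) * (z * z) + ZtoC (qb Q) * z + ZtoC (qc Q).

Definition geodesic (Q : bqf) (z : C) : Prop :=
  upper z /\
  (IZR (qa Q) * (Cmod z) ^ 2 + IZR (qb Q) * Re z + IZR (qc Q) = 0)%R.

Definition content (Q : bqf) : Z := Z.gcd (Z.gcd (qa Q) (qb Q)) (qc Q).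

Definition primitive_part (Q : bqf) : bqf :=
  BQF (qa Q / content Q) (qb Q / content Q) (qc Q / content Q).

Definition positive_pell (D t u : Z) : Prop :=
  (0 < t /\ 0 < u /\ t * t - D * (u * u) = 4)%Z.

Definition smallest_pell (D t u : Z) : Prop :=
  positive_pell D t u /\
  forall t' u', positive_pell D t' u' -> (t <= t' /\ u <= u')%Z.

(* The divisions by 2 are exact: t = b u modulo 2 as soon as
   t^2 - qdisc P * u^2 = 4. *)
Definition is_gQ (Q : bqf) (g : mat2) : Prop :=
  let P := primitive_part Q in
  exists t u, smallest_pell (qdisc P) t u /\
    g = Mat2 ((t + qb P * u) / 2) (qc P * u)
             (- (qa P * u)) ((t - qb P * u) / 2).

(* For qa Q <> 0, the semicircle [geodesic Q], by the angle at its centre. *)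
Definition semicircle (Q : bqf) (theta : R) : C :=
  let r := (sqrt (IZR (qdisc Q)) / (2 * Rabs (IZR (qa Q))))%R in
  (- IZR (qb Q) / (2 * IZR (qa Q)) + r * cos theta, r * sin theta)%R.

(* v is the integral of f along the arc of the semicircle from z to z'. *)
Definition is_arc_integral (f : C -> C) (Q : bqf) (z z' v : C) : Prop :=
  exists theta theta' : R,
    (0 < theta < PI)%R /\ (0 < theta' < PI)%R /\
    semicircle Q theta = z /\ semicircle Q theta' = z' /\
    is_path_integral f (semicircle Q) theta theta' v.

(* For a <> 0 the geodesic is directed counterclockwise if a > 0 and clockwise
   if a < 0; in both cases it starts at (-b + sqrt D)/(2a) and ends at
   (-b - sqrt D)/(2a).  For a = 0 it runs from -c/b up to i oo. *)
Definition geodesic_start (Q : bqf) : cusp :=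
  if Z.eq_dec (qa Q) 0
  then Cusp_real (- IZR (qc Q) / IZR (qb Q))
  else Cusp_real ((- IZR (qb Q) + sqrt (IZR (qdisc Q))) / (2 * IZR (qa Q))).

Definition geodesic_end (Q : bqf) : cusp :=
  if Z.eq_dec (qa Q) 0
  then Cusp_ioo
  else Cusp_real ((- IZR (qb Q) - sqrt (IZR (qdisc Q))) / (2 * IZR (qa Q))).

(* v is the cycle integral C(F;Q) of a function F of weight 2k. *)
Definition is_cycle_integral (k : nat) (F : C -> C) (Q : bqf) (v : C) : Prop :=
  let f := fun z => F z * Cpow (qeval Q z) (k - 1) in
  (~ is_square (qdisc Q) ->
     forall g z, is_gQ Q g -> geodesic Q z ->
       is_arc_integral f Q z (moebius g z) v) /\
  (is_square (qdisc Q) ->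
     is_reg_integral f (geodesic_start Q) (geodesic_end Q) v).

(* Main.v *)
(** Put n = 2k-2, let g = xi(M), and let P = Q(z,1)^(k-1), a polynomial of
    degree at most n. The bracket H(f,P) = sum_(j <= n) (-1)^j f^(n-j) P^(j)
    (derivatives in z) satisfies dH = f^(n+1) P dz + (terms in dz-bar), and it is
    SL_2-equivariant for functions f, P of weight -n. For f = M its dz-bar
    part is a multiple of the conjugate of g P dz, so D^(2k-1)(M) P dz plus a
    multiple of that conjugate is the differential of an invariant function.

    To integrate, g is written as the (n+1)-st derivative of a periodic
    holomorphic E, and M = M+ + M-, with M- an explicit Taylor sum in the
    derivatives of E, for which H(M-,P) is a multiple of the conjugate of H(E,P).
    Then H(E,P) and H(M+,P) are holomorphic primitives of g P and, up to a
    constant, of D^(2k-1)(M) P. For non-square D the cycle integrals are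
    differences of their values at z and g_Q z. For square D, the regularised
    integral of f^(n+1) P from z to i-infinity is -H(f,P)(z) as soon as the
    periodic holomorphic f has mean zero and at most exponential growth:
    comparing the vertical rays from z and z+1 gives
      (1 - e^(iu)) F_P(u) = (integral over [z,z+1]) + e^(iu) F_(P(.+1) - P)(u),
    which continues u^d F_P(u) to a neighbourhood of 0 for deg P < d, and partial
    integrations remove the remaining pole. *)
Require Import Defs.
From Stdlib Require Import Reals ZArith.
From Coquelicot Require Import Coquelicot.
From Stdlib Require Import Lra Lia List ClassicalEpsilon.
Open Scope C_scope.

(** No Fourier expansion is used: periodic primitives come from an integral kernel, and the growth
    of the derivatives of M+ from Cauchy's estimate. The delicate point is a constant term. A
    primitive of a periodic function is periodic only if its mean vanishes; for g this follows from
    decay at the cusp, but M+ has a mean a0, which is subtracted and reappears in the bracket as a0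
    P^(n), up to sign. Now P^(n) is a constant, the same at z and g_Q z; and for square D, moving an
    endpoint to i-infinity kills the leading coefficient of Q, so that P^(n) is 0 at both ends, or 1
    at both ends if k = 1. Hence a0 cancels from every difference. The regularised integral costs
    one primitive more than the bracket: degree n may create a pole of order n+1 at u = 0, n+1
    partial integrations remove it, and one more yields the value. E and M+ are periodic but not
    invariant; at each cusp H(M+,P) is therefore rewritten through the invariant H(M,P) and the
    conjugate of H(E,P). The constant n!/(4 pi)^(n+1) is (2 pi i)^(-n-1) times i n!/(2 (2i)^n), with
    n even. *)

Lemma C_pair_intro (z w : C) : Re z = Re w -> Im z = Im w -> z = w.
Proof. destruct z, w; simpl; congruence. Qed.

Lemma Ci_sqr : Ci * Ci = Copp 1.
Proof. apply C_pair_intro; simpl; ring. Qed.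

Lemma Cmod_sub_comm (x y : C) : Cmod (x - y) = Cmod (y - x).
Proof. rewrite <- Cmod_opp. f_equal. ring. Qed.

Lemma Im_le_Cmod (z : C) : (Rabs (Im z) <= Cmod z)%R.
Proof. apply Rle_trans with (2 := Rmax_Cmod z). apply Rmax_r. Qed.

Lemma Cmod_triangle_sub (x y : C) : (Cmod x <= Cmod y + Cmod (x - y))%R.
Proof. replace x with (y + (x - y)) at 1 by ring. apply Cmod_triangle. Qed.

(** * Wirtinger derivatives and their rules *)

Definition littleo (r : C -> C) : Prop :=
  forall eps, (0 < eps)%R -> exists d, (0 < d)%R /\
    forall h, (Cmod h < d)%R -> (Cmod (r h) <= eps * Cmod h)%R.

(* The real differential of [f] at [z] is [h => a h + b (conj h)]: [a] and [b]
   are the Wirtinger derivatives, and [b = 0] is complex differentiability. *)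
Definition wd (f : C -> C) (z a b : C) : Prop :=
  littleo (fun h => f (z + h) - f z - a * h - b * Cconj h).

Lemma littleo_ext (r s : C -> C) : (forall h, r h = s h) -> littleo r -> littleo s.
Proof.
  intros E H eps He. destruct (H eps He) as (d & Hd & K).
  exists d; split; auto. intros h Hh. rewrite <- E. auto.
Qed.

Lemma littleo_plus (r s : C -> C) :
  littleo r -> littleo s -> littleo (fun h => r h + s h).
Proof.
  intros Hr Hs eps He.
  destruct (Hr (eps / 2)%R) as (d & Hd & K); [lra|].
  destruct (Hs (eps / 2)%R) as (d' & Hd' & K'); [lra|].
  exists (Rmin d d'); split; [apply Rmin_pos; auto|]. intros h Hh.
  specialize (K h (Rlt_le_trans _ _ _ Hh (Rmin_l _ _))).
  specialize (K' h (Rlt_le_trans _ _ _ Hh (Rmin_r _ _))).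
  apply Rle_trans with (1 := Cmod_triangle _ _). lra.
Qed.

Lemma littleo_mult_bounded (B : R) (r m : C -> C) :
  (exists d, (0 < d)%R /\ forall h, (Cmod h < d)%R -> (Cmod (m h) <= B)%R) ->
  littleo r -> littleo (fun h => r h * m h).
Proof.
  intros (d0 & Hd0 & Hm) Hr eps He.
  assert (HB : (0 < Rmax B 1)%R) by (apply Rlt_le_trans with (2 := Rmax_r _ _); lra).
  destruct (Hr (eps / Rmax B 1)%R) as (d & Hd & K).
  { apply Rdiv_lt_0_compat; auto. }
  exists (Rmin d0 d); split; [apply Rmin_pos; auto|]. intros h Hh.
  specialize (K h (Rlt_le_trans _ _ _ Hh (Rmin_r _ _))).
  specialize (Hm h (Rlt_le_trans _ _ _ Hh (Rmin_l _ _))).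
  rewrite Cmod_mult.
  apply Rle_trans with ((eps / Rmax B 1 * Cmod h) * Rmax B 1)%R.
  - apply Rmult_le_compat; auto using Cmod_ge_0.
    apply Rle_trans with (1 := Hm), Rmax_l.
  - right. field. lra.
Qed.

Lemma littleo_mult_linear (r l : C -> C) (L : R) :
  (forall h, (Cmod (l h) <= L * Cmod h)%R) ->
  (forall eps, (0 < eps)%R -> exists d, (0 < d)%R /\
     forall h, (Cmod h < d)%R -> (Cmod (r h) <= eps)%R) ->
  littleo (fun h => r h * l h).
Proof.
  intros Hl Hr eps He.
  assert (HL : (0 < Rmax L 1)%R) by (apply Rlt_le_trans with (2 := Rmax_r _ _); lra).
  destruct (Hr (eps / Rmax L 1)%R) as (d & Hd & K).
  { apply Rdiv_lt_0_compat; auto. }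
  exists d; split; auto. intros h Hh. rewrite Cmod_mult.
  apply Rle_trans with ((eps / Rmax L 1) * (Rmax L 1 * Cmod h))%R.
  - apply Rmult_le_compat; auto using Cmod_ge_0.
    apply Rle_trans with (1 := Hl h). apply Rmult_le_compat_r; auto using Cmod_ge_0.
    apply Rmax_l.
  - right. field. lra.
Qed.

Lemma wd_lin_bound (a b h : C) :
  (Cmod (a * h + b * Cconj h) <= (Cmod a + Cmod b) * Cmod h)%R.
Proof.
  apply Rle_trans with (1 := Cmod_triangle _ _).
  rewrite !Cmod_mult, Cmod_conj. lra.
Qed.

Lemma wd_lipschitz (f : C -> C) (z a b : C) : wd f z a b ->
  exists d, (0 < d)%R /\ forall h, (Cmod h < d)%R ->
    (Cmod (f (z + h)%C - f z) <= (Cmod a + Cmod b + 1) * Cmod h)%R.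
Proof.
  intros H. destruct (H 1%R Rlt_0_1) as (d & Hd & K).
  exists d; split; auto. intros h Hh. specialize (K h Hh).
  replace (f (z + h) - f z) with
    ((a * h + b * Cconj h) + (f (z + h) - f z - a * h - b * Cconj h)) by ring.
  apply Rle_trans with (1 := Cmod_triangle _ _).
  generalize (wd_lin_bound a b h). lra.
Qed.

Lemma wd_small (f : C -> C) (z a b : C) : wd f z a b ->
  forall eps, (0 < eps)%R -> exists d, (0 < d)%R /\
    forall h, (Cmod h < d)%R -> (Cmod (f (z + h)%C - f z) <= eps)%R.
Proof.
  intros H eps He. destruct (wd_lipschitz _ _ _ _ H) as (d & Hd & K).
  set (L := (Cmod a + Cmod b + 1)%R) in *.
  assert (HL : (0 < L)%R)
    by (unfold L; generalize (Cmod_ge_0 a) (Cmod_ge_0 b); lra).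
  exists (Rmin d (eps / L)); split.
  { apply Rmin_pos; auto. apply Rdiv_lt_0_compat; auto. }
  intros h Hh.
  apply Rle_trans with (1 := K h (Rlt_le_trans _ _ _ Hh (Rmin_l _ _))).
  apply Rle_trans with (L * (eps / L))%R.
  - apply Rmult_le_compat_l; [lra|]. left. apply Rlt_le_trans with (1 := Hh), Rmin_r.
  - right; field; lra.
Qed.

Lemma wd_eq (f g : C -> C) (z a b a' b' : C) :
  wd f z a b -> (forall w, f w = g w) -> a = a' -> b = b' -> wd g z a' b'.
Proof.
  intros H E <- <-. apply littleo_ext with (2 := H). intros h. now rewrite !E.
Qed.

Lemma wd_ext_loc (f g : C -> C) (z a b : C) :
  (exists d, (0 < d)%R /\ forall h, (Cmod h < d)%R -> f (z + h) = g (z + h)) ->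
  wd f z a b -> wd g z a b.
Proof.
  intros (d & Hd & E) H eps He. destruct (H eps He) as (d' & Hd' & K).
  exists (Rmin d d'); split; [apply Rmin_pos; auto|]. intros h Hh.
  rewrite <- E by (apply Rlt_le_trans with (1 := Hh), Rmin_l).
  replace (g z) with (f z).
  - apply K. apply Rlt_le_trans with (1 := Hh), Rmin_r.
  - replace z with (z + 0) by ring. apply E. now rewrite Cmod_0.
Qed.

Lemma wd_const (c z : C) : wd (fun _ => c) z 0 0.
Proof.
  intros eps He. exists 1%R; split; [lra|]. intros h _.
  replace (c - c - 0 * h - 0 * Cconj h) with (RtoC 0) by ring.
  rewrite Cmod_0. generalize (Cmod_ge_0 h). nra.
Qed.

Lemma wd_id (z : C) : wd (fun w => w) z 1 0.
Proof.
  intros eps He. exists 1%R; split; [lra|]. intros h _.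
  replace (z + h - z - 1 * h - 0 * Cconj h) with (RtoC 0) by ring.
  rewrite Cmod_0. generalize (Cmod_ge_0 h). nra.
Qed.

Lemma wd_plus (f g : C -> C) (z a b a' b' : C) :
  wd f z a b -> wd g z a' b' -> wd (fun w => f w + g w) z (a + a') (b + b').
Proof.
  intros Hf Hg. apply littleo_ext with (2 := littleo_plus _ _ Hf Hg).
  intros h. ring.
Qed.

Lemma wd_mult (f g : C -> C) (z a b a' b' : C) :
  wd f z a b -> wd g z a' b' ->
  wd (fun w => f w * g w) z (a * g z + f z * a') (b * g z + f z * b').
Proof.
  intros Hf Hg.
  apply littleo_ext with
    (fun h => (g (z + h) - g z - a' * h - b' * Cconj h) * f (z + h)
      + ((f (z + h) - f z - a * h - b * Cconj h) * g z
      + (f (z + h) - f z) * (a' * h + b' * Cconj h))).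
  { intros h. ring. }
  apply littleo_plus; [|apply littleo_plus].
  - apply littleo_mult_bounded with (2 := Hg) (B := (Cmod (f z) + 1)%R).
    destruct (wd_small _ _ _ _ Hf 1%R Rlt_0_1) as (d & Hd & K).
    exists d; split; auto. intros h Hh.
    apply Rle_trans with (1 := Cmod_triangle_sub _ (f z)).
    specialize (K h Hh). lra.
  - apply littleo_mult_bounded with (2 := Hf) (B := Cmod (g z)).
    exists 1%R; split; [lra|]. intros; lra.
  - apply littleo_mult_linear with (1 := wd_lin_bound a' b').
    apply wd_small with (1 := Hf).
Qed.

Lemma wd_scal (c : C) (f : C -> C) (z a b : C) :
  wd f z a b -> wd (fun w => c * f w) z (c * a) (c * b).
Proof.
  intros H. apply wd_eq with (1 := wd_mult _ _ _ _ _ _ _ (wd_const c z) H);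
  auto; ring.
Qed.

Lemma wd_opp (f : C -> C) (z a b : C) :
  wd f z a b -> wd (fun w => - f w) z (- a) (- b).
Proof.
  intros H. apply wd_eq with (1 := wd_scal (Copp 1) _ _ _ _ H);
  intros; ring.
Qed.

Lemma wd_minus (f g : C -> C) (z a b a' b' : C) :
  wd f z a b -> wd g z a' b' -> wd (fun w => f w - g w) z (a - a') (b - b').
Proof. intros Hf Hg. exact (wd_plus _ _ _ _ _ _ _ Hf (wd_opp _ _ _ _ Hg)). Qed.

Lemma Cconj_plus (x y : C) : Cconj (x + y) = Cconj x + Cconj y.
Proof. apply C_pair_intro; unfold Re, Im; simpl; ring. Qed.
Lemma Cconj_opp (x : C) : Cconj (- x) = - Cconj x.
Proof. apply C_pair_intro; unfold Re, Im; simpl; ring. Qed.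
Lemma Cconj_minus (x y : C) : Cconj (x - y) = Cconj x - Cconj y.
Proof. apply C_pair_intro; unfold Re, Im; simpl; ring. Qed.
Lemma Cconj_mult (x y : C) : Cconj (x * y) = Cconj x * Cconj y.
Proof. apply C_pair_intro; unfold Re, Im; simpl; ring. Qed.
Lemma Cconj_invol (x : C) : Cconj (Cconj x) = x.
Proof. apply C_pair_intro; unfold Re, Im; simpl; ring. Qed.
Lemma Cconj_RtoC (x : R) : Cconj (RtoC x) = RtoC x.
Proof. apply C_pair_intro; unfold Re, Im; simpl; ring. Qed.

Lemma wd_conj (f : C -> C) (z a b : C) :
  wd f z a b -> wd (fun w => Cconj (f w)) z (Cconj b) (Cconj a).
Proof.
  intros H eps He. destruct (H eps He) as (d & Hd & K). exists d; split; auto.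
  intros h Hh. specialize (K h Hh). rewrite <- Cmod_conj in K.
  apply Rle_trans with (2 := K). right. f_equal.
  rewrite !Cconj_minus, !Cconj_mult, Cconj_invol. ring.
Qed.

(** The error splits into the remainder of f at the increment of g, small because g is locally
    Lipschitz, and the images of the remainder of g under [a] and [b]. *)
Lemma wd_comp (f g : C -> C) (z a b c d : C) :
  wd f (g z) a b -> wd g z c d ->
  wd (fun w => f (g w)) z (a * c + b * Cconj d) (a * d + b * Cconj c).
Proof.
  intros Hf Hg.
  apply littleo_ext with
    (fun h => ((f (g z + (g (z + h) - g z)) - f (g z) - a * (g (z + h) - g z)
               - b * Cconj (g (z + h) - g z))
       + (((g (z + h) - g z - c * h - d * Cconj h) * a)
       + (Cconj (g (z + h) - g z - c * h - d * Cconj h) * b)))).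
  { intros h. replace (g z + (g (z + h) - g z)) with (g (z + h)) by ring.
    rewrite !Cconj_minus, !Cconj_mult, Cconj_invol. ring. }
  assert (Hbd : forall c : C, exists d, (0 < d)%R /\
     forall h : C, (Cmod h < d)%R -> (Cmod c <= Cmod c)%R).
  { intros c0. exists 1%R; split; [lra|]. intros; lra. }
  apply littleo_plus; [|apply littleo_plus].
  - destruct (wd_lipschitz _ _ _ _ Hg) as (d1 & Hd1 & K1).
    set (L := (Cmod c + Cmod d + 1)%R) in *.
    assert (HL : (0 < L)%R)
      by (unfold L; generalize (Cmod_ge_0 c) (Cmod_ge_0 d); lra).
    intros eps He. destruct (Hf (eps / L)%R) as (d2 & Hd2 & K2).
    { apply Rdiv_lt_0_compat; auto. }
    destruct (wd_small _ _ _ _ Hg (d2 / 2)%R) as (d3 & Hd3 & K3); [lra|].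
    exists (Rmin d1 d3); split; [apply Rmin_pos; auto|]. intros h Hh.
    specialize (K1 h (Rlt_le_trans _ _ _ Hh (Rmin_l _ _))).
    specialize (K3 h (Rlt_le_trans _ _ _ Hh (Rmin_r _ _))).
    apply Rle_trans with (1 := K2 (g (z + h) - g z) ltac:(lra)).
    apply Rle_trans with (eps / L * (L * Cmod h))%R.
    + apply Rmult_le_compat_l; auto. left. apply Rdiv_lt_0_compat; auto.
    + right. field. lra.
  - apply littleo_mult_bounded with (1 := Hbd a) (2 := Hg).
  - apply littleo_mult_bounded with (1 := Hbd b).
    intros eps He. destruct (Hg eps He) as (d' & Hd' & K). exists d'; split; auto.
    intros h Hh. rewrite Cmod_conj. auto.
Qed.

Lemma wd_inv_id (z : C) : z <> 0 -> wd (fun w => / w) z (- / (z * z)) 0.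
Proof.
  intros Hz. assert (Hm := proj1 (Cmod_gt_0 z) Hz). set (m := Cmod z) in *.
  intros eps He.
  (* The first bound keeps |z + h| >= m/2; with it, the second makes the exact remainder h^2 / (z^2
     (z + h)) at most eps |h|. *)
  exists (Rmin (m / 2) (eps * (m * m * m) / 2))%R; split.
  { apply Rmin_pos; [lra|]. apply Rdiv_lt_0_compat; [|lra].
    repeat apply Rmult_lt_0_compat; auto. }
  intros h Hh.
  assert (H1 := Rlt_le_trans _ _ _ Hh (Rmin_l _ _)).
  assert (H2 := Rlt_le_trans _ _ _ Hh (Rmin_r _ _)).
  assert (H3 : (m / 2 <= Cmod (z + h))%R).
  { generalize (Cmod_triangle_sub z (z + h)).
    replace (z - (z + h)) with (- h) by ring. rewrite Cmod_opp. fold m. lra. }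
  assert (Hzh : z + h <> 0) by (apply Cmod_gt_0; lra).
  replace (/ (z + h) - / z - - / (z * z) * h - 0 * Cconj h)
    with (h * h / (z * z * (z + h))) by (field; auto).
  rewrite Cmod_div by (repeat apply Cmult_neq_0; auto).
  rewrite !Cmod_mult. fold m.
  assert (H0 := Cmod_ge_0 h).
  apply Rle_div_l; [repeat apply Rmult_lt_0_compat; lra|].
  apply Rle_trans with (Cmod h * (eps * (m * m * m) / 2))%R.
  - apply Rmult_le_compat_l; lra.
  - apply Rle_trans with (Cmod h * (eps * (m * m * (m / 2))))%R.
    + right. field.
    + rewrite (Rmult_comm eps (Cmod h)), !Rmult_assoc. apply Rmult_le_compat_l; auto.
      apply Rmult_le_compat_l; [lra|]. repeat apply Rmult_le_compat_l; lra.
Qed.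

Lemma wd_inv (f : C -> C) (z a : C) :
  f z <> 0 -> wd f z a 0 -> wd (fun w => / f w) z (- a / (f z * f z)) 0.
Proof.
  intros Hz H. apply wd_eq with (1 := wd_comp _ _ _ _ _ _ _ (wd_inv_id _ Hz) H); auto.
  - unfold Cdiv. ring.
  - ring.
Qed.

(** A real-linear map that is o(h) vanishes along every ray; the directions 1 and i then separate
    the two coefficients. *)
Lemma wd_unique (f : C -> C) (z a b a' b' : C) :
  wd f z a b -> wd f z a' b' -> a = a' /\ b = b'.
Proof.
  intros H H'.
  assert (K := wd_minus _ _ _ _ _ _ _ H H').
  set (c := a - a') in *. set (e := b - b') in *.
  assert (L : forall v : C, v <> 0 -> c * v + e * Cconj v = 0).
  { intros v Hv. apply Cmod_eq_0. apply Rle_antisym; [|apply Cmod_ge_0].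
    apply le_epsilon. intros eps He. rewrite Rplus_0_l.
    assert (Hm := proj1 (Cmod_gt_0 v) Hv).
    destruct (K (eps / Cmod v)%R) as (d & Hd & K').
    { apply Rdiv_lt_0_compat; auto. }
    set (t := (d / 2 / Cmod v)%R).
    assert (Ht : (0 < t)%R) by (apply Rdiv_lt_0_compat; lra).
    assert (E : Cmod (RtoC t * v) = (d / 2)%R).
    { rewrite Cmod_mult, Cmod_R, Rabs_pos_eq by lra. unfold t. field. lra. }
    specialize (K' (RtoC t * v)). rewrite E in K'. specialize (K' ltac:(lra)).
    replace (f (z + RtoC t * v) - f (z + RtoC t * v) - (f z - f z) - c * (RtoC t * v)
       - e * Cconj (RtoC t * v)) with (- (RtoC t) * (c * v + e * Cconj v)) in K'
      by (rewrite Cconj_mult, Cconj_RtoC; ring).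
    rewrite Cmod_mult, Cmod_opp, Cmod_R, Rabs_pos_eq in K' by lra.
    apply Rmult_le_reg_l with (1 := Ht). apply Rle_trans with (1 := K').
    unfold t. right. field. lra. }
  assert (L1 := L 1 ltac:(apply Cmod_gt_0; rewrite Cmod_1; lra)).
  assert (Li := L Ci ltac:(apply Cmod_gt_0; rewrite Cmod_Ci; lra)).
  replace (Cconj 1) with (RtoC 1) in L1 by (apply C_pair_intro; simpl; ring).
  replace (Cconj Ci) with (- Ci) in Li by (apply C_pair_intro; simpl; ring).
  assert (E1 : c + e = 0) by (rewrite <- L1; ring).
  assert (E2 : c - e = 0).
  { replace (c - e) with (- Ci * (c * Ci + e * - Ci)).
    - rewrite Li. ring.
    - replace (- Ci * (c * Ci + e * - Ci)) with (- (Ci * Ci) * (c - e)) by ring.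
      rewrite Ci_sqr. ring. }
  assert (E3 : c = 0).
  { replace c with (/ 2 * ((c + e) + (c - e))) by field. rewrite E1, E2. ring. }
  assert (E4 : e = 0).
  { replace e with (/ 2 * ((c + e) - (c - e))) by field. rewrite E1, E2. ring. }
  unfold c, e in *. split.
  - replace a with ((a - a') + a') by ring. rewrite E3. ring.
  - replace b with ((b - b') + b') by ring. rewrite E4. ring.
Qed.

Lemma wd_pow (f : C -> C) (z a : C) (n : nat) :
  wd f z a 0 -> wd (fun w => f w ^ n) z (INR n * f z ^ pred n * a) 0.
Proof.
  intros H. induction n as [|n IH].
  - apply wd_eq with (1 := wd_const 1 z); auto. simpl. ring.
  - apply wd_eq with (1 := wd_mult _ _ _ _ _ _ _ H IH).
    + reflexivity.
    + rewrite S_INR, RtoC_plus. destruct n as [|n]; [simpl; ring|]. change (pred (S n)) with n. change (pred (S (S n))) with (S n). rewrite Cpow_S. ring.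
    + ring.
Qed.

(** * Continuity *)

Lemma continuous_C_intro {T : UniformSpace} (f : T -> C) (x : T) :
  continuous (fun t => Re (f t)) x -> continuous (fun t => Im (f t)) x ->
  continuous (U := C_UniformSpace) f x.
Proof.
  intros H1 H2 P [eps HP].
  assert (K1 : locally x (fun t => ball (Re (f x)) eps (Re (f t))))
    by exact (H1 (ball (Re (f x)) eps) (locally_ball _ _)).
  assert (K2 : locally x (fun t => ball (Im (f x)) eps (Im (f t))))
    by exact (H2 (ball (Im (f x)) eps) (locally_ball _ _)).
  refine (filter_imp _ _ _ (filter_and _ _ K1 K2)). intros t [A B]. apply HP. split; assumption.
Qed.

Lemma continuous_Re {T : UniformSpace} (f : T -> C) (x : T) :
  continuous (U := C_UniformSpace) f x -> continuous (fun t => Re (f t)) x.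
Proof.
  intros H. apply (continuous_comp f (fun p : C_UniformSpace => fst p : R_UniformSpace)); auto.
  apply continuous_fst.
Qed.

Lemma continuous_Im {T : UniformSpace} (f : T -> C) (x : T) :
  continuous (U := C_UniformSpace) f x -> continuous (fun t => Im (f t)) x.
Proof.
  intros H. apply (continuous_comp f (fun p : C_UniformSpace => snd p : R_UniformSpace)); auto.
  apply continuous_snd.
Qed.

(** The balls of the product uniformity on C are squares; sqrt 2 <= 2 compares them with the discs
    of [Cmod]. *)
Lemma continuous_C_eps {T : UniformSpace} (f : T -> C) (x : T) :
  continuous (U := C_UniformSpace) f x <->
  forall eps, (0 < eps)%R -> locally x (fun y => Cmod (f y - f x) < eps)%R.
Proof.
  split.
  - intros H eps He.
    assert (He2 : (0 < eps / 2)%R) by lra.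
    assert (K : locally x (fun t => ball (M := C_UniformSpace) (f x) (mkposreal _ He2) (f t)))
      by exact (H (ball (f x) (mkposreal _ He2)) (locally_ball _ _)).
    refine (filter_imp _ _ _ K). intros t [A B].
    change (Rabs (Re (f t) - Re (f x)) < eps / 2)%R in A.
    change (Rabs (Im (f t) - Im (f x)) < eps / 2)%R in B.
    apply Rle_lt_trans with (1 := Cmod_2Rmax _).
    apply Rlt_le_trans with (sqrt 2 * (eps / 2))%R.
    + apply Rmult_lt_compat_l; [apply sqrt_lt_R0; lra|].
      apply Rmax_lub_lt; assumption.
    + assert (sqrt 2 <= 2)%R.
      { rewrite <- (sqrt_square 2) at 2 by lra. apply sqrt_le_1; lra. }
      nra.
  - intros H. apply continuous_C_intro; intros P [eps HP];
    refine (filter_imp _ _ _ (H eps (cond_pos eps)));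
    intros t A; apply HP.
    + apply Rle_lt_trans with (2 := A). apply (re_le_Cmod (f t - f x)).
    + apply Rle_lt_trans with (2 := A). apply (Im_le_Cmod (f t - f x)).
Qed.

Lemma locally_C_Cmod (z : C) (P : C -> Prop) :
  locally (T := C_UniformSpace) z P <->
  exists d, (0 < d)%R /\ forall w, (Cmod (w - z) < d)%R -> P w.
Proof.
  split.
  - intros [eps H]. exists eps; split; [apply cond_pos|]. intros w Hw. apply H. split.
    + apply Rle_lt_trans with (2 := Hw). apply (re_le_Cmod (w - z)).
    + apply Rle_lt_trans with (2 := Hw). apply (Im_le_Cmod (w - z)).
  - intros (d & Hd & H).
    assert (Hd2 : (0 < d / 2)%R) by lra.
    exists (mkposreal _ Hd2). intros w [A B]. apply H.
    change (Rabs (Re w - Re z) < d / 2)%R in A.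
    change (Rabs (Im w - Im z) < d / 2)%R in B.
    apply Rle_lt_trans with (1 := Cmod_2Rmax _).
    apply Rlt_le_trans with (sqrt 2 * (d / 2))%R.
    + apply Rmult_lt_compat_l; [apply sqrt_lt_R0; lra|].
      apply Rmax_lub_lt; assumption.
    + assert (sqrt 2 <= 2)%R.
      { rewrite <- (sqrt_square 2) at 2 by lra. apply sqrt_le_1; lra. }
      nra.
Qed.

Lemma wd_continuous (f : C -> C) (z a b : C) : wd f z a b -> continuous f z.
Proof.
  intros H. apply (continuous_C_eps f z). intros eps He.
  apply locally_C_Cmod.
  destruct (wd_small _ _ _ _ H (eps / 2)%R) as (d & Hd & K); [lra|].
  exists d; split; auto. intros w Hw. specialize (K (w - z) Hw).
  replace (z + (w - z)) with w in K by ring. lra.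
Qed.

Section ContinuousC.
Variable T : UniformSpace.
Implicit Types (f g : T -> C) (x : T).

Lemma continuous_Cconst (c : C) x : continuous (U := C_UniformSpace) (fun _ : T => c) x.
Proof. apply continuous_const. Qed.

Lemma continuous_RtoC (f : T -> R) x :
  continuous f x -> continuous (U := C_UniformSpace) (fun t => RtoC (f t)) x.
Proof. intros H. apply continuous_C_intro; simpl; auto. apply continuous_const. Qed.

Lemma continuous_Cplus f g x :
  continuous (U := C_UniformSpace) f x -> continuous (U := C_UniformSpace) g x ->
  continuous (U := C_UniformSpace) (fun t => f t + g t) x.
Proof.
  intros Hf Hg. apply continuous_C_intro; simpl.
  - apply (continuous_plus (V := R_NormedModule) (fun t => Re (f t)) (fun t => Re (g t)));
    apply continuous_Re; auto.
  - apply (continuous_plus (V := R_NormedModule) (fun t => Im (f t)) (fun t => Im (g t)));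
    apply continuous_Im; auto.
Qed.

Lemma continuous_Copp f x :
  continuous (U := C_UniformSpace) f x ->
  continuous (U := C_UniformSpace) (fun t => - f t) x.
Proof.
  intros Hf. apply continuous_C_intro; simpl.
  - apply (continuous_opp (V := R_NormedModule) (fun t => Re (f t))).
    apply continuous_Re; auto.
  - apply (continuous_opp (V := R_NormedModule) (fun t => Im (f t))).
    apply continuous_Im; auto.
Qed.

Lemma continuous_Cminus f g x :
  continuous (U := C_UniformSpace) f x -> continuous (U := C_UniformSpace) g x ->
  continuous (U := C_UniformSpace) (fun t => f t - g t) x.
Proof. intros. apply continuous_Cplus; auto. apply continuous_Copp; auto. Qed.

Lemma continuous_Cmult f g x :
  continuous (U := C_UniformSpace) f x -> continuous (U := C_UniformSpace) g x ->
  continuous (U := C_UniformSpace) (fun t => f t * g t) x.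
Proof.
  intros Hf Hg. apply continuous_C_intro; simpl.
  - apply (continuous_minus (V := R_NormedModule) (fun t => Re (f t) * Re (g t))%R
      (fun t => Im (f t) * Im (g t))%R);
    apply (continuous_mult (K := R_AbsRing)); auto using continuous_Re, continuous_Im.
  - apply (continuous_plus (V := R_NormedModule) (fun t => Re (f t) * Im (g t))%R
      (fun t => Im (f t) * Re (g t))%R);
    apply (continuous_mult (K := R_AbsRing)); auto using continuous_Re, continuous_Im.
Qed.

Lemma continuous_Cconj f x :
  continuous (U := C_UniformSpace) f x ->
  continuous (U := C_UniformSpace) (fun t => Cconj (f t)) x.
Proof.
  intros Hf. apply continuous_C_intro; simpl.
  - apply continuous_Re; auto.
  - apply (continuous_opp (V := R_NormedModule) (fun t => Im (f t))).
    apply continuous_Im; auto.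
Qed.

Lemma continuous_C_comp (h : C -> C) f x :
  continuous h (f x) -> continuous (U := C_UniformSpace) f x ->
  continuous (U := C_UniformSpace) (fun t => h (f t)) x.
Proof. intros Hh Hf. exact (continuous_comp f h x Hf Hh). Qed.

End ContinuousC.

Notation ccont f t := (continuous (U := C_UniformSpace) f t).

(** * Differentiation along paths *)

(** The derivative is taken componentwise so that the real theorems on derivatives and integrals
    apply, and because [pullback] uses the same pair of real derivatives. *)
Definition pd (g : R -> C) (t : R) (v : C) : Prop :=
  is_derive (fun s => Re (g s)) t (Re v) /\ is_derive (fun s => Im (g s)) t (Im v).

Lemma is_derive_eps (f : R -> R) (x l : R) : is_derive f x l <->
  forall eps, (0 < eps)%R -> exists d, (0 < d)%R /\
    forall h, (Rabs h < d)%R -> (Rabs (f (x + h)%R - f x - h * l) <= eps * Rabs h)%R.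
Proof.
  rewrite is_derive_Reals. split.
  - intros H eps He. destruct (H eps He) as [d K]. exists d; split; [apply cond_pos|].
    intros h Hh. destruct (Req_dec h 0) as [->|Hn].
    + rewrite Rplus_0_r, Rabs_R0.
      replace (f x - f x - 0 * l)%R with 0%R by ring. rewrite Rabs_R0. lra.
    + specialize (K h Hn Hh).
      replace (f (x + h) - f x - h * l)%R with (((f (x + h) - f x) / h - l) * h)%R
        by (field; auto).
      rewrite Rabs_mult. apply Rmult_le_compat_r; [apply Rabs_pos|lra].
  - intros H eps He. destruct (H (eps / 2)%R) as (d & Hd & K); [lra|].
    exists (mkposreal d Hd). intros h Hn Hh. specialize (K h Hh).
    replace ((f (x + h) - f x) / h - l)%R with ((f (x + h) - f x - h * l) / h)%R
      by (field; auto).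
    unfold Rdiv. rewrite Rabs_mult, Rabs_inv.
    assert (0 < Rabs h)%R by (apply Rabs_pos_lt; auto).
    apply Rle_lt_trans with (eps / 2)%R; [|lra].
    apply Rle_div_l; auto.
Qed.

Lemma pd_eps (g : R -> C) (t : R) (v : C) : pd g t v <->
  forall eps, (0 < eps)%R -> exists d, (0 < d)%R /\
    forall h, (Rabs h < d)%R -> (Cmod (g (t + h)%R - g t - RtoC h * v) <= eps * Rabs h)%R.
Proof.
  unfold pd. rewrite !is_derive_eps. split.
  - intros [H1 H2] eps He.
    destruct (H1 (eps / 2)%R) as (d1 & Hd1 & K1); [lra|].
    destruct (H2 (eps / 2)%R) as (d2 & Hd2 & K2); [lra|].
    exists (Rmin d1 d2); split; [apply Rmin_pos; auto|]. intros h Hh.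
    specialize (K1 h (Rlt_le_trans _ _ _ Hh (Rmin_l _ _))).
    specialize (K2 h (Rlt_le_trans _ _ _ Hh (Rmin_r _ _))).
    apply Rle_trans with (1 := Cmod_2Rmax _).
    apply Rle_trans with (2 * (eps / 2 * Rabs h))%R; [|right; field].
    assert (sqrt 2 <= 2)%R.
    { rewrite <- (sqrt_square 2) at 2 by lra. apply sqrt_le_1; lra. }
    apply Rmult_le_compat; auto using sqrt_pos.
    { apply Rle_trans with (2 := Rmax_l _ _), Rabs_pos. }
    apply Rmax_lub.
    + apply Rle_trans with (2 := K1). right. f_equal. unfold Re. simpl. ring.
    + apply Rle_trans with (2 := K2). right. f_equal. unfold Im. simpl. ring.
  - intros H; split; intros eps He; destruct (H eps He) as (d & Hd & K);
    exists d; split; auto; intros h Hh; apply Rle_trans with (2 := K h Hh).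
    + apply Rle_trans with (2 := re_le_Cmod _). right. f_equal. unfold Re. simpl. ring.
    + apply Rle_trans with (2 := Im_le_Cmod _). right. f_equal. unfold Im. simpl. ring.
Qed.

Lemma pd_eq (f g : R -> C) (t : R) (v w : C) :
  pd f t v -> (forall s, f s = g s) -> v = w -> pd g t w.
Proof.
  intros [H1 H2] E <-. split.
  - apply is_derive_ext with (2 := H1). intros s. now rewrite E.
  - apply is_derive_ext with (2 := H2). intros s. now rewrite E.
Qed.

Lemma wd_path (f : C -> C) (g : R -> C) (t : R) (a b v : C) :
  wd f (g t) a b -> pd g t v -> pd (fun s => f (g s)) t (a * v + b * Cconj v).
Proof.
  intros Hf Hg. rewrite pd_eps in *. intros eps He.
  set (L := (Cmod v + 1)%R). set (N := (Cmod a + Cmod b + 1)%R).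
  assert (HL : (0 < L)%R) by (unfold L; generalize (Cmod_ge_0 v); lra).
  assert (HN : (0 < N)%R)
    by (unfold N; generalize (Cmod_ge_0 a) (Cmod_ge_0 b); lra).
  destruct (Hf (eps / 2 / L)%R) as (d1 & Hd1 & K1).
  { repeat apply Rdiv_lt_0_compat; lra. }
  destruct (Hg 1%R Rlt_0_1) as (d2 & Hd2 & K2).
  destruct (Hg (eps / 2 / N)%R) as (d3 & Hd3 & K3).
  { repeat apply Rdiv_lt_0_compat; lra. }
  exists (Rmin (d1 / L) (Rmin d2 d3)); split.
  { repeat apply Rmin_pos; auto. apply Rdiv_lt_0_compat; auto. }
  intros h Hh.
  assert (A1 := Rlt_le_trans _ _ _ Hh (Rmin_l _ _)).
  assert (A2 := Rlt_le_trans _ _ _ Hh (Rle_trans _ _ _ (Rmin_r _ _) (Rmin_l _ _))).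
  assert (A3 := Rlt_le_trans _ _ _ Hh (Rle_trans _ _ _ (Rmin_r _ _) (Rmin_r _ _))).
  specialize (K2 h A2). specialize (K3 h A3).
  set (k := g (t + h)%R - g t) in *.
  assert (Hk : (Cmod k <= L * Rabs h)%R).
  { apply Rle_trans with (1 := Cmod_triangle_sub k (RtoC h * v)).
    rewrite Cmod_mult, Cmod_R. unfold L. lra. }
  assert (Hk1 : (Cmod k < d1)%R).
  { apply Rle_lt_trans with (1 := Hk). rewrite Rmult_comm. apply Rlt_div_r; auto. }
  specialize (K1 k Hk1). unfold k in K1 at 1.
  replace (g t + (g (t + h)%R - g t)) with (g (t + h)%R) in K1 by ring.
  replace (f (g (t + h)%R) - f (g t) - RtoC h * (a * v + b * Cconj v)) with
    ((f (g (t + h)%R) - f (g t) - a * k - b * Cconj k)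
     + (a * (k - RtoC h * v) + b * Cconj (k - RtoC h * v)))
    by (rewrite !Cconj_minus, !Cconj_mult, Cconj_RtoC; ring).
  apply Rle_trans with (1 := Cmod_triangle _ _).
  apply Rle_trans with (eps / 2 / L * (L * Rabs h) + N * (eps / 2 / N * Rabs h))%R.
  - apply Rplus_le_compat.
    + apply Rle_trans with (1 := K1). apply Rmult_le_compat_l; auto.
      left; repeat apply Rdiv_lt_0_compat; lra.
    + apply Rle_trans with (1 := wd_lin_bound _ _ _).
      apply Rmult_le_compat; auto using Cmod_ge_0.
      * generalize (Cmod_ge_0 a) (Cmod_ge_0 b); lra.
      * unfold N; lra.
  - right. field. lra.
Qed.

Lemma pd_affine (a b : C) (t : R) : pd (fun s => a + RtoC s * b) t b.
Proof.
  rewrite pd_eps. intros eps He. exists 1%R; split; [lra|]. intros h _.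
  replace (a + RtoC (t + h)%R * b - (a + RtoC t * b) - RtoC h * b) with (RtoC 0)
    by (rewrite RtoC_plus; ring).
  rewrite Cmod_0. generalize (Rabs_pos h). nra.
Qed.

Lemma pd_continuous (g : R -> C) (t : R) (v : C) : pd g t v -> ccont g t.
Proof.
  intros [H1 H2]. apply continuous_C_intro.
  - apply (ex_derive_continuous (fun s => Re (g s))). now exists (Re v).
  - apply (ex_derive_continuous (fun s => Im (g s))). now exists (Im v).
Qed.

Lemma pd_unique (g : R -> C) (t : R) (v : C) : pd g t v ->
  (Derive (fun s => Re (g s)) t, Derive (fun s => Im (g s)) t) = v.
Proof.
  intros [H1 H2]. apply C_pair_intro; simpl; now apply is_derive_unique.
Qed.

(** There is no mean value equality for complex values. The real theorem is applied to Re (conj D *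
    g) with D = g b - g a, whose increment is |D|^2. *)
Lemma pd_mean_value (g dg : R -> C) (a b m : R) :
  (a <= b)%R ->
  (forall t, (a <= t <= b)%R -> pd g t (dg t)) ->
  (forall t, (a <= t <= b)%R -> (Cmod (dg t) <= m)%R) ->
  (Cmod (g b - g a) <= m * (b - a))%R.
Proof.
  intros Hab Hd Hm. set (D := g b - g a).
  destruct (MVT_gen (fun t => Re (Cconj D * g t)) a b (fun t => Re (Cconj D * dg t)))
    as (c & Hc & E).
  - rewrite Rmin_left, Rmax_right by auto. intros x Hx. destruct (Hd x ltac:(lra)) as [H1 H2].
    unfold Re in *; simpl. apply @is_derive_minus; apply is_derive_scal; auto.
  - rewrite Rmin_left, Rmax_right by auto. intros x Hx. apply continuity_pt_filterlim.
    apply (continuous_Re (fun t => Cconj D * g t)). apply continuous_Cmult.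
    + apply continuous_Cconst.
    + apply pd_continuous with (1 := Hd x Hx).
  - rewrite Rmin_left, Rmax_right in Hc by auto.
    assert (E1 : (Cmod D * Cmod D <= Cmod D * (m * (b - a)))%R).
    { replace (Cmod D * Cmod D)%R with (Cmod D ^ 2)%R by ring.
      replace (Cmod D ^ 2)%R with (Re (Cconj D * g b) - Re (Cconj D * g a))%R.
      - rewrite E. rewrite <- Rmult_assoc. apply Rmult_le_compat_r; [lra|].
        apply Rle_trans with (1 := Rle_abs _). apply Rle_trans with (1 := re_le_Cmod _).
        rewrite Cmod_mult, Cmod_conj. apply Rmult_le_compat_l; auto using Cmod_ge_0.
      - rewrite Cmod2_alt. unfold D, Re, Im. simpl. ring. }
    destruct (Req_dec (Cmod D) 0) as [E0|E0].
    + rewrite E0. apply Rmult_le_pos; [|lra].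
      apply Rle_trans with (2 := Hm a ltac:(lra)), Cmod_ge_0.
    + apply Rmult_le_reg_l with (2 := E1). generalize (Cmod_ge_0 D). lra.
Qed.

Lemma pd_const (c : C) (t : R) : pd (fun _ => c) t 0.
Proof. split; simpl; apply @is_derive_const. Qed.

Lemma pd_plus (f g : R -> C) (t : R) (v w : C) :
  pd f t v -> pd g t w -> pd (fun s => f s + g s) t (v + w).
Proof.
  intros [H1 H2] [H3 H4]. split; simpl; apply @is_derive_plus; auto.
Qed.

Lemma pd_mult (f g : R -> C) (t : R) (v w : C) :
  pd f t v -> pd g t w -> pd (fun s => f s * g s) t (v * g t + f t * w).
Proof.
  intros [H1 H2] [H3 H4]. unfold Re, Im in *. split; simpl.
  - assert (K := @is_derive_minus _ _ _ _ _ _ _ (is_derive_mult _ _ _ _ _ H1 H3 Rmult_comm)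
      (is_derive_mult _ _ _ _ _ H2 H4 Rmult_comm)).
    unfold Re, Im; simpl. eapply is_derive_ext; [|eapply eq_rect; [exact K|]].
    + intros s. reflexivity.
    + unfold minus, plus, opp, mult; simpl. ring.
  - assert (K := @is_derive_plus _ _ _ _ _ _ _ (is_derive_mult _ _ _ _ _ H1 H4 Rmult_comm)
      (is_derive_mult _ _ _ _ _ H2 H3 Rmult_comm)).
    unfold Re, Im; simpl. eapply is_derive_ext; [|eapply eq_rect; [exact K|]].
    + intros s. reflexivity.
    + unfold minus, plus, opp, mult; simpl. ring.
Qed.

Lemma pd_RtoC (u : R -> R) (t l : R) : is_derive u t l -> pd (fun s => RtoC (u s)) t (RtoC l).
Proof. intros H. split; simpl; auto. apply @is_derive_const. Qed.

Lemma pd_scal (c : C) (f : R -> C) (t : R) (v : C) :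
  pd f t v -> pd (fun s => c * f s) t (c * v).
Proof.
  intros H. apply pd_eq with (1 := pd_mult _ _ _ _ _ (pd_const c t) H); auto. ring.
Qed.

Lemma pd_minus (f g : R -> C) (t : R) (v w : C) :
  pd f t v -> pd g t w -> pd (fun s => f s - g s) t (v - w).
Proof.
  intros H H'. apply pd_eq with (1 := pd_plus _ _ _ _ _ H (pd_scal (Copp 1) _ _ _ H'));
  intros; ring.
Qed.

Lemma pd_comp (g : R -> C) (u : R -> R) (t l : R) (v : C) :
  pd g (u t) v -> is_derive u t l -> pd (fun s => g (u s)) t (RtoC l * v).
Proof.
  intros [H1 H2] H. split.
  - eapply eq_rect; [exact (is_derive_comp _ _ _ _ _ H1 H)|].
    unfold scal; simpl; unfold mult; simpl. unfold Re; simpl. ring.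
  - eapply eq_rect; [exact (is_derive_comp _ _ _ _ _ H2 H)|].
    unfold scal; simpl; unfold mult; simpl. unfold Im; simpl. ring.
Qed.

(** * Mean value inequality on convex sets *)

Lemma segment_pd (f : C -> C) (z w : C) (t : R) (a b : C) :
  wd f (z + RtoC t * (w - z)) a b ->
  pd (fun s => f (z + RtoC s * (w - z))) t (a * (w - z) + b * Cconj (w - z)).
Proof. intros H. apply wd_path with (1 := H), pd_affine. Qed.

Definition convex (U : C -> Prop) : Prop :=
  forall z w, U z -> U w -> forall t, (0 <= t <= 1)%R -> U (z + RtoC t * (w - z)).

Lemma wd_mean_value (U : C -> Prop) (f df : C -> C) (m : R) : convex U ->
  (forall z, U z -> wd f z (df z) 0) ->
  (forall z, U z -> (Cmod (df z) <= m)%R) ->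
  forall z w, U z -> U w -> (Cmod (f w - f z) <= m * Cmod (w - z))%R.
Proof.
  intros HU Hf Hm z w Hz Hw.
  assert (K := pd_mean_value (fun s => f (z + RtoC s * (w - z)))
    (fun s => df (z + RtoC s * (w - z)) * (w - z)) 0 1 (m * Cmod (w - z)) ltac:(lra)).
  simpl in K. replace (z + 1 * (w - z)) with w in K by ring.
  replace (z + 0 * (w - z)) with z in K by ring.
  rewrite Rminus_0_r, Rmult_1_r in K. apply K.
  - intros t Ht. apply pd_eq with (1 := segment_pd _ _ _ _ _ _ (Hf _ (HU z w Hz Hw t Ht))); auto.
    ring.
  - intros t Ht. rewrite Cmod_mult. apply Rmult_le_compat_r; auto using Cmod_ge_0.
Qed.

(** The common source of the constancy arguments below: an identity is proved by showing that one
    side does not vary with an auxiliary variable and evaluating it at a convenient point. *)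
Lemma wd_zero_constant (U : C -> Prop) (f : C -> C) : convex U ->
  (forall z, U z -> wd f z 0 0) -> forall z w, U z -> U w -> f z = f w.
Proof.
  intros HU Hf z w Hz Hw.
  assert (K := wd_mean_value U f (fun _ => 0) 0 HU Hf).
  specialize (K ltac:(intros; cbv beta; rewrite Cmod_0; lra) w z Hw Hz).
  rewrite Rmult_0_l in K.
  replace (f z) with (f w + (f z - f w)) by ring.
  rewrite (Cmod_eq_0 (f z - f w)); [ring|].
  apply Rle_antisym; auto using Cmod_ge_0.
Qed.

Lemma convex_upper : convex upper.
Proof.
  intros [x y] [x' y'] Hz Hw t Ht. unfold upper in *. simpl in *. nra.
Qed.

Lemma convex_full : convex (fun _ => True).
Proof. intros z w _ _ t _; exact I. Qed.

Lemma upper_open (z : C) : upper z -> exists d, (0 < d)%R /\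
  forall h, (Cmod h < d)%R -> upper (z + h).
Proof.
  intros Hz. exists (Im z). split; auto. intros h Hh. unfold upper in *.
  replace (Im (z + h)) with (Im z + Im h)%R by (destruct z, h; reflexivity).
  generalize (Im_le_Cmod h). intros A. apply Rabs_le_between in A. lra.
Qed.

Lemma wd_ext_upper (f g : C -> C) (z a b : C) :
  (forall w, upper w -> f w = g w) -> upper z -> wd f z a b -> wd g z a b.
Proof.
  intros E Hz. apply wd_ext_loc. destruct (upper_open z Hz) as (d & Hd & K).
  exists d; split; auto.
Qed.

(** * Partial derivatives *)

Lemma wd_partials (f : C -> C) (z a b : C) : wd f z a b ->
  pd (fun t => f (t, Im z)) (Re z) (a + b) /\
  pd (fun t => f (Re z, t)) (Im z) (Ci * (a - b)).
Proof.
  intros H. destruct z as [x y]. simpl. split.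
  - assert (K := pd_affine (0, y) 1 x).
    apply pd_eq with (g := fun t : R => (t, y) : C) (w := RtoC 1) in K; auto.
    2: { intros s. apply C_pair_intro; simpl; ring. }
    apply pd_eq with (1 := wd_path f (fun t => (t, y)) x a b 1 H K); auto.
    replace (Cconj 1) with (RtoC 1) by (apply C_pair_intro; simpl; ring). ring.
  - assert (K := pd_affine (x, 0%R) Ci y).
    apply pd_eq with (g := fun t : R => (x, t) : C) (w := Ci) in K; auto.
    2: { intros s. apply C_pair_intro; simpl; ring. }
    apply pd_eq with (1 := wd_path f (fun t => (x, t)) y a b Ci H K); auto.
    replace (Cconj Ci) with (- Ci) by (apply C_pair_intro; simpl; ring). ring.
Qed.

Lemma pd_ex_partials (f : C -> C) (z : C) : ex_partials f z <->
  pd (fun t => f (t, Im z)) (Re z) (partial_x f z) /\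
  pd (fun t => f (Re z, t)) (Im z) (partial_y f z).
Proof.
  split.
  - intros (H1 & H2 & H3 & H4). split; split; simpl; apply Derive_correct; auto.
  - intros ([H1 H2] & [H3 H4]). repeat split; eexists; eassumption.
Qed.

Lemma wd_partial_x (f : C -> C) (z a b : C) : wd f z a b -> partial_x f z = a + b.
Proof. intros H. apply (pd_unique (fun t => f (t, Im z))), wd_partials, H. Qed.

Lemma wd_partial_y (f : C -> C) (z a b : C) : wd f z a b -> partial_y f z = Ci * (a - b).
Proof. intros H. apply (pd_unique (fun t => f (Re z, t))), wd_partials, H. Qed.

Lemma Ci_mult_Ci (z : C) : Ci * (Ci * z) = - z.
Proof. replace (Ci * (Ci * z)) with ((Ci * Ci) * z) by ring. rewrite Ci_sqr. ring. Qed.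

Lemma wd_partial_z (f : C -> C) (z a b : C) : wd f z a b -> partial_z f z = a.
Proof.
  intros H. unfold partial_z.
  rewrite (wd_partial_x _ _ _ _ H), (wd_partial_y _ _ _ _ H), Ci_mult_Ci. field.
Qed.

Lemma wd_partial_zbar (f : C -> C) (z a b : C) : wd f z a b -> partial_zbar f z = b.
Proof.
  intros H. unfold partial_zbar.
  rewrite (wd_partial_x _ _ _ _ H), (wd_partial_y _ _ _ _ H), Ci_mult_Ci. field.
Qed.

(** Rescaling to [0, 1] treats both signs of h at once; subtracting t h v turns the mean value
    inequality into a first-order expansion. *)
Lemma pd_mean_value_R (g dg : R -> C) (v : C) (a h m : R) :
  (forall t, (Rabs (t - a) <= Rabs h)%R -> pd g t (dg t)) ->
  (forall t, (Rabs (t - a) <= Rabs h)%R -> (Cmod (dg t - v) <= m)%R) ->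
  (Cmod (g (a + h)%R - g a - RtoC h * v) <= m * Rabs h)%R.
Proof.
  intros Hd Hm.
  assert (K : forall t, (0 <= t <= 1)%R -> (Rabs (a + t * h - a) <= Rabs h)%R).
  { intros t Ht. replace (a + t * h - a)%R with (t * h)%R by ring.
    rewrite Rabs_mult, (Rabs_pos_eq t) by lra. generalize (Rabs_pos h). nra. }
  assert (L := pd_mean_value (fun t => g (a + t * h)%R - (RtoC t * (RtoC h * v)))
    (fun t => RtoC h * dg (a + t * h)%R - RtoC h * v) 0 1 (m * Rabs h) ltac:(lra)).
  cbv beta in L. rewrite !Rmult_0_l, !Rmult_1_l, Rplus_0_r, Rminus_0_r, Rmult_1_r in L.
  replace (g (a + h)%R - 1 * (RtoC h * v) - (g a - 0 * (RtoC h * v))) with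
    (g (a + h)%R - g a - RtoC h * v) in L by ring.
  apply L.
  - intros t Ht. apply pd_minus.
    + apply pd_comp; [apply Hd; auto|]. auto_derive; auto; ring.
    + apply pd_eq with (1 := pd_affine 0 (RtoC h * v) t); auto. intros s; ring.
  - intros t Ht. replace (RtoC h * dg (a + t * h)%R - RtoC h * v) with
      (RtoC h * (dg (a + t * h)%R - v)) by ring.
    rewrite Cmod_mult, Cmod_R, Rmult_comm. apply Rmult_le_compat_r; auto using Rabs_pos.
Qed.

Lemma Cmod_Re_Im_lt (z w : C) (d : R) :
  (Rabs (Re w - Re z) < d / 2)%R -> (Rabs (Im w - Im z) < d / 2)%R -> (Cmod (w - z) < d)%R.
Proof.
  intros A B. assert (0 < d)%R by (generalize (Rabs_pos (Re w - Re z)); lra).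
  apply Rle_lt_trans with (1 := Cmod_2Rmax _).
  apply Rlt_le_trans with (sqrt 2 * (d / 2))%R.
  - apply Rmult_lt_compat_l; [apply sqrt_lt_R0; lra|].
    apply Rmax_lub_lt; assumption.
  - assert (sqrt 2 <= 2)%R.
    { rewrite <- (sqrt_square 2) at 2 by lra. apply sqrt_le_1; lra. }
    nra.
Qed.

Lemma continuous_C_delta (f : C -> C) (z : C) : continuous f z ->
  forall eps, (0 < eps)%R -> exists d, (0 < d)%R /\ forall w, (Cmod (w - z) < d)%R -> (Cmod (f w - f z) < eps)%R.
Proof.
  intros H eps He. apply locally_C_Cmod. apply (proj1 (continuous_C_eps f z) H eps He).
Qed.

(** The C^1 criterion: the step h is made first vertically and then horizontally, and on each leg
    continuity of the partial derivative bounds its deviation from the value at z. *)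
Lemma wd_of_partials (U : C -> Prop) (f fx fy : C -> C) (z : C) :
  (exists d, (0 < d)%R /\ forall w, (Cmod (w - z) < d)%R -> U w) ->
  (forall w, U w -> pd (fun t => f (t, Im w)) (Re w) (fx w) /\ pd (fun t => f (Re w, t)) (Im w) (fy w)) ->
  continuous fx z -> continuous fy z ->
  wd f z (/ 2 * (fx z - Ci * fy z)) (/ 2 * (fx z + Ci * fy z)).
Proof.
  intros (d0 & Hd0 & HU) Hf Hx Hy eps He.
  destruct (continuous_C_delta _ _ Hx (eps / 2)%R) as (d1 & Hd1 & K1); [lra|].
  destruct (continuous_C_delta _ _ Hy (eps / 2)%R) as (d2 & Hd2 & K2); [lra|].
  set (d := Rmin d0 (Rmin d1 d2)).
  assert (Hd : (0 < d)%R) by (repeat apply Rmin_pos; auto).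
  exists (d / 2)%R; split; [lra|]. intros h Hh.
  set (x := Re z). set (y := Im z). set (s := Re h). set (t := Im h).
  assert (Hs : (Rabs s < d / 2)%R) by (apply Rle_lt_trans with (2 := Hh), re_le_Cmod).
  assert (Ht : (Rabs t < d / 2)%R) by (apply Rle_lt_trans with (2 := Hh), Im_le_Cmod).
  assert (N : forall w : C, (Rabs (Re w - x) <= Rabs s)%R -> (Rabs (Im w - y) <= Rabs t)%R ->
     U w /\ (Cmod (fx w - fx z) <= eps / 2)%R /\ (Cmod (fy w - fy z) <= eps / 2)%R).
  { intros w A B. assert (D : (Cmod (w - z) < d)%R) by (apply Cmod_Re_Im_lt; fold x y; lra).
    unfold d in D. repeat apply Rmin_Rgt_l in D. destruct D as [D0 D]. apply Rmin_Rgt_l in D.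
    split; [apply HU; lra|]. split; left; [apply K1|apply K2]; lra. }
  assert (M1 := pd_mean_value_R (fun u => f (u, (y + t)%R)) (fun u => fx (u, (y + t)%R))
    (fx z) x s (eps / 2)).
  assert (M2 := pd_mean_value_R (fun u => f (x, u)) (fun u => fy (x, u)) (fy z) y t (eps / 2)).
  cbv beta in M1, M2.
  replace (f (z + h) - f z - / 2 * (fx z - Ci * fy z) * h
     - / 2 * (fx z + Ci * fy z) * Cconj h) with
    ((f ((x + s)%R, (y + t)%R) - f (x, (y + t)%R) - RtoC s * fx z)
     + (f (x, (y + t)%R) - f (x, y) - RtoC t * fy z)).
  - apply Rle_trans with (1 := Cmod_triangle _ _).
    apply Rle_trans with (eps / 2 * Rabs s + eps / 2 * Rabs t)%R.
    + apply Rplus_le_compat; [apply M1|apply M2]; intros u Hu.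
      * apply (Hf (u, (y + t)%R)). apply N; simpl; auto.
        right. f_equal. ring.
      * apply N; simpl; auto. right. f_equal. ring.
      * apply (Hf (x, u)). apply N; simpl; auto.
        replace (x - x)%R with 0%R by ring. rewrite Rabs_R0. apply Rabs_pos.
      * apply N; simpl; auto. replace (x - x)%R with 0%R by ring. rewrite Rabs_R0. apply Rabs_pos.
    + assert (Rabs s <= Cmod h)%R by apply re_le_Cmod.
      assert (Rabs t <= Cmod h)%R by apply Im_le_Cmod. nra.
  - replace (z + h) with ((x + s)%R, (y + t)%R) by reflexivity.
    replace (f z) with (f (x, y)) by (destruct z; reflexivity).
    unfold s, t. destruct (f ((x + Re h)%R, (y + Im h)%R)), (f (x, y)), (f (x, (y + Im h)%R)).
    destruct (fx z), (fy z), h. apply C_pair_intro; unfold Re, Im; simpl; field.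
Qed.

(** * Complex derivatives *)

(** [holomorphic_on] refers to the derivative over [C_AbsRing], whose neighbourhoods are discs; this
    lemma and its converse translate between that notion and [wd]. *)
Lemma wd_is_derive (f : C -> C) (z a : C) : wd f z a 0 ->
  @is_derive C_AbsRing C_NormedModule f z a.
Proof.
  intros H. split.
  - apply @is_linear_scal_l.
  - intros x Hx eps. apply (is_filter_lim_locally_unique (V := AbsRing_NormedModule C_AbsRing)) in Hx.
    subst x.
    destruct (H eps (cond_pos eps)) as (d & Hd & K).
    exists (mkposreal d Hd). intros w Hw.
    specialize (K (w - z) Hw).
    assert (E : forall w : C, z + (w - z) = w) by (intros; ring). rewrite E in K.
    apply Rle_trans with (2 := K). right.
    change (Cmod (f w - f z - (w - z) * a) = Cmod (f w - f z - a * (w - z) - 0 * Cconj (w - z))).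
    assert (E' : forall w : C, f w - f z - (w - z) * a = f w - f z - a * (w - z) - 0 * Cconj (w - z))
      by (intros; ring).
    now rewrite E'.
Qed.

Lemma is_derive_wd (f : C -> C) (z a : C) :
  @is_derive C_AbsRing C_NormedModule f z a -> wd f z a 0.
Proof.
  intros [_ H] eps He.
  destruct (H z (fun P HP => HP) (mkposreal eps He)) as [d K].
  exists d; split; [apply cond_pos|]. intros h Hh.
  assert (B : ball (M := AbsRing_UniformSpace C_AbsRing) z d (z + h)).
  { change (Cmod (z + h - z) < d)%R. now replace (z + h - z) with h by ring. }
  specialize (K (z + h) B).
  change (Cmod (f (z + h)%C - f z - (z + h - z) * a) <= eps * Cmod (z + h - z))%R in K.
  replace (z + h - z) with h in K by ring. apply Rle_trans with (2 := K). right.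
  f_equal. ring.
Qed.

(** * Integrals of complex functions of a real variable *)

Definition isI (f : R -> C) (a b : R) (v : C) : Prop := @is_RInt C_R_NormedModule f a b v.
Definition CI (f : R -> C) (a b : R) : C := @RInt C_R_CompleteNormedModule f a b.

Lemma isI_intro (f : R -> C) (a b : R) (v : C) :
  is_RInt (fun t => Re (f t)) a b (Re v) -> is_RInt (fun t => Im (f t)) a b (Im v) ->
  isI f a b v.
Proof.
  intros H1 H2. destruct v. apply (is_RInt_fct_extend_pair f); assumption.
Qed.

Lemma isI_Re (f : R -> C) (a b : R) (v : C) : isI f a b v -> is_RInt (fun t => Re (f t)) a b (Re v).
Proof. intros H. exact (is_RInt_fct_extend_fst f a b v H). Qed.
Lemma isI_Im (f : R -> C) (a b : R) (v : C) : isI f a b v -> is_RInt (fun t => Im (f t)) a b (Im v).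
Proof. intros H. exact (is_RInt_fct_extend_snd f a b v H). Qed.

Lemma CI_correct (f : R -> C) (a b : R) :
  (a <= b)%R -> (forall t, (a <= t <= b)%R -> ccont f t) -> isI f a b (CI f a b).
Proof.
  intros Hab H. apply (RInt_correct (V := C_R_CompleteNormedModule)).
  apply (ex_RInt_continuous (V := C_R_CompleteNormedModule)).
  rewrite Rmin_left, Rmax_right by auto. exact H.
Qed.

Lemma isI_unique (f : R -> C) (a b : R) (v : C) : isI f a b v -> CI f a b = v.
Proof. intros H. exact (is_RInt_unique (V := C_R_CompleteNormedModule) f a b v H). Qed.

Lemma isI_eq (f g : R -> C) (a b : R) (v w : C) :
  (a <= b)%R -> (forall t, (a <= t <= b)%R -> f t = g t) -> v = w -> isI f a b v -> isI g a b w.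
Proof.
  intros Hab E <-. apply (is_RInt_ext (V := C_R_NormedModule)).
  rewrite Rmin_left, Rmax_right by auto. intros; apply E; lra.
Qed.

Lemma CI_ext (f g : R -> C) (a b : R) :
  (a <= b)%R -> (forall t, (a <= t <= b)%R -> f t = g t) -> CI f a b = CI g a b.
Proof.
  intros Hab E. apply (RInt_ext (V := C_R_CompleteNormedModule)).
  rewrite Rmin_left, Rmax_right by auto. intros; apply E; lra.
Qed.

Lemma isI_plus (f g : R -> C) (a b : R) (v w : C) :
  isI f a b v -> isI g a b w -> isI (fun t => f t + g t) a b (v + w).
Proof. intros H H'. exact (is_RInt_plus (V := C_R_NormedModule) _ _ _ _ _ _ H H'). Qed.

(** [C_R_NormedModule] has only real scalars, so a complex factor is treated on components. *)
Lemma isI_scal (c : C) (f : R -> C) (a b : R) (v : C) :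
  isI f a b v -> isI (fun t => c * f t) a b (c * v).
Proof.
  intros H. apply isI_intro; simpl.
  - exact (is_RInt_minus (V := R_NormedModule) _ _ _ _ _ _
      (is_RInt_scal (V := R_NormedModule) _ _ _ (fst c) _ (isI_Re _ _ _ _ H))
      (is_RInt_scal (V := R_NormedModule) _ _ _ (snd c) _ (isI_Im _ _ _ _ H))).
  - exact (is_RInt_plus (V := R_NormedModule) _ _ _ _ _ _
      (is_RInt_scal (V := R_NormedModule) _ _ _ (fst c) _ (isI_Im _ _ _ _ H))
      (is_RInt_scal (V := R_NormedModule) _ _ _ (snd c) _ (isI_Re _ _ _ _ H))).
Qed.

Lemma isI_minus (f g : R -> C) (a b : R) (v w : C) :
  isI f a b v -> isI g a b w -> isI (fun t => f t - g t) a b (v - w).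
Proof. intros H H'. exact (is_RInt_minus (V := C_R_NormedModule) _ _ _ _ _ _ H H'). Qed.

Lemma isI_const (c : C) (a b : R) : isI (fun _ => c) a b (RtoC (b - a) * c).
Proof.
  apply isI_intro; simpl.
  - eapply eq_rect; [apply @is_RInt_const|]. unfold scal; simpl; unfold mult; simpl; unfold Re. ring.
  - eapply eq_rect; [apply @is_RInt_const|]. unfold scal; simpl; unfold mult; simpl; unfold Im. ring.
Qed.

Lemma norm_C_R (z : C) : @norm R_AbsRing C_R_NormedModule z = Cmod z.
Proof.
  unfold norm; simpl. unfold prod_norm, Cmod, norm; simpl. unfold abs; simpl. f_equal.
  rewrite !Rmult_1_r. rewrite <- !Rabs_mult, !Rabs_pos_eq by nra. ring.
Qed.

Lemma isI_bound (f : R -> C) (g : R -> R) (a b : R) (v : C) (l : R) :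
  (a <= b)%R -> (forall t, (a <= t <= b)%R -> (Cmod (f t) <= g t)%R) ->
  isI f a b v -> is_RInt g a b l -> (Cmod v <= l)%R.
Proof.
  intros Hab H Hf Hg. rewrite <- norm_C_R.
  refine (norm_RInt_le (V := C_R_NormedModule) f g a b v l Hab _ Hf Hg).
  intros t Ht. rewrite norm_C_R. auto.
Qed.

Lemma isI_bound_const (f : R -> C) (m : R) (a b : R) (v : C) :
  (a <= b)%R -> (forall t, (a <= t <= b)%R -> (Cmod (f t) <= m)%R) ->
  isI f a b v -> (Cmod v <= m * (b - a))%R.
Proof.
  intros Hab H Hf.
  apply (isI_bound f (fun _ => m) a b v); auto.
  eapply eq_rect; [apply @is_RInt_const|]. unfold scal; simpl; unfold mult; simpl. ring.
Qed.

Lemma isI_derive (g dg : R -> C) (a b : R) :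
  (forall t, (Rmin a b <= t <= Rmax a b)%R -> pd g t (dg t)) ->
  (forall t, (Rmin a b <= t <= Rmax a b)%R -> ccont dg t) ->
  isI dg a b (g b - g a).
Proof.
  intros Hd Hc. apply isI_intro.
  - apply (is_RInt_derive (V := R_CompleteNormedModule) (fun t => Re (g t))).
    + intros t Ht. apply Hd; auto.
    + intros t Ht. apply continuous_Re; auto.
  - apply (is_RInt_derive (V := R_CompleteNormedModule) (fun t => Im (g t))).
    + intros t Ht. apply Hd; auto.
    + intros t Ht. apply continuous_Im; auto.
Qed.

Lemma isI_Chasles (f : R -> C) (a b c : R) (v w : C) :
  isI f a b v -> isI f b c w -> isI f a c (v + w).
Proof. intros H H'. exact (is_RInt_Chasles (V := C_R_NormedModule) _ _ _ _ _ _ H H'). Qed.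

(** Differentiation under the integral sign. The derivative is required on the larger interval (a -
    d, b + d) because the real theorem asks for [Derive] to be continuous on a full two-dimensional
    neighbourhood, also at t = a and t = b. *)
Lemma CI_param_derive (k dk : R -> R -> C) (a b s0 d : R) :
  (a <= b)%R -> (0 < d)%R ->
  (forall s t, (Rabs (s - s0) < d)%R -> (a - d < t < b + d)%R -> pd (fun s => k s t) s (dk s t)) ->
  (forall t, (a <= t <= b)%R ->
     continuous (T := prod_UniformSpace R_UniformSpace R_UniformSpace) (U := C_UniformSpace)
       (fun p => dk (fst p) (snd p)) (s0, t)) ->
  (forall s t, (Rabs (s - s0) < d)%R -> (a <= t <= b)%R -> ccont (k s) t) ->
  pd (fun s => CI (k s) a b) s0 (CI (dk s0) a b).
Proof.
  intros Hab Hd Hk Hc Hk0.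
  assert (Loc : forall P : R -> Prop, (forall s, (Rabs (s - s0) < d)%R -> P s) -> locally s0 P).
  { intros P HP. exists (mkposreal d Hd). intros s Hs. apply HP, Hs. }
  assert (Hdk : isI (dk s0) a b (CI (dk s0) a b)).
  { apply CI_correct; auto. intros t Ht. specialize (Hc t Ht).
    refine (continuous_comp (fun t => (s0, t) : prod_UniformSpace R_UniformSpace R_UniformSpace)
      (fun p => dk (fst p) (snd p)) t _ Hc).
    intros P [eps HP]. exists eps. intros t' Ht'. apply HP. split; auto. apply ball_center. }
  assert (Hs : forall s, (Rabs (s - s0) < d)%R -> isI (k s) a b (CI (k s) a b)).
  { intros s Hs. apply CI_correct; auto. }
  assert (H00 : (Rabs (s0 - s0) < d)%R).
  { replace (s0 - s0)%R with 0%R by ring. now rewrite Rabs_R0. }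
  (* [p] stands for [Re] or [Im], so that one argument serves both components. *)
  assert (gen : forall (p : C -> R),
     (forall g t v, pd g t v -> is_derive (fun s => p (g s)) t (p v)) ->
     (forall f v, isI f a b v -> is_RInt (fun t => p (f t)) a b (p v)) ->
     (forall (T : UniformSpace) (f : T -> C) x, continuous (U := C_UniformSpace) f x ->
        continuous (fun t => p (f t)) x) ->
     is_derive (fun s => p (CI (k s) a b)) s0 (p (CI (dk s0) a b))).
  { intros p Hp1 Hp2 Hp3.
    apply is_derive_ext_loc with (fun s => RInt (fun t => p (k s t)) a b).
    { apply Loc. intros s Hs'. apply is_RInt_unique. apply Hp2, Hs, Hs'. }
    replace (p (CI (dk s0) a b)) with (RInt (fun t => Derive (fun u => p (k u t)) s0) a b).
    2: { apply is_RInt_unique. apply is_RInt_ext with (2 := Hp2 _ _ Hdk).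
         rewrite Rmin_left, Rmax_right by auto. intros t Ht. symmetry.
         apply is_derive_unique. apply Hp1. apply Hk; auto. lra. }
    apply (is_derive_RInt_param (fun s t => p (k s t))).
    - apply Loc. rewrite Rmin_left, Rmax_right by auto. intros s Hs' t Ht.
      eexists. apply Hp1. apply Hk; auto. lra.
    - rewrite Rmin_left, Rmax_right by auto. intros t Ht.
      apply continuity_2d_pt_ext_loc with (fun u v => p (dk u v)).
      + exists (mkposreal d Hd). intros u v Hu Hv. simpl in Hu, Hv. symmetry.
        apply is_derive_unique, Hp1, Hk; auto. apply Rabs_def2 in Hv. lra.
      + apply continuity_2d_pt_filterlim. exact (Hp3 _ _ _ (Hc t Ht)).
    - apply Loc. intros s Hs'. eexists. apply Hp2, Hs, Hs'. }
  split.
  - apply (gen Re).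
    + intros g t v [H _]; auto.
    + intros f v; apply isI_Re.
    + intros T f x; apply continuous_Re.
  - apply (gen Im).
    + intros g t v [_ H]; auto.
    + intros f v; apply isI_Im.
    + intros T f x; apply continuous_Im.
Qed.

(** * The complex exponential *)

Lemma Cexp_plus (z w : C) : Cexp (z + w) = Cexp z * Cexp w.
Proof.
  destruct z as [x y], w as [x' y']. unfold Cexp, Re, Im; simpl.
  rewrite exp_plus, cos_plus, sin_plus. apply C_pair_intro; simpl; ring.
Qed.

Lemma Cexp_0 : Cexp 0 = 1.
Proof. unfold Cexp, Re, Im; simpl. rewrite exp_0, cos_0, sin_0. apply C_pair_intro; simpl; ring. Qed.

Lemma Cmod_Cexp (z : C) : Cmod (Cexp z) = exp (Re z).
Proof.
  unfold Cmod, Cexp; simpl. rewrite !Rmult_1_r.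
  replace (exp (Re z) * cos (Im z) * (exp (Re z) * cos (Im z)) +
     exp (Re z) * sin (Im z) * (exp (Re z) * sin (Im z)))%R with (exp (Re z) * exp (Re z))%R.
  - apply sqrt_square. left; apply exp_pos.
  - replace (exp (Re z) * exp (Re z))%R with (exp (Re z) * exp (Re z) * 1)%R by ring.
    rewrite <- (sin2_cos2 (Im z)). unfold Rsqr. ring.
Qed.

Lemma continuous_Cexp (z : C) : continuous Cexp z.
Proof.
  apply continuous_C_intro; unfold Cexp; simpl;
  apply (continuous_mult (K := R_AbsRing) (fun z : C_UniformSpace => exp (Re z))).
  1,3: apply (continuous_comp (fun z : C_UniformSpace => Re z) exp);
    [apply (continuous_Re (fun z : C_UniformSpace => z)), continuous_id|].
  1,2: apply (ex_derive_continuous exp); eexists; apply is_derive_exp.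
  - apply (continuous_comp (fun z : C_UniformSpace => Im z) cos);
    [apply (continuous_Im (fun z : C_UniformSpace => z)), continuous_id|apply continuous_cos].
  - apply (continuous_comp (fun z : C_UniformSpace => Im z) sin);
    [apply (continuous_Im (fun z : C_UniformSpace => z)), continuous_id|apply continuous_sin].
Qed.

Lemma wd_Cexp (z : C) : wd Cexp z (Cexp z) 0.
Proof.
  apply wd_eq with (1 := wd_of_partials (fun _ => True) Cexp Cexp (fun w => Ci * Cexp w) z
    (ex_intro _ 1%R (conj Rlt_0_1 (fun _ _ => I)))
    ltac:(intros [x y] _; split; split; unfold Cexp, Re, Im; simpl;
      auto_derive; auto; ring)
    (continuous_Cexp z) ltac:(apply continuous_Cmult; [apply continuous_Cconst|apply continuous_Cexp])); auto.
  - rewrite Ci_mult_Ci. field.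
  - rewrite Ci_mult_Ci. field.
Qed.

Lemma pd_Cexp_line (h : C) (t : R) : pd (fun t => Cexp (RtoC t * h)) t (h * Cexp (RtoC t * h)).
Proof.
  assert (K := pd_affine 0 h t).
  apply pd_eq with (g := fun s : R => RtoC s * h) (w := h) in K; auto.
  2: intros; ring.
  apply pd_eq with (1 := wd_path Cexp _ t _ _ _ (wd_Cexp _) K); auto. ring.
Qed.

Lemma exp_le (x y : R) : (x <= y)%R -> (exp x <= exp y)%R.
Proof. intros [H| ->]; [left; now apply exp_increasing|lra]. Qed.

Lemma Cexp_bound_1 (h : C) : (Cmod (Cexp h - 1) <= Cmod h * exp (Cmod h))%R.
Proof.
  assert (K := pd_mean_value (fun t => Cexp (RtoC t * h)) (fun t => h * Cexp (RtoC t * h))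
    0 1 (Cmod h * exp (Cmod h)) ltac:(lra)).
  cbv beta in K. rewrite Cmult_0_l, Cmult_1_l, Cexp_0, Rminus_0_r, Rmult_1_r in K. apply K.
  - intros; apply pd_Cexp_line.
  - intros t Ht. rewrite Cmod_mult, Cmod_Cexp. apply Rmult_le_compat_l; auto using Cmod_ge_0.
    apply exp_le. apply Rle_trans with (1 := Rle_abs _).
    apply Rle_trans with (1 := re_le_Cmod _). rewrite Cmod_mult, Cmod_R, Rabs_pos_eq by lra.
    generalize (Cmod_ge_0 h). nra.
Qed.

Lemma Cexp_bound_2 (h : C) : (Cmod (Cexp h - 1 - h) <= Cmod h ^ 2 * exp (Cmod h))%R.
Proof.
  assert (K := pd_mean_value (fun t => Cexp (RtoC t * h) - RtoC t * h)
    (fun t => h * Cexp (RtoC t * h) - h)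
    0 1 (Cmod h ^ 2 * exp (Cmod h)) ltac:(lra)).
  cbv beta in K. rewrite !Cmult_0_l, !Cmult_1_l, Cexp_0, Rminus_0_r, Rmult_1_r in K.
  replace (Cexp h - 1 - h) with (Cexp h - h - (1 - 0)) by ring. apply K.
  - intros t _. apply pd_minus; [apply pd_Cexp_line|].
    apply pd_eq with (1 := pd_affine 0 h t); auto. intros; ring.
  - intros t Ht. replace (h * Cexp (RtoC t * h) - h) with (h * (Cexp (RtoC t * h) - 1)) by ring.
    rewrite Cmod_mult. simpl. rewrite Rmult_1_r, Rmult_assoc.
    apply Rmult_le_compat_l; auto using Cmod_ge_0.
    assert (E : (Cmod (RtoC t * h) <= Cmod h)%R).
    { rewrite Cmod_mult, Cmod_R, Rabs_pos_eq by lra. generalize (Cmod_ge_0 h). nra. }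
    apply Rle_trans with (1 := Cexp_bound_1 _).
    apply Rmult_le_compat; auto using Cmod_ge_0, exp_le. left; apply exp_pos.
Qed.

(** * Finite sums *)

Fixpoint csum (f : nat -> C) (N : nat) : C :=
  match N with O => 0 | S m => csum f m + f m end.

Lemma csum_S (f : nat -> C) (N : nat) : csum f (S N) = csum f N + f N.
Proof. reflexivity. Qed.

Lemma csum_ext (f g : nat -> C) (N : nat) :
  (forall i, (i < N)%nat -> f i = g i) -> csum f N = csum g N.
Proof.
  intros H. induction N as [|N IH]; simpl; auto. rewrite IH, H; auto.
Qed.

Lemma csum_plus (f g : nat -> C) (N : nat) :
  csum (fun i => f i + g i) N = csum f N + csum g N.
Proof. induction N as [|N IH]; simpl; [ring|rewrite IH; ring]. Qed.

Lemma csum_scal (c : C) (f : nat -> C) (N : nat) :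
  csum (fun i => c * f i) N = c * csum f N.
Proof. induction N as [|N IH]; simpl; [ring|rewrite IH; ring]. Qed.

Lemma csum_shift (f : nat -> C) (N : nat) :
  csum f (S N) = f O + csum (fun i => f (S i)) N.
Proof. induction N as [|N IH]; [simpl; ring|]. simpl in *. rewrite IH. ring. Qed.

Lemma csum_zero (f : nat -> C) (N : nat) :
  (forall i, (i < N)%nat -> f i = 0) -> csum f N = 0.
Proof.
  intros H. induction N as [|N IH]; simpl; auto. rewrite IH, H; auto. ring.
Qed.

Lemma csum_conj (f : nat -> C) (N : nat) : Cconj (csum f N) = csum (fun i => Cconj (f i)) N.
Proof.
  induction N as [|N IH]; simpl; [apply C_pair_intro; simpl; ring|].
  now rewrite Cconj_plus, IH.
Qed.

Lemma csum_rev (f : nat -> C) (N : nat) :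
  csum f (S N) = csum (fun i => f (N - i)%nat) (S N).
Proof.
  revert f. induction N as [|N IH]; intros f; [simpl; ring|].
  rewrite csum_S, IH, (csum_shift (fun i => f (S N - i)%nat) (S N)).
  replace (S N - 0)%nat with (S N) by lia.
  change (csum (fun i => f (S N - S i)%nat) (S N)) with (csum (fun i => f (N - i)%nat) (S N)).
  ring.
Qed.

(** The triangle l <= j <= n is summed along its diagonals m = j - l. *)
Lemma csum_triangle (a : nat -> nat -> C) (n : nat) :
  csum (fun j => csum (fun l => a j l) (S j)) (S n) =
  csum (fun m => csum (fun l => a (m + l)%nat l) (S n - m)) (S n).
Proof.
  induction n as [|n IH]; [reflexivity|].
  rewrite csum_S, IH, (csum_rev (fun l => a (S n) l)), (csum_S _ (S n)), (csum_S _ (S n)).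
  replace (S (S n) - S n)%nat with 1%nat by lia.
  rewrite (csum_ext (fun m => csum (fun l => a (m + l)%nat l) (S (S n) - m))
    (fun m => csum (fun l => a (m + l)%nat l) (S n - m) + a (S n) (S n - m)%nat) (S n)).
  - rewrite csum_plus. replace (S n - S n)%nat with 0%nat by lia. simpl.
    rewrite Nat.add_0_r. ring.
  - intros m Hm. replace (S (S n) - m)%nat with (S (S n - m)) by lia.
    rewrite csum_S. now replace (m + (S n - m))%nat with (S n) by lia.
Qed.

Lemma wd_csum (F : nat -> C -> C) (z : C) (a b : nat -> C) (N : nat) :
  (forall i, (i < N)%nat -> wd (F i) z (a i) (b i)) ->
  wd (fun w => csum (fun i => F i w) N) z (csum a N) (csum b N).
Proof.
  intros H. induction N as [|N IH]; simpl; [apply wd_const|].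
  apply (wd_plus (fun w => csum (fun i => F i w) N)); auto.
Qed.

Definition sgn (i : nat) : C := Copp 1 ^ i.
Lemma sgn_S (i : nat) : sgn (S i) = - sgn i.
Proof. unfold sgn. rewrite Cpow_S. ring. Qed.

(** * Taylor sums *)

Definition taylor (N : nat) (e : nat -> C) (y : C) : C :=
  csum (fun l => e l * (y ^ l / INR (fact l))) N.

Lemma INR_fact_neq (l : nat) : RtoC (INR (fact l)) <> 0.
Proof. intros H. apply RtoC_inj in H. now apply (INR_fact_neq_0 l). Qed.

(** As y has z-derivative -1, the derivative of y^(l+1)/(l+1)! cancels that of e_l, and only the top
    term survives in z. The zbar-derivative acts on y alone and shifts the sequence. *)
Lemma wd_taylor (N : nat) (e : nat -> C -> C) (y : C -> C) (z c : C) :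
  (forall l, (l <= N)%nat -> wd (e l) z (e (S l) z) 0) -> wd y z (Copp 1) c ->
  wd (fun w => taylor (S N) (fun l => e l w) (y w)) z
    (e (S N) z * (y z ^ N / INR (fact N)))
    (c * taylor N (fun l => e (S l) z) (y z)).
Proof.
  intros He Hy. induction N as [|N IH].
  - apply wd_eq with (1 := He O ltac:(lia)).
    + intros w. unfold taylor. simpl. field.
    + simpl. field.
    + unfold taylor; simpl; ring.
  - assert (Hp : wd (fun w => y w ^ S N / INR (fact (S N))) z
        (- (y z ^ N / INR (fact N))) (c * (y z ^ N / INR (fact N)))).
    { clear IH He.
      assert (Hp : forall M, wd (fun w => y w ^ S M) z (- (INR (S M) * y z ^ M)) (c * (INR (S M) * y z ^ M))).
      { induction M as [|M IHM].
        - apply wd_eq with (1 := Hy); intros; simpl; ring.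
        - apply wd_eq with (1 := wd_mult _ _ _ _ _ _ _ Hy IHM).
          + intros w. now rewrite <- Cpow_S.
          + rewrite (S_INR (S M)), RtoC_plus, !Cpow_S. ring.
          + rewrite (S_INR (S M)), RtoC_plus, !Cpow_S. ring. }
      assert (E : RtoC (INR (fact (S N))) = RtoC (INR (S N)) * RtoC (INR (fact N))).
      { rewrite <- RtoC_mult, <- mult_INR. reflexivity. }
      assert (E1 : RtoC (INR (S N)) <> 0).
      { intros H. apply RtoC_inj in H. now apply (not_0_INR (S N)). }
      assert (E2 := INR_fact_neq N).
      apply wd_eq with (1 := wd_scal (/ INR (fact (S N))) _ _ _ _ (Hp N)).
      - intros w. unfold Cdiv. ring.
      - rewrite E. field. auto.
      - rewrite E. field. auto. }
    assert (IH' := IH ltac:(intros; apply He; lia)).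
    apply wd_eq with (1 := wd_plus _ _ _ _ _ _ _ IH' (wd_mult _ _ _ _ _ _ _ (He (S N) ltac:(lia)) Hp)).
    + reflexivity.
    + ring.
    + unfold taylor. simpl csum. ring.
Qed.

(** * Polynomials with real coefficients *)

Fixpoint peval (l : list R) (z : C) : C :=
  match l with nil => 0 | a :: l => RtoC a + z * peval l z end.

Fixpoint padd (l m : list R) : list R :=
  match l, m with
  | nil, _ => m
  | _, nil => l
  | a :: l, b :: m => (a + b)%R :: padd l m
  end.

(** Multiplication by X. The empty list stays empty so that [length] remains an honest bound for the
    degree, on which the later inductions run. *)
Definition pshift (l : list R) : list R := match l with nil => nil | _ => 0%R :: l end.

Fixpoint pderiv (l : list R) : list R :=
  match l with nil => nil | _ :: l => padd l (pshift (pderiv l)) end.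

Fixpoint pmul (l m : list R) : list R :=
  match l with nil => nil | a :: l => padd (map (Rmult a) m) (pshift (pmul l m)) end.

Fixpoint ppow (l : list R) (n : nat) : list R :=
  match n with O => 1%R :: nil | S n => pmul l (ppow l n) end.

(** The recursion is Delta(a + X L) = X Delta L + L + Delta L. Each difference loses a coefficient,
    which makes the continuation argument terminate. *)
Fixpoint pdelta (l : list R) : list R :=
  match l with nil => nil | _ :: l => padd (pshift (pdelta l)) (padd l (pdelta l)) end.

Lemma peval_padd (l m : list R) (z : C) : peval (padd l m) z = peval l z + peval m z.
Proof.
  revert m. induction l as [|a l IH]; intros [|b m]; simpl; try ring.
  rewrite IH, RtoC_plus. ring.
Qed.

Lemma peval_pshift (l : list R) (z : C) : peval (pshift l) z = z * peval l z.
Proof. destruct l; simpl; ring. Qed.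

Lemma peval_pmul (l m : list R) (z : C) : peval (pmul l m) z = peval l z * peval m z.
Proof.
  assert (E : forall a, peval (map (Rmult a) m) z = RtoC a * peval m z).
  { intros a. induction m as [|b m IH]; simpl; [ring|]. rewrite IH, RtoC_mult. ring. }
  induction l as [|a l IH]; simpl; [ring|].
  rewrite peval_padd, peval_pshift, E, IH. ring.
Qed.

Lemma peval_ppow (l : list R) (n : nat) (z : C) : peval (ppow l n) z = peval l z ^ n.
Proof.
  induction n as [|n IH]; simpl ppow; [simpl; ring|]. rewrite peval_pmul, IH, Cpow_S. ring.
Qed.

Lemma peval_pdelta (l : list R) (z : C) : peval (pdelta l) z = peval l (z + 1) - peval l z.
Proof.
  induction l as [|a l IH]; simpl; [ring|].
  rewrite !peval_padd, peval_pshift, IH. ring.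
Qed.

Lemma peval_conj (l : list R) (z : C) : Cconj (peval l z) = peval l (Cconj z).
Proof.
  induction l as [|a l IH]; simpl; [apply C_pair_intro; simpl; ring|].
  now rewrite Cconj_plus, Cconj_mult, IH, Cconj_RtoC.
Qed.

Lemma wd_peval (l : list R) (z : C) : wd (peval l) z (peval (pderiv l) z) 0.
Proof.
  induction l as [|a l IH]; [exact (wd_const 0 z)|].
  apply wd_eq with (1 := wd_plus _ _ _ _ _ _ _ (wd_const (RtoC a) z)
    (wd_mult _ _ _ _ _ _ _ (wd_id z) IH)); auto.
  - simpl. rewrite peval_padd, peval_pshift. ring.
  - ring.
Qed.

Lemma length_padd (l m : list R) : length (padd l m) = Nat.max (length l) (length m).
Proof.
  revert m. induction l as [|a l IH]; intros [|b m]; simpl; auto.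
Qed.

Lemma length_pshift (l : list R) :
  length (pshift l) = match l with nil => 0%nat | _ => S (length l) end.
Proof. destruct l; reflexivity. Qed.

Lemma length_pderiv (l : list R) : length (pderiv l) = pred (length l).
Proof.
  induction l as [|a l IH]; simpl; auto.
  rewrite length_padd, length_pshift. destruct l as [|b l]; [reflexivity|].
  revert IH. destruct (pderiv (b :: l)); simpl; lia.
Qed.

Lemma length_pdelta (l : list R) : (length (pdelta l) <= pred (length l))%nat.
Proof.
  induction l as [|a l IH]; simpl; auto.
  rewrite !length_padd, length_pshift. destruct l as [|b l]; [reflexivity|].
  revert IH. destruct (pdelta (b :: l)); cbn [length pred]; lia.
Qed.

Lemma length_pmul (l m : list R) :
  (length (pmul l m) <= pred (length l + length m))%nat.
Proof.
  induction l as [|a l IH]; simpl; [lia|].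
  rewrite length_padd, length_pshift, length_map.
  revert IH. destruct (pmul l m); simpl; lia.
Qed.

Lemma length_ppow (l : list R) (d n : nat) :
  (length l <= S d)%nat -> (length (ppow l n) <= S (n * d))%nat.
Proof.
  intros H. induction n as [|n IH]; simpl; auto.
  assert (K := length_pmul l (ppow l n)). lia.
Qed.

Definition ptower (l : list R) (i : nat) : C -> C := peval (Nat.iter i pderiv l).

Lemma wd_ptower (l : list R) (i : nat) (z : C) : wd (ptower l i) z (ptower l (S i) z) 0.
Proof. apply wd_peval. Qed.

Lemma length_iter_pderiv (l : list R) (i : nat) :
  length (Nat.iter i pderiv l) = (length l - i)%nat.
Proof.
  induction i as [|i IH]; simpl; [lia|]. rewrite length_pderiv. unfold Nat.iter in *. lia.
Qed.

Lemma ptower_zero (l : list R) (i : nat) (z : C) : (length l <= i)%nat -> ptower l i z = 0.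
Proof.
  intros H. unfold ptower. assert (K := length_iter_pderiv l i).
  destruct (Nat.iter i pderiv l); [reflexivity|]. simpl in K. lia.
Qed.

Lemma ptower_pderiv (l : list R) (i : nat) : ptower (pderiv l) i = ptower l (S i).
Proof.
  unfold ptower. f_equal. induction i as [|i IH]; simpl; auto. now rewrite IH.
Qed.

Lemma ptower_conj (l : list R) (i : nat) (z : C) : Cconj (ptower l i z) = ptower l i (Cconj z).
Proof. apply peval_conj. Qed.

(** As a function of the expansion point z, the Taylor sum has derivative equal to its top term,
    which contains a vanishing derivative of the polynomial; it is therefore constant, and it is
    evaluated at z = b. *)
Lemma ptower_taylor (l : list R) (n m : nat) (z b : C) :
  (length l <= S n)%nat -> (m <= n)%nat ->
  taylor (S n - m) (fun i => ptower l (m + i) z) (b - z) = ptower l m b.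
Proof.
  intros Hl Hm. replace (S n - m)%nat with (S (n - m)) by lia.
  set (S0 := fun w => taylor (S (n - m)) (fun i => ptower l (m + i) w) (b - w)).
  assert (D : forall w, True -> wd S0 w 0 0).
  { intros w _.
    assert (Hy : wd (fun w => b - w) w (Copp 1) 0).
    { apply wd_eq with (1 := wd_minus _ _ _ _ _ _ _ (wd_const b w) (wd_id w)); intros; ring. }
    assert (He : forall i, (i <= n - m)%nat -> wd (ptower l (m + i)) w (ptower l (m + S i) w) 0).
    { intros i _. rewrite Nat.add_succ_r. apply wd_ptower. }
    apply wd_eq with (1 := wd_taylor (n - m) (fun i => ptower l (m + i)) _ w 0 He Hy); auto.
    - rewrite ptower_zero by lia. ring.
    - ring. }
  change (S0 z = ptower l m b).
  rewrite (wd_zero_constant (fun _ => True) S0 convex_full D z b I I).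
  unfold S0, taylor. rewrite csum_shift, Nat.add_0_r.
  rewrite csum_zero.
  - simpl. field.
  - intros i _. replace (b - b) with (RtoC 0) by ring.
    rewrite Cpow_S. unfold Cdiv. ring.
Qed.

(** * The invariant pairing *)

(* The Rankin-Cohen bracket of order n of two functions of weight -n, for
   sequences f, p standing for the successive derivatives of the functions. *)
Definition bracket (n : nat) (f p : nat -> C -> C) (z : C) : C :=
  csum (fun i => sgn i * f (n - i)%nat z * p i z) (S n).

(** The alternating signs make the z-derivative telescope to its two ends, f^(n+1) p and f p^(n+1);
    the latter vanishes because p stands for a polynomial of degree at most n. *)
Lemma wd_bracket (n : nat) (f p : nat -> C -> C) (bf : nat -> C) (z : C) :
  (forall i, (i <= n)%nat -> wd (f i) z (f (S i) z) (bf i)) ->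
  (forall i, (i <= n)%nat -> wd (p i) z (p (S i) z) 0) ->
  p (S n) z = 0 ->
  wd (bracket n f p) z (f (S n) z * p O z)
    (csum (fun i => sgn i * bf (n - i)%nat * p i z) (S n)).
Proof.
  intros Hf Hp Hz.
  assert (T : forall N, (N <= S n)%nat ->
    csum (fun i => sgn i * (f (S (n - i)) z * p i z + f (n - i)%nat z * p (S i) z)) N
    = f (S n) z * p O z - sgn N * f (S n - N)%nat z * p N z).
  { induction N as [|N IH]; intros HN.
    - unfold sgn. simpl. ring.
    - rewrite csum_S, IH by lia. rewrite sgn_S.
      replace (S n - N)%nat with (S (n - N)) by lia.
      replace (S n - S N)%nat with (n - N)%nat by lia. ring. }
  assert (Q : forall i, (i < S n)%nat -> wd (fun w => sgn i * f (n - i)%nat w * p i w) z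
     (sgn i * (f (S (n - i)) z * p i z + f (n - i)%nat z * p (S i) z))
     (sgn i * bf (n - i)%nat * p i z)).
  { intros i Hi.
    apply wd_eq with (1 := wd_mult _ _ _ _ _ _ _
      (wd_scal (sgn i) _ _ _ _ (Hf (n - i)%nat ltac:(lia))) (Hp i ltac:(lia)));
    intros; auto; ring. }
  apply wd_eq with (1 := wd_csum _ _ _ _ _ Q); auto.
  rewrite T by lia. rewrite Hz. ring.
Qed.

(** * The action of the modular group *)

Lemma autfactor_neq_0 (g : mat2) (z : C) : SL2Z g -> upper z -> autfactor g z <> 0.
Proof.
  intros Hg Hz H. unfold autfactor, ZtoC, upper, SL2Z in *. destruct z as [x y]. simpl in Hz.
  assert (H1 := f_equal snd H). assert (H2 := f_equal fst H). simpl in H1, H2.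
  assert (E : IZR (m21 g) = 0%R).
  { destruct (Rmult_integral (IZR (m21 g)) y); lra. }
  rewrite E in H2. assert (E' : IZR (m22 g) = 0%R) by lra.
  apply eq_IZR in E, E'. rewrite E, E' in Hg. lia.
Qed.

Lemma moebius_upper (g : mat2) (z : C) : SL2Z g -> upper z -> upper (moebius g z).
Proof.
  intros Hg Hz. assert (HA := autfactor_neq_0 g z Hg Hz).
  assert (Hm := proj1 (Cmod_gt_0 _) HA).
  assert (E : Im (moebius g z) = (Im z / Cmod (autfactor g z) ^ 2)%R).
  { assert (Hn : (Cmod (autfactor g z) ^ 2 <> 0)%R) by (apply Rgt_not_eq; nra).
    unfold SL2Z in Hg. apply (f_equal IZR) in Hg. rewrite minus_IZR, !mult_IZR in Hg.
    revert Hn. rewrite Cmod2_alt. unfold moebius, autfactor, ZtoC. destruct z as [x y].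
    unfold Re, Im; simpl.
    generalize dependent (IZR (m11 g)). generalize dependent (IZR (m12 g)).
    generalize (IZR (m21 g)) (IZR (m22 g)). intros c d b a Hd Hn.
    transitivity ((a * d - b * c) * y / ((c * x - 0 * y + d) * ((c * x - 0 * y + d) * 1) +
       (c * y + 0 * x + 0) * ((c * y + 0 * x + 0) * 1)))%R; [|rewrite Hd]; field;
    (intros E; apply Hn; etransitivity; [|exact E]; ring). }
  unfold upper in *. rewrite E. apply Rdiv_lt_0_compat; auto. nra.
Qed.

Lemma wd_autfactor (g : mat2) (z : C) : wd (autfactor g) z (ZtoC (m21 g)) 0.
Proof.
  apply wd_eq with (1 := wd_plus _ _ _ _ _ _ _ (wd_scal (ZtoC (m21 g)) _ _ _ _ (wd_id z))
    (wd_const (ZtoC (m22 g)) z)); intros; auto; ring.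
Qed.

Lemma ZtoC_SL2Z (g : mat2) : SL2Z g ->
  ZtoC (m11 g) * ZtoC (m22 g) - ZtoC (m12 g) * ZtoC (m21 g) = 1.
Proof.
  unfold SL2Z, ZtoC. intros H. rewrite <- !RtoC_mult, <- RtoC_minus, <- !mult_IZR, <- minus_IZR.
  now rewrite H.
Qed.

Lemma wd_moebius (g : mat2) (z : C) : SL2Z g -> upper z ->
  wd (moebius g) z (/ autfactor g z * / autfactor g z) 0.
Proof.
  intros Hg Hz. assert (HA := autfactor_neq_0 g z Hg Hz). assert (Hd := ZtoC_SL2Z g Hg).
  assert (N := wd_plus _ _ _ _ _ _ _ (wd_scal (ZtoC (m11 g)) _ _ _ _ (wd_id z))
    (wd_const (ZtoC (m12 g)) z)).
  assert (N' : wd (fun w => ZtoC (m11 g) * w + ZtoC (m12 g)) z (ZtoC (m11 g)) 0).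
  { apply wd_eq with (1 := N); intros; auto; ring. }
  apply wd_eq with (1 := wd_mult _ _ _ _ _ _ _ N' (wd_inv _ _ _ HA (wd_autfactor g z))); auto.
  - transitivity ((ZtoC (m11 g) * ZtoC (m22 g) - ZtoC (m12 g) * ZtoC (m21 g)) *
      (/ autfactor g z * / autfactor g z)); [|rewrite Hd; ring].
    unfold autfactor in *. field; auto.
  - ring.
Qed.

(* With A = cz + d, the r-th derivative of A^n f(gz) is the sum over j of
   [transfer n r j * c^(r-j) * A^(n-r-j) * f^(j)(gz)]. *)
Fixpoint transfer (n r j : nat) : R :=
  match r with
  | O => if Nat.eqb j 0 then 1%R else 0%R
  | S r => ((INR n - INR r - INR j) * transfer n r j +
            match j with O => 0 | S j => transfer n r j end)%R
  end.

Lemma transfer_gt (n r j : nat) : (r < j)%nat -> transfer n r j = 0%R.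
Proof.
  revert j. induction r as [|r IH]; intros [|j] H; simpl; try lia; auto.
  rewrite !IH by lia. ring.
Qed.

Lemma transfer_diag (n r : nat) : transfer n r r = 1%R.
Proof.
  induction r as [|r IH]; simpl; auto. rewrite transfer_gt, IH by lia. ring.
Qed.

(** The ratio of consecutive entries in the closed form binom(r, j) (n-j)(n-j-1)...(n-r+1), derived
    from the recursion without division. *)
Lemma transfer_lower (n r j : nat) :
  ((INR (S r) - INR j) * transfer n (S r) j =
   INR (S r) * (INR n - INR r) * transfer n r j)%R.
Proof.
  revert j. induction r as [|r IH]; intros j.
  - destruct j as [|[|j]].
    + simpl. ring.
    + rewrite transfer_diag. simpl. ring.
    + rewrite !transfer_gt by lia. ring.
  - change (transfer n (S (S r)) j) with ((INR n - INR (S r) - INR j) * transfer n (S r) j +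
      match j with O => 0 | S j => transfer n (S r) j end)%R.
    destruct j as [|j].
    + change (INR 0) with 0%R. ring.
    + assert (K := IH (S j)). assert (K' := IH j).
      assert (E : transfer n (S r) (S j) = ((INR n - INR r - INR (S j)) * transfer n r (S j)
        + transfer n r j)%R) by reflexivity.
      rewrite (S_INR (S r)), (S_INR r), (S_INR j) in *.
      assert (E' : transfer n r j = (transfer n (S r) (S j)
        - (INR n - INR r - (INR j + 1)) * transfer n r (S j))%R) by lra.
      replace ((INR r + 1 + 1 - (INR j + 1)) * ((INR n - (INR r + 1) - (INR j + 1)) *
        transfer n (S r) (S j) + transfer n (S r) j))%R with
        ((INR r + 1 + 1 - (INR j + 1)) * (INR n - (INR r + 1) - (INR j + 1)) *
          transfer n (S r) (S j) + (INR r + 1 - INR j) * transfer n (S r) j)%R by ring.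
      rewrite K', E'.
      replace ((INR r + 1) * (INR n - INR r) *
        (transfer n (S r) (S j) - (INR n - INR r - (INR j + 1)) * transfer n r (S j)))%R with
        ((INR r + 1) * (INR n - INR r) * transfer n (S r) (S j)
         - (INR n - INR r - (INR j + 1)) * ((INR r + 1) * (INR n - INR r) * transfer n r (S j)))%R
        by ring.
      rewrite <- K. ring.
Qed.

(* [a] and [ai] stand for A and its inverse, [s] for the lower left entry c. *)
Definition transfer_sum (n : nat) (a ai : C) (b : nat -> C) (r : nat) (s : C) : C :=
  csum (fun j => RtoC (transfer n r j) * s ^ (r - j) * (a ^ n * ai ^ (r + j)) * b j) (S r).

(** The entry c is varied alone, with A, its inverse and the values b held fixed. In this variable
    the sums form a ladder: differentiation sends order r to r (n-r+1) / A times order r-1. *)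
Lemma wd_transfer_sum (n : nat) (a ai : C) (b : nat -> C) (r : nat) (s : C) :
  wd (transfer_sum n a ai b r) s
    (RtoC (INR r * (INR n - INR (pred r))) * ai * transfer_sum n a ai b (pred r) s) 0.
Proof.
  assert (Q : forall j, (j < S r)%nat ->
    wd (fun w => RtoC (transfer n r j) * w ^ (r - j) * (a ^ n * ai ^ (r + j)) * b j) s
    (RtoC (transfer n r j) * (INR (r - j) * s ^ pred (r - j) * 1) * (a ^ n * ai ^ (r + j)) * b j) 0).
  { intros j _.
    apply wd_eq with (1 := wd_scal (RtoC (transfer n r j) * (a ^ n * ai ^ (r + j)) * b j) _ _ _ _
      (wd_pow _ _ _ (r - j) (wd_id s))); intros; ring. }
  apply wd_eq with (1 := wd_csum _ _ _ (fun _ => 0) _ Q); auto.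
  2: { apply csum_zero; auto. }
  clear Q.
  destruct r as [|r].
  - unfold transfer_sum; simpl; rewrite Rmult_0_l; ring.
  - rewrite csum_S, Nat.sub_diag. change (pred (S r)) with r. unfold transfer_sum. rewrite <- csum_scal.
    replace (RtoC (transfer n (S r) (S r)) * (INR 0 * s ^ pred 0 * 1) * (a ^ n * ai ^ (S r + S r)) * b (S r))
      with (RtoC 0) by (simpl; ring).
    rewrite Cplus_0_r. apply csum_ext. intros j Hj.
    replace (S r - j)%nat with (S (r - j)) by lia. change (pred (S (r - j))) with (r - j)%nat.
    assert (E : RtoC (transfer n (S r) j) * RtoC (INR (S (r - j))) =
      RtoC (INR (S r) * (INR n - INR r)) * RtoC (transfer n r j)).
    { rewrite <- !RtoC_mult. f_equal. rewrite <- transfer_lower.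
      replace (S (r - j)) with (S r - j)%nat by lia. rewrite minus_INR by lia. ring. }
    replace (S r + j)%nat with (S (r + j)) by lia. rewrite Cpow_S.
    transitivity ((RtoC (transfer n (S r) j) * RtoC (INR (S (r - j)))) * (s ^ (r - j) *
      (a ^ n * (ai * ai ^ (r + j))) * b j)); [|rewrite E]; ring.
Qed.

(** The left side does not depend on [s]: its derivative telescopes, since the ladder factor r
    (n-r+1) is symmetric under r -> n+1-r. At s = 0 only the diagonal terms survive, and their
    powers of A cancel. *)
Lemma transfer_pairing (n : nat) (a ai : C) (b b' : nat -> C) (s : C) : a * ai = 1 ->
  csum (fun r => sgn r * transfer_sum n a ai b (n - r) s * transfer_sum n a ai b' r s) (S n) =
  csum (fun r => sgn r * b (n - r)%nat * b' r) (S n).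
Proof.
  intros Ha.
  set (B := fun s => csum (fun r => sgn r * transfer_sum n a ai b (n - r) s * transfer_sum n a ai b' r s) (S n)).
  set (c := fun r => RtoC (INR r * (INR n - INR (pred r))) * ai).
  assert (D : forall s, True -> wd B s 0 0).
  { clear s. intros s _.
    (* One product is left over at each stage; at N = n its factor [c 0] is zero. *)
    assert (T : forall N, (N <= n)%nat ->
      csum (fun r => sgn r * (c (n - r)%nat * transfer_sum n a ai b (pred (n - r)) s * transfer_sum n a ai b' r s
         + transfer_sum n a ai b (n - r) s * (c r * transfer_sum n a ai b' (pred r) s))) (S N)
      = sgn N * (c (n - N)%nat * transfer_sum n a ai b (pred (n - N)) s * transfer_sum n a ai b' N s)).
    { induction N as [|N IH]; intros HN.
      - simpl csum. unfold c at 2. simpl INR. rewrite Rmult_0_l. ring.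
      - rewrite csum_S, IH by lia. rewrite sgn_S.
        assert (E : c (n - N)%nat = c (S N)).
        { unfold c. f_equal. f_equal.
          replace (pred (n - N)) with (n - S N)%nat by lia. simpl pred.
          rewrite !minus_INR by lia. rewrite S_INR. ring. }
        rewrite E. simpl pred. replace (pred (n - N)) with (n - S N)%nat by lia. ring. }
    assert (Q : forall r, (r < S n)%nat ->
      wd (fun s => sgn r * transfer_sum n a ai b (n - r) s * transfer_sum n a ai b' r s) s
      (sgn r * (c (n - r)%nat * transfer_sum n a ai b (pred (n - r)) s * transfer_sum n a ai b' r s
         + transfer_sum n a ai b (n - r) s * (c r * transfer_sum n a ai b' (pred r) s))) 0).
    { intros r _. apply wd_eq with (1 := wd_mult _ _ _ _ _ _ _
        (wd_scal (sgn r) _ _ _ _ (wd_transfer_sum n a ai b (n - r) s))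
        (wd_transfer_sum n a ai b' r s)); intros; auto; unfold c; ring. }
    apply wd_eq with (1 := wd_csum _ _ _ (fun _ => 0) _ Q); auto.
    - rewrite T by lia. unfold c. rewrite Nat.sub_diag. simpl INR. rewrite Rmult_0_l. ring.
    - apply csum_zero; auto. }
  change (B s = csum (fun r => sgn r * b (n - r)%nat * b' r) (S n)).
  rewrite (wd_zero_constant _ B convex_full D s 0 I I).
  apply csum_ext. intros r Hr.
  assert (E : forall d m, transfer_sum n a ai d m 0 = a ^ n * ai ^ (m + m) * d m).
  { intros d m. unfold transfer_sum. rewrite csum_S, csum_zero.
    - rewrite transfer_diag, Nat.sub_diag. simpl. ring.
    - intros j Hj. replace (m - j)%nat with (S (m - j - 1)) by lia. rewrite Cpow_S. ring. }
  rewrite !E.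
  replace (sgn r * (a ^ n * ai ^ (n - r + (n - r)) * b (n - r)%nat) * (a ^ n * ai ^ (r + r) * b' r))
    with (sgn r * b (n - r)%nat * b' r * ((a ^ n * a ^ n) * (ai ^ (n - r + (n - r)) * ai ^ (r + r)))) by ring.
  rewrite <- !Cpow_add_r. replace (n - r + (n - r) + (r + r))%nat with (n + n)%nat by lia.
  rewrite <- Cpow_mult_l, Ha, Cpow_1_l. ring.
Qed.

(** Only the z-derivative is recorded, so that the equivariance results cover both the holomorphic
    Eichler integral and the non-holomorphic form M. *)
Definition wdz (f : C -> C) (z a : C) : Prop := exists b, wd f z a b.

(** Differentiating A^(n-r-j) f^(j)(gz) yields a factor (n-r-j) c from the power of A and, since gz
    has derivative A^(-2), a term with f^(j+1): these are the two summands in the recursion of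
    [transfer]. The exponent n-r-j may be negative, hence the separate powers of A and of its
    inverse. *)
Lemma derivatives_moebius (n : nat) (g : mat2) (f ft : nat -> C -> C) : SL2Z g ->
  (forall i z, (i < n)%nat -> upper z -> wdz (f i) z (f (S i) z)) ->
  (forall i z, (i < n)%nat -> upper z -> wdz (ft i) z (ft (S i) z)) ->
  (forall z, upper z -> ft O z = autfactor g z ^ n * f O (moebius g z)) ->
  forall r z, (r <= n)%nat -> upper z ->
  ft r z = transfer_sum n (autfactor g z) (/ autfactor g z)
    (fun j => f j (moebius g z)) r (ZtoC (m21 g)).
Proof.
  intros Hg Hf Hft H0. induction r as [|r IH]; intros z Hr Hz.
  - rewrite H0 by auto. unfold transfer_sum. simpl. ring.
  - set (c := ZtoC (m21 g)) in *.
    assert (HA := autfactor_neq_0 g z Hg Hz).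
    destruct (Hft r z ltac:(lia) Hz) as [b Hb].
    assert (Hai : wd (fun w => / autfactor g w) z (- c * (/ autfactor g z * / autfactor g z)) 0).
    { apply wd_eq with (1 := wd_inv _ _ _ HA (wd_autfactor g z)); auto. fold c. field; auto. }
    set (A := autfactor g z) in *. set (ai := / A) in *.
    assert (Hp : forall m, wd (fun w => autfactor g w ^ n * (/ autfactor g w) ^ m) z
       (RtoC (INR n - INR m) * c * (A ^ n * ai ^ S m)) 0).
    { intros m.
      apply wd_eq with (1 := wd_mult _ _ _ _ _ _ _ (wd_pow _ _ _ n (wd_autfactor g z))
        (wd_pow _ _ _ m Hai)); auto; [|ring].
      fold A ai c. rewrite Cpow_S, RtoC_minus.
      assert (E1 : INR n * A ^ pred n * c = INR n * A ^ n * ai * c).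
      { destruct n as [|n']; [simpl; ring|]. simpl pred. rewrite Cpow_S. unfold ai. field. auto. }
      assert (E2 : INR m * ai ^ pred m * (- c * (ai * ai)) = - (INR m * ai ^ m * ai * c)).
      { destruct m as [|m']; [simpl; ring|]. simpl pred. rewrite Cpow_S. ring. }
      rewrite E1, E2. ring. }
    assert (Hj : forall j, exists bj, (j <= r)%nat -> wd (fun w => f j (moebius g w)) z (f (S j) (moebius g z) * (ai * ai)) bj).
    { intros j. destruct (le_lt_dec j r) as [Hle|Hlt].
      - destruct (Hf j (moebius g z) ltac:(lia) (moebius_upper g z Hg Hz)) as [bj Hbj].
        eexists. intros _.
        apply wd_eq with (1 := wd_comp _ _ _ _ _ _ _ Hbj (wd_moebius g z Hg Hz)); auto.
        + fold A ai. replace (Cconj 0) with (RtoC 0) by (apply C_pair_intro; simpl; ring). ring.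
      - exists 0. lia. }
    assert (Hb2 : exists b', wd (fun w => transfer_sum n (autfactor g w) (/ autfactor g w)
      (fun j => f j (moebius g w)) r c) z (transfer_sum n A ai (fun j => f j (moebius g z)) (S r) c) b').
    (* The unknown zbar-derivatives are gathered into one sequence, a finite choice made by
       induction on r. *)
    { assert (Hch : exists bb : nat -> C, forall j, (j <= r)%nat ->
        wd (fun w => f j (moebius g w)) z (f (S j) (moebius g z) * (ai * ai)) (bb j)).
      { clear - Hj. induction r as [|r IH].
        - destruct (Hj O) as [b0 H0]. exists (fun _ => b0). intros j Hle.
          replace j with O by lia. apply H0. lia.
        - destruct IH as [bb Hbb].
          { intros j. destruct (Hj j) as [bj H]. exists bj. intros; apply H; lia. }
          destruct (Hj (S r)) as [b1 H1].
          exists (fun j => if Nat.eqb j (S r) then b1 else bb j). intros j Hle.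
          destruct (Nat.eqb_spec j (S r)) as [->|Hne]; [apply H1; lia|apply Hbb; lia]. }
      destruct Hch as [bb Hbb].
      assert (Q : forall j, (j < S r)%nat ->
        wd (fun w => RtoC (transfer n r j) * c ^ (r - j) *
          (autfactor g w ^ n * (/ autfactor g w) ^ (r + j)) * f j (moebius g w)) z
        (RtoC (transfer n r j) * c ^ (r - j) *
          ((RtoC (INR n - INR (r + j)) * c * (A ^ n * ai ^ S (r + j))) * f j (moebius g z)
           + (A ^ n * ai ^ (r + j)) * (f (S j) (moebius g z) * (ai * ai))))
        (RtoC (transfer n r j) * c ^ (r - j) * (A ^ n * ai ^ (r + j)) * bb j)).
      { intros j Hjr. apply wd_eq with (1 := wd_mult _ _ _ _ _ _ _
          (wd_scal (RtoC (transfer n r j) * c ^ (r - j)) _ _ _ _ (Hp (r + j)%nat))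
          (Hbb j ltac:(lia))); intros; auto; fold A ai; ring. }
      exists (csum (fun j => RtoC (transfer n r j) * c ^ (r - j) * (A ^ n * ai ^ (r + j)) * bb j) (S r)).
      apply wd_eq with (1 := wd_csum _ _ _ _ _ Q); auto.
      clear Q.
      unfold transfer_sum.
      transitivity (csum (fun j => RtoC ((INR n - INR r - INR j) * transfer n r j) * c ^ (S r - j) *
          (A ^ n * ai ^ (S r + j)) * f j (moebius g z)) (S (S r))
        + csum (fun j => RtoC (match j with O => 0%R | S j => transfer n r j end) * c ^ (S r - j) *
          (A ^ n * ai ^ (S r + j)) * f j (moebius g z)) (S (S r))).
      - rewrite (csum_S _ (S r)), (csum_shift _ (S r)).
        replace (RtoC ((INR n - INR r - INR (S r)) * transfer n r (S r))) with (RtoC 0)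
          by (rewrite transfer_gt by lia; f_equal; ring).
        rewrite !Cmult_0_l, Cplus_0_r, Cplus_0_l, <- csum_plus.
        apply csum_ext. intros j Hjr.
        replace (S r - S j)%nat with (r - j)%nat by lia.
        replace (S r - j)%nat with (S (r - j)) by lia.
        replace (S r + j)%nat with (S (r + j)) by lia.
        replace (S r + S j)%nat with (S (S (r + j))) by lia.
        rewrite !Cpow_S, plus_INR, !RtoC_mult, !RtoC_minus, RtoC_plus. ring.
      - rewrite <- csum_plus. apply csum_ext. intros j _.
        change (transfer n (S r) j) with ((INR n - INR r - INR j) * transfer n r j +
          match j with O => 0 | S j => transfer n r j end)%R.
        rewrite RtoC_plus. ring. }
    destruct Hb2 as [b' Hb'].
    (* Both functions agree on the whole half-plane by induction, so their differentials at z
       agree. *)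
    apply (wd_unique (ft r) z _ b _ b'); auto.
    apply wd_ext_upper with (3 := Hb'); auto. intros w Hw. symmetry. apply IH; auto. lia.
Qed.

(** Both sequences of derivatives are transfer sums with the same A and c, so the invariance is
    [transfer_pairing]; the transformation law is needed for the functions of index 0 only. *)
Lemma bracket_moebius (n : nat) (g : mat2) (f ft p pt : nat -> C -> C) : SL2Z g ->
  (forall i z, (i < n)%nat -> upper z -> wdz (f i) z (f (S i) z)) ->
  (forall i z, (i < n)%nat -> upper z -> wdz (ft i) z (ft (S i) z)) ->
  (forall z, upper z -> ft O z = autfactor g z ^ n * f O (moebius g z)) ->
  (forall i z, (i < n)%nat -> upper z -> wdz (p i) z (p (S i) z)) ->
  (forall i z, (i < n)%nat -> upper z -> wdz (pt i) z (pt (S i) z)) ->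
  (forall z, upper z -> pt O z = autfactor g z ^ n * p O (moebius g z)) ->
  forall z, upper z -> bracket n ft pt z = bracket n f p (moebius g z).
Proof.
  intros Hg H1 H2 H3 H4 H5 H6 z Hz. unfold bracket.
  rewrite <- (transfer_pairing n (autfactor g z) (/ autfactor g z)
    (fun j => f j (moebius g z)) (fun j => p j (moebius g z)) (ZtoC (m21 g))).
  - apply csum_ext. intros i Hi.
    rewrite <- (derivatives_moebius n g f ft), <- (derivatives_moebius n g p pt); auto; lia.
  - apply Cinv_r, autfactor_neq_0; auto.
Qed.

(** * Improper integrals *)

Definition limI (k : R -> C) (l : C) : Prop :=
  forall eps, (0 < eps)%R -> exists Y0, (0 <= Y0)%R /\
    forall Y, (Y0 <= Y)%R -> (Cmod (CI k 0 Y - l) < eps)%R.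

Definition cont_ray (k : R -> C) : Prop := forall t, (0 <= t)%R -> ccont k t.

Lemma cont_ray_isI (k : R -> C) (a b : R) : cont_ray k -> (0 <= a <= b)%R -> isI k a b (CI k a b).
Proof. intros H Hab. apply CI_correct; [lra|]. intros t Ht. apply H. lra. Qed.

Lemma limI_is_RInt_gen (k k' : R -> C) (l : C) : cont_ray k ->
  (forall t, (0 <= t)%R -> k t = k' t) -> limI k l ->
  @is_RInt_gen C_R_NormedModule k' (at_point 0%R) (Rbar_locally p_infty) l.
Proof.
  intros Hc E H P HP. apply (locally_C_Cmod l P) in HP. destruct HP as (d & Hd & HP).
  destruct (H d Hd) as (Y0 & HY0 & HY).
  apply Filter_prod with (Q := fun x => x = 0%R) (R := fun y => (Y0 < y)%R).
  - reflexivity.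
  - exists Y0. auto.
  - intros x y -> Hy. simpl. exists (CI k 0 y). split.
    + apply isI_eq with k (CI k 0 y); try lra; auto.
      * intros t Ht. apply E. lra.
      * apply cont_ray_isI; auto. lra.
    + apply HP, HY. lra.
Qed.

Lemma limI_unique (k : R -> C) (l l' : C) : limI k l -> limI k l' -> l = l'.
Proof.
  intros H H'.
  assert (E : l - l' = 0).
  { apply Cmod_eq_0, Rle_antisym; [|apply Cmod_ge_0]. apply le_epsilon. intros eps He.
    destruct (H (eps / 2)%R) as (Y & _ & K); [lra|].
    destruct (H' (eps / 2)%R) as (Y' & _ & K'); [lra|].
    specialize (K (Rmax Y Y') (Rmax_l _ _)). specialize (K' (Rmax Y Y') (Rmax_r _ _)).
    replace (l - l') with ((CI k 0 (Rmax Y Y') - l') + (- (CI k 0 (Rmax Y Y') - l))) by ring.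
    apply Rle_trans with (1 := Cmod_triangle _ _). rewrite Cmod_opp. lra. }
  replace l with ((l - l') + l') by ring. rewrite E. ring.
Qed.

Lemma limI_plus (k k' : R -> C) (l l' : C) : cont_ray k -> cont_ray k' ->
  limI k l -> limI k' l' -> limI (fun t => k t + k' t) (l + l').
Proof.
  intros Hc Hc' H H' eps He.
  destruct (H (eps / 2)%R) as (Y & HY & K); [lra|].
  destruct (H' (eps / 2)%R) as (Y' & HY' & K'); [lra|].
  exists (Rmax Y Y'); split; [apply Rle_trans with (1 := HY), Rmax_l|]. intros Z HZ.
  specialize (K Z (Rle_trans _ _ _ (Rmax_l _ _) HZ)).
  specialize (K' Z (Rle_trans _ _ _ (Rmax_r _ _) HZ)).
  assert (0 <= Z)%R by (apply Rle_trans with (1 := HY), Rle_trans with (2 := HZ), Rmax_l).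
  rewrite (isI_unique _ _ _ _ (isI_plus _ _ _ _ _ _ (cont_ray_isI k 0 Z Hc ltac:(lra))
    (cont_ray_isI k' 0 Z Hc' ltac:(lra)))).
  replace (CI k 0 Z + CI k' 0 Z - (l + l')) with ((CI k 0 Z - l) + (CI k' 0 Z - l')) by ring.
  apply Rle_lt_trans with (1 := Cmod_triangle _ _). lra.
Qed.

Lemma limI_scal (c : C) (k : R -> C) (l : C) : cont_ray k ->
  limI k l -> limI (fun t => c * k t) (c * l).
Proof.
  intros Hc H eps He. assert (H0 := Cmod_ge_0 c).
  destruct (H (eps / (Cmod c + 1))%R) as (Y & HY & K); [apply Rdiv_lt_0_compat; lra|].
  exists Y; split; auto. intros Z HZ. specialize (K Z HZ).
  rewrite (isI_unique _ _ _ _ (isI_scal c _ _ _ _ (cont_ray_isI k 0 Z Hc ltac:(lra)))).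
  replace (c * CI k 0 Z - c * l) with (c * (CI k 0 Z - l)) by ring.
  rewrite Cmod_mult.
  apply Rle_lt_trans with ((Cmod c + 1) * Cmod (CI k 0 Z - l))%R.
  - apply Rmult_le_compat_r; auto using Cmod_ge_0. lra.
  - apply Rlt_le_trans with ((Cmod c + 1) * (eps / (Cmod c + 1)))%R.
    + apply Rmult_lt_compat_l; lra.
    + right. field. lra.
Qed.

Lemma is_RInt_exp (B d a b : R) : (0 < d)%R ->
  is_RInt (fun t => B * exp (- d * t))%R a b (B / d * (exp (- d * a) - exp (- d * b)))%R.
Proof.
  intros Hd.
  eapply eq_rect.
  - apply (is_RInt_derive (V := R_CompleteNormedModule) (fun t => - (B / d) * exp (- d * t))%R
      (fun t => B * exp (- d * t))%R).
    + intros t _. auto_derive; auto. field. lra.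
    + intros t _. apply (ex_derive_continuous (fun t => B * exp (- d * t))%R). auto_derive. auto.
  - unfold minus, plus, opp; simpl. ring.
Qed.

Lemma tail_bound (k : R -> C) (B d a b : R) : cont_ray k -> (0 < d)%R -> (0 <= a <= b)%R ->
  (forall t, (0 <= t)%R -> (Cmod (k t) <= B * exp (- d * t))%R) ->
  (Cmod (CI k a b) <= B / d * exp (- d * a))%R.
Proof.
  intros Hc Hd Hab Hk.
  assert (HB : (0 <= B)%R).
  { assert (K := Rle_trans _ _ _ (Cmod_ge_0 _) (Hk 0%R ltac:(lra))).
    replace (- d * 0)%R with 0%R in K by ring. rewrite exp_0 in K. lra. }
  apply Rle_trans with (B / d * (exp (- d * a) - exp (- d * b)))%R.
  - apply (isI_bound k (fun t => B * exp (- d * t))%R a b); try lra.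
    + intros t Ht. apply Hk. lra.
    + apply cont_ray_isI; auto.
    + apply is_RInt_exp; auto.
  - apply Rmult_le_compat_l.
    + apply Rmult_le_pos; auto. left. apply Rinv_0_lt_compat; auto.
    + generalize (exp_pos (- d * b)). lra.
Qed.

Lemma exp_small (B d eps : R) : (0 <= B)%R -> (0 < d)%R -> (0 < eps)%R ->
  exists Y0, (0 <= Y0)%R /\ forall a, (Y0 <= a)%R -> (B * exp (- d * a) < eps)%R.
Proof.
  (* For such a, exp (d a) >= 1 + d a > B / eps. *)
  intros HB Hd He. exists (B / (d * eps))%R. split.
  { apply Rmult_le_pos; auto. left. apply Rinv_0_lt_compat, Rmult_lt_0_compat; auto. }
  intros a Ha. replace (- d * a)%R with (- (d * a))%R by ring. rewrite exp_Ropp.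
  apply Rle_div_l in Ha; [|apply Rmult_lt_0_compat; auto].
  assert (E : (1 + d * a <= exp (d * a))%R) by apply exp_ineq1_le.
  assert (Hx := exp_pos (d * a)). apply Rlt_div_l; auto.
  apply Rle_lt_trans with (1 := Ha). nra.
Qed.

Lemma limI_exists (k : R -> C) (B d : R) : cont_ray k -> (0 < d)%R ->
  (forall t, (0 <= t)%R -> (Cmod (k t) <= B * exp (- d * t))%R) ->
  exists l, limI k l /\ (Cmod l <= B / d)%R.
Proof.
  intros Hc Hd Hk.
  assert (HB : (0 <= B)%R).
  { assert (K := Rle_trans _ _ _ (Cmod_ge_0 _) (Hk 0%R ltac:(lra))).
    replace (- d * 0)%R with 0%R in K by ring. rewrite exp_0 in K. lra. }
  assert (HBd : (0 <= B / d)%R).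
  { apply Rmult_le_pos; auto. left. apply Rinv_0_lt_compat; auto. }
  destruct (proj1 (filterlim_locally_cauchy (U := C_R_CompleteNormedModule)
    (F := Rbar_locally p_infty) (fun Y => CI k 0 Y))) as [l Hl].
  { intros eps. destruct (exp_small (B / d) d eps HBd Hd (cond_pos eps)) as (Y0 & HY0 & K).
    exists (fun Y => (Y0 < Y)%R). split; [now exists Y0|].
    assert (G : forall u v, (Y0 < u)%R -> (u <= v)%R -> (Cmod (CI k 0 v - CI k 0 u) < eps)%R).
    { intros u v Hu Huv.
      rewrite (isI_unique k 0 v _ (isI_Chasles k 0 u v _ _ (cont_ray_isI k 0 u Hc ltac:(lra))
        (cont_ray_isI k u v Hc ltac:(lra)))).
      replace (CI k 0 u + CI k u v - CI k 0 u) with (CI k u v) by ring.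
      apply Rle_lt_trans with (2 := K u ltac:(lra)). apply tail_bound; auto. lra. }
    assert (G' : forall x y : C, (Cmod (y - x) < eps)%R -> ball (M := C_UniformSpace) x eps y).
    { intros x y Hxy. split.
      - apply Rle_lt_trans with (2 := Hxy). apply (re_le_Cmod (y - x)).
      - apply Rle_lt_trans with (2 := Hxy). apply (Im_le_Cmod (y - x)). }
    intros u v Hu Hv. apply G'.
    destruct (Rle_dec u v); [apply G; auto|]. rewrite Cmod_sub_comm. apply G; lra. }
  assert (L : limI k l).
  { intros eps He.
    assert (Q : locally (T := C_UniformSpace) l (fun w => (Cmod (w - l) < eps)%R)).
    { apply locally_C_Cmod. exists eps; split; auto. }
    destruct (Hl _ Q) as [Y0 K]. exists (Rmax 0 (Y0 + 1)). split; [apply Rmax_l|].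
    intros Y HY. apply K. generalize (Rmax_r 0 (Y0 + 1)). lra. }
  exists l; split; auto.
  apply le_epsilon. intros eps He. destruct (L eps He) as (Y & HY & K).
  specialize (K Y ltac:(lra)).
  assert (K' := tail_bound k B d 0 Y Hc Hd ltac:(lra) Hk).
  replace (- d * 0)%R with 0%R in K' by ring. rewrite exp_0, Rmult_1_r in K'.
  apply Rle_trans with (1 := Cmod_triangle_sub l (CI k 0 Y)). rewrite Cmod_sub_comm. lra.
Qed.

(** A total choice, so that the integral becomes a function of the parameter on all of C; its value
    is controlled where the limit exists. *)
Definition improper (k : R -> C) : C := epsilon (inhabits (RtoC 0)) (limI k).

Lemma improper_unique (k : R -> C) (l : C) : limI k l -> improper k = l.
Proof.
  intros H. apply (limI_unique k); auto. unfold improper. apply epsilon_spec. now exists l.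
Qed.

Lemma bounded_on_segment (k : R -> C) (a b : R) : (a <= b)%R ->
  (forall t, (a <= t <= b)%R -> ccont k t) ->
  exists B, (0 <= B)%R /\ forall t, (a <= t <= b)%R -> (Cmod (k t) <= B)%R.
Proof.
  intros Hab Hc.
  destruct (continuity_ab_maj (fun t => Cmod (k t)) a b Hab) as (x & Hx & _).
  - intros t Ht. apply continuity_pt_filterlim.
    intros P [eps HP].
    refine (filter_imp _ _ _ (proj1 (continuous_C_eps k t) (Hc t Ht) eps (cond_pos eps))).
    intros s Hs. apply HP. change (Rabs (Cmod (k s) - Cmod (k t)) < eps)%R.
    apply Rle_lt_trans with (2 := Hs).
    assert (H1 := Cmod_triangle_sub (k s) (k t)). assert (H2 := Cmod_triangle_sub (k t) (k s)).
    rewrite Cmod_sub_comm in H2. apply Rabs_le. lra.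
  - exists (Cmod (k x)). split; [apply Cmod_ge_0|]. auto.
Qed.

(** * Integrals depending on a complex parameter *)

Lemma exp_param_quadratic (u h m f : C) :
  (Cmod (Cexp ((u + h) * m) * f - Cexp (u * m) * f - h * (m * Cexp (u * m) * f)) <=
   Cmod h * Cmod h * (Cmod m * Cmod m * exp (Cmod h * Cmod m) * Cmod (Cexp (u * m) * f)))%R.
Proof.
  replace (Cexp ((u + h) * m) * f - Cexp (u * m) * f - h * (m * Cexp (u * m) * f))
    with ((Cexp (h * m) - 1 - h * m) * (Cexp (u * m) * f)).
  - rewrite (Cmod_mult (Cexp (h * m) - 1 - h * m)).
    replace (Cmod h * Cmod h * (Cmod m * Cmod m * exp (Cmod h * Cmod m) * Cmod (Cexp (u * m) * f)))%R
      with ((Cmod h * Cmod m) ^ 2 * exp (Cmod h * Cmod m) * Cmod (Cexp (u * m) * f))%R by ring.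
    apply Rmult_le_compat_r; auto using Cmod_ge_0.
    rewrite <- Cmod_mult. apply Cexp_bound_2.
  - replace ((u + h) * m) with (u * m + h * m) by ring. rewrite Cexp_plus. ring.
Qed.

Lemma littleo_of_quadratic (r : C -> C) (d B : R) : (0 < d)%R ->
  (forall h, (Cmod h < d)%R -> (Cmod (r h) <= Cmod h * Cmod h * B)%R) -> littleo r.
Proof.
  intros Hd H eps He. set (B' := Rmax B 1).
  assert (HB : (0 < B')%R) by (apply Rlt_le_trans with (2 := Rmax_r _ _); lra).
  exists (Rmin d (eps / B')). split.
  { apply Rmin_pos; auto. apply Rdiv_lt_0_compat; auto. }
  intros h Hh. assert (H1 := Rlt_le_trans _ _ _ Hh (Rmin_l _ _)).
  assert (H2 := Rlt_le_trans _ _ _ Hh (Rmin_r _ _)).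
  apply Rle_trans with (1 := H h H1). assert (H0 := Cmod_ge_0 h).
  apply Rle_trans with (Cmod h * Cmod h * B')%R.
  - apply Rmult_le_compat_l; [nra|apply Rmax_l].
  - rewrite (Rmult_comm eps), Rmult_assoc. apply Rmult_le_compat_l; auto.
    apply Rle_div_r; auto. lra.
Qed.

Lemma continuous_exp_param (m f : R -> C) (u : C) (t : R) :
  ccont m t -> ccont f t -> ccont (fun t => Cexp (u * m t) * f t) t.
Proof.
  intros Hm Hf. apply continuous_Cmult; auto.
  apply (continuous_C_comp _ Cexp (fun t => u * m t)); [apply continuous_Cexp|].
  apply continuous_Cmult; auto. apply continuous_Cconst.
Qed.

(** The remainder of the integrand is O(|h|^2) uniformly on the segment, and this bound survives
    integration. *)
Lemma wd_CI_exp_param (m f : R -> C) (a b : R) (u : C) : (a <= b)%R ->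
  (forall t, (a <= t <= b)%R -> ccont m t) -> (forall t, (a <= t <= b)%R -> ccont f t) ->
  wd (fun u => CI (fun t => Cexp (u * m t) * f t) a b) u
    (CI (fun t => m t * Cexp (u * m t) * f t) a b) 0.
Proof.
  intros Hab Hm Hf.
  destruct (bounded_on_segment m a b Hab Hm) as (M & HM0 & HM).
  destruct (bounded_on_segment (fun t => Cexp (u * m t) * f t) a b Hab) as (B & HB0 & HB).
  { intros; apply continuous_exp_param; auto. }
  apply littleo_of_quadratic with (d := 1%R) (B := (M * M * exp M * B * (b - a))%R); [lra|].
  intros h Hh.
  assert (I1 : forall v, isI (fun t => Cexp (v * m t) * f t) a b (CI (fun t => Cexp (v * m t) * f t) a b)).
  { intros v. apply CI_correct; auto. intros; apply continuous_exp_param; auto. }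
  assert (I2 : isI (fun t => m t * Cexp (u * m t) * f t) a b (CI (fun t => m t * Cexp (u * m t) * f t) a b)).
  { apply CI_correct; auto. intros t Ht.
    apply (continuous_ext (T := R_UniformSpace) (U := C_UniformSpace) (fun t => m t * (Cexp (u * m t) * f t))).
    - intros; apply Cmult_assoc.
    - apply continuous_Cmult; auto. apply continuous_exp_param; auto. }
  assert (K := isI_minus _ _ _ _ _ _ (isI_minus _ _ _ _ _ _ (I1 (u + h)) (I1 u)) (isI_scal h _ _ _ _ I2)).
  assert (Q : forall t, (a <= t <= b)%R ->
    (Cmod (Cexp ((u + h) * m t) * f t - Cexp (u * m t) * f t - h * (m t * Cexp (u * m t) * f t))
     <= Cmod h * Cmod h * (M * M * exp M * B))%R).
  { intros t Ht. apply Rle_trans with (1 := exp_param_quadratic _ _ _ _).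
    assert (H0 := Cmod_ge_0 h). assert (H1 := Cmod_ge_0 (m t)). assert (H2 := HM t Ht).
    apply Rmult_le_compat_l; [nra|].
    assert (H3 := exp_pos (Cmod h * Cmod (m t))).
    apply Rmult_le_compat; auto using Cmod_ge_0.
    - apply Rmult_le_pos; [nra|lra].
    - apply Rmult_le_compat; try nra. apply exp_le. nra. }
  assert (K' := isI_bound_const _ _ a b _ Hab Q K).
  eapply Rle_trans; [|eapply Rle_trans; [exact K'|right; ring]].
  right. f_equal. ring.
Qed.

Lemma wd_improper_exp_param (m f : R -> C) (c M B : R) (u : C) :
  cont_ray m -> cont_ray f -> (c < Re u)%R -> (0 <= M)%R ->
  (forall t, (0 <= t)%R -> (Cmod (m t) <= M + t)%R) ->
  (forall v, (c < Re v)%R -> exists B, forall t, (0 <= t)%R ->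
     (Cmod (Cexp (v * m t) * f t) <= B * exp (- (Re v - c) * t))%R) ->
  exists d, wd (fun u => improper (fun t => Cexp (u * m t) * f t)) u d 0.
Proof.
  intros Hm Hf Hu HM0 HM Hb.
  assert (Hlim : forall v, (c < Re v)%R ->
     limI (fun t => Cexp (v * m t) * f t) (improper (fun t => Cexp (v * m t) * f t))).
  { intros v Hv. destruct (Hb v Hv) as (Bv & HBv).
    destruct (limI_exists (fun t => Cexp (v * m t) * f t) Bv (Re v - c)) as (l & Hl & _); auto; try lra.
    - intros t Ht. apply continuous_exp_param; auto.
    - rewrite (improper_unique _ l); auto. }
  (* The integrand decays at rate 8e. Each factor |m(t)| costs e and so does exp (|h| |m(t)|), which
     leaves 7e for the derivative and 5e for the quadratic remainder. *)
  set (e := ((Re u - c) / 8)%R). assert (He : (0 < e)%R) by (unfold e; lra).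
  destruct (Hb u Hu) as (Bu & HBu).
  assert (HBu0 : (0 <= Bu)%R).
  { assert (K := Rle_trans _ _ _ (Cmod_ge_0 _) (HBu 0%R ltac:(lra))).
    rewrite Rmult_0_r, exp_0 in K. lra. }
  (* Chosen so that M + t <= M1 (1 + e t) <= M1 exp (e t). *)
  set (M1 := (M + 1 + 1 / e)%R).
  assert (HM1 : (1 <= M1)%R).
  { unfold M1. assert (0 < 1 / e)%R by (apply Rdiv_lt_0_compat; lra). lra. }
  assert (Hm1 : forall t, (0 <= t)%R -> (Cmod (m t) <= M1 * exp (e * t))%R).
  { intros t Ht. apply Rle_trans with (1 := HM t Ht).
    assert (E : (1 + e * t <= exp (e * t))%R) by apply exp_ineq1_le.
    apply Rle_trans with (M1 * (1 + e * t))%R; [|apply Rmult_le_compat_l; lra].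
    unfold M1. replace ((M + 1 + 1 / e) * (1 + e * t))%R with
      (M + 1 + 1 / e + e * t * (M + 1) + t)%R by (field; lra).
    assert (0 < 1 / e)%R by (apply Rdiv_lt_0_compat; lra).
    assert (0 <= e * t * (M + 1))%R by (repeat apply Rmult_le_pos; lra). lra. }
  assert (C1 : forall t, (0 <= t)%R -> ccont (fun t => m t * Cexp (u * m t) * f t) t).
  { intros t Ht.
    apply (continuous_ext (T := R_UniformSpace) (U := C_UniformSpace) (fun t => m t * (Cexp (u * m t) * f t))).
    - intros; apply Cmult_assoc.
    - apply continuous_Cmult; auto. apply continuous_exp_param; auto. }
  destruct (limI_exists (fun t => m t * Cexp (u * m t) * f t) (M1 * Bu) (7 * e)) as (d & Hd & _); auto; try lra.
  { intros t Ht. rewrite <- Cmult_assoc, Cmod_mult.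
    apply Rle_trans with ((M1 * exp (e * t)) * (Bu * exp (- (Re u - c) * t)))%R.
    - apply Rmult_le_compat; auto using Cmod_ge_0.
    - right. replace (- (7 * e) * t)%R with (e * t + - (Re u - c) * t)%R by (unfold e; field).
      rewrite exp_plus. ring. }
  exists d.
  apply littleo_of_quadratic with (d := e) (B := (M1 * M1 * exp (e * M) * Bu / (5 * e))%R); auto.
  intros h Hh.
  assert (Huh : (c < Re (u + h))%R).
  { assert (K := re_le_Cmod h). apply Rabs_le_between in K.
    replace (Re (u + h)) with (Re u + Re h)%R by (destruct u, h; reflexivity).
    unfold e in *. lra. }
  assert (Cu : forall v, cont_ray (fun t => Cexp (v * m t) * f t)).
  { intros v t Ht. apply continuous_exp_param; auto. }
  assert (Cs : forall (a : C) k, cont_ray k -> cont_ray (fun t => a * k t)).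
  { intros a k Hk t Ht. apply continuous_Cmult; auto. apply continuous_Cconst. }
  assert (Cp : forall k k', cont_ray k -> cont_ray k' -> cont_ray (fun t => k t + k' t)).
  { intros k k' Hk Hk' t Ht. apply continuous_Cplus; auto. }
  assert (L := limI_plus _ _ _ _ (Cp _ _ (Cu (u + h)) (Cs (Copp 1) _ (Cu u))) (Cs (- h) _ C1)
    (limI_plus _ _ _ _ (Cu (u + h)) (Cs (Copp 1) _ (Cu u)) (Hlim _ Huh)
      (limI_scal (Copp 1) _ _ (Cu u) (Hlim _ Hu))) (limI_scal (- h) _ _ C1 Hd)).
  destruct (limI_exists (fun t => Cexp ((u + h) * m t) * f t + Copp 1 * (Cexp (u * m t) * f t)
      + - h * (m t * Cexp (u * m t) * f t))
      (Cmod h * Cmod h * (M1 * M1 * exp (e * M) * Bu)) (5 * e)) as (l & Hl & Bl).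
  { exact (Cp _ _ (Cp _ _ (Cu (u + h)) (Cs (Copp 1) _ (Cu u))) (Cs (- h) _ C1)). }
  { lra. }
  { intros t Ht.
    replace (Cexp ((u + h) * m t) * f t + Copp 1 * (Cexp (u * m t) * f t)
      + - h * (m t * Cexp (u * m t) * f t)) with
      (Cexp ((u + h) * m t) * f t - Cexp (u * m t) * f t - h * (m t * Cexp (u * m t) * f t)) by ring.
    apply Rle_trans with (1 := exp_param_quadratic _ _ _ _).
    rewrite !Rmult_assoc. do 2 (apply Rmult_le_compat_l; auto using Cmod_ge_0).
    apply Rle_trans with ((M1 * exp (e * t)) * ((M1 * exp (e * t)) * (exp (e * M + e * t) *
      (Bu * exp (- (Re u - c) * t)))))%R.
    - assert (0 <= exp (Cmod h * Cmod (m t)))%R by (left; apply exp_pos).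
      repeat apply Rmult_le_compat; repeat apply Rmult_le_pos; auto using Cmod_ge_0.
      apply exp_le. assert (K := HM t Ht).
      apply Rle_trans with (e * (M + t))%R; [|right; ring].
      apply Rmult_le_compat; auto using Cmod_ge_0. lra.
    - right. replace (- (5 * e) * t)%R with (e * t + e * t + e * t + - (Re u - c) * t)%R by (unfold e; field).
      rewrite !exp_plus. ring. }
  assert (El := limI_unique _ _ _ L Hl).
  replace (improper (fun t => Cexp ((u + h) * m t) * f t) - improper (fun t => Cexp (u * m t) * f t)
    - d * h - 0 * Cconj h) with l by (rewrite <- El; ring).
  apply Rle_trans with (1 := Bl). right. unfold Rdiv. ring.
Qed.

(** * Holomorphic functions and exponential growth on vertical strips *)

Definition hol (f df : C -> C) : Prop := forall z, upper z -> wd f z (df z) 0.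

Definition cont_upper (f : C -> C) : Prop := forall z, upper z -> continuous f z.

Lemma hol_cont (f df : C -> C) : hol f df -> cont_upper f.
Proof. intros H z Hz. exact (wd_continuous _ _ _ _ (H z Hz)). Qed.

Definition strip (z0 : C) (s t : R) : C := z0 + RtoC s + Ci * RtoC t.

Lemma strip_upper (z0 : C) (s t : R) : (- Im z0 < t)%R -> upper (strip z0 s t).
Proof. unfold strip, upper. destruct z0; simpl. intros; lra. Qed.

Lemma vertical_ray_strip (z0 : C) (t : R) : vertical_ray z0 t = strip z0 0 t.
Proof. unfold strip, vertical_ray. ring. Qed.

Lemma pd_strip_t (z0 : C) (s t : R) : pd (fun t => strip z0 s t) t Ci.
Proof.
  apply pd_eq with (1 := pd_affine (z0 + RtoC s) Ci t); auto. intros; unfold strip; ring.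
Qed.

Lemma pd_strip_s (z0 : C) (s t : R) : pd (fun s => strip z0 s t) s 1.
Proof.
  apply pd_eq with (1 := pd_affine (z0 + Ci * RtoC t) 1 s); auto. intros; unfold strip; ring.
Qed.

Lemma cont_strip_t (h : C -> C) (z0 : C) (s t : R) : cont_upper h -> upper (strip z0 s t) ->
  ccont (fun t : R => h (strip z0 s t)) t.
Proof.
  intros Hh Hu. apply (continuous_C_comp _ h); [now apply Hh|].
  exact (pd_continuous _ _ _ (pd_strip_t z0 s t)).
Qed.

Lemma cont_strip_s (h : C -> C) (z0 : C) (s t : R) : cont_upper h -> upper (strip z0 s t) ->
  ccont (fun s : R => h (strip z0 s t)) s.
Proof.
  intros Hh Hu. apply (continuous_C_comp _ h); [now apply Hh|].
  exact (pd_continuous _ _ _ (pd_strip_s z0 s t)).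
Qed.

(** Cauchy's theorem for a rectangle, by differentiation in its height: the integral over the upper
    edge has derivative i times the difference of h at the right and left corners, because d/dt h =
    i d/ds h. *)
Lemma cauchy_rectangle (h dh : C -> C) (z0 : C) (Y : R) :
  hol h dh -> cont_upper dh -> upper z0 -> (0 <= Y)%R ->
  CI (fun s => h (strip z0 s Y)) 0 1 - CI (fun s => h (strip z0 s 0)) 0 1 =
  Ci * (CI (fun t => h (strip z0 1 t)) 0 Y - CI (fun t => h (strip z0 0 t)) 0 Y).
Proof.
  intros Hh Hdh Hz HY.
  assert (Hch := hol_cont _ _ Hh).
  set (G := fun Y => CI (fun s => h (strip z0 s Y)) 0 1).
  assert (HG : forall t, (0 <= t)%R -> pd G t (Ci * h (strip z0 1 t) - Ci * h (strip z0 0 t))).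
  { intros t Ht.
    assert (E : CI (fun s => Ci * dh (strip z0 s t)) 0 1 = Ci * h (strip z0 1 t) - Ci * h (strip z0 0 t)).
    { apply isI_unique. apply (isI_derive (fun s => Ci * h (strip z0 s t))).
      - intros s _. apply pd_scal.
        apply pd_eq with (1 := wd_path h _ s _ _ _ (Hh _ (strip_upper z0 s t ltac:(unfold upper in Hz; lra)))
          (pd_strip_s z0 s t)); auto. ring.
      - intros s _. apply continuous_Cmult; [apply continuous_Cconst|].
        apply cont_strip_s; [exact Hdh|apply strip_upper; unfold upper in Hz; lra]. }
    rewrite <- E.
    apply (CI_param_derive (fun t s => h (strip z0 s t)) (fun t s => Ci * dh (strip z0 s t)) 0 1 t (Im z0));
      auto; try lra.
    - intros t' s Ht' _. apply Rabs_def2 in Ht'.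
      apply pd_eq with (1 := wd_path h _ t' _ _ _ (Hh _ (strip_upper z0 s t' ltac:(lra)))
          (pd_strip_t z0 s t')); auto. ring.
    - intros s _. apply continuous_Cmult; [apply continuous_Cconst|].
      apply continuous_C_comp; [apply Hdh, strip_upper; unfold upper in Hz; simpl; lra|].
      unfold strip. apply continuous_Cplus; [apply continuous_Cplus|apply continuous_Cmult];
        try apply continuous_Cconst; apply continuous_RtoC.
      + apply continuous_snd.
      + apply continuous_fst.
    - intros t' s Ht' _. apply Rabs_def2 in Ht'.
      apply cont_strip_s; [exact Hch|apply strip_upper; lra]. }
  assert (Hv : forall s t, (0 <= t)%R -> ccont (fun t => h (strip z0 s t)) t).
  { intros s t Ht. apply cont_strip_t; [exact Hch|apply strip_upper; unfold upper in Hz; lra]. }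
  assert (K : isI (fun t => Ci * h (strip z0 1 t) - Ci * h (strip z0 0 t)) 0 Y (G Y - G 0%R)).
  { apply isI_derive; rewrite Rmin_left, Rmax_right by auto; intros t Ht.
    - apply HG. lra.
    - apply continuous_Cminus; (apply continuous_Cmult; [apply continuous_Cconst|apply Hv; lra]). }
  fold (G Y) (G 0%R). rewrite <- (isI_unique _ _ _ _ K).
  apply isI_unique.
  apply isI_eq with (4 := isI_minus _ _ _ _ _ _
    (isI_scal Ci _ _ _ _ (CI_correct _ 0 Y HY (fun t Ht => Hv 1%R t (proj1 Ht))))
    (isI_scal Ci _ _ _ _ (CI_correct _ 0 Y HY (fun t Ht => Hv 0%R t (proj1 Ht))))); auto.
  set (a := CI (fun t : R => h (strip z0 1 t)) 0 Y). set (b := CI (fun t : R => h (strip z0 0 t)) 0 Y).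
  change (Ci * a - Ci * b = Ci * (a - b)). ring.
Qed.

Definition sgrowth (z0 : C) (c : R) (f : C -> C) : Prop :=
  exists B A, (0 <= B)%R /\ (0 <= A)%R /\
  forall s t, (0 <= s <= 1)%R -> (A <= t)%R -> (Cmod (f (strip z0 s t)) <= B * exp (c * t))%R.

Lemma sgrowth_mult (z0 : C) (c c' : R) (f g : C -> C) :
  sgrowth z0 c f -> sgrowth z0 c' g -> sgrowth z0 (c + c') (fun z => f z * g z).
Proof.
  intros (B & A & HB & HA & H) (B' & A' & HB' & HA' & H').
  exists (B * B')%R, (Rmax A A'). repeat split.
  - apply Rmult_le_pos; auto.
  - apply Rle_trans with (1 := HA), Rmax_l.
  - intros s t Hs Ht. rewrite Cmod_mult.
    replace (B * B' * exp ((c + c') * t))%R with ((B * exp (c * t)) * (B' * exp (c' * t)))%R.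
    + apply Rmult_le_compat; auto using Cmod_ge_0.
      * apply H; auto. apply Rle_trans with (2 := Ht), Rmax_l.
      * apply H'; auto. apply Rle_trans with (2 := Ht), Rmax_r.
    + rewrite Rmult_plus_distr_r, exp_plus. ring.
Qed.

Lemma sgrowth_plus (z0 : C) (c : R) (f g : C -> C) :
  sgrowth z0 c f -> sgrowth z0 c g -> sgrowth z0 c (fun z => f z + g z).
Proof.
  intros (B & A & HB & HA & H) (B' & A' & HB' & HA' & H').
  exists (B + B')%R, (Rmax A A'). repeat split.
  - lra.
  - apply Rle_trans with (1 := HA), Rmax_l.
  - intros s t Hs Ht. apply Rle_trans with (1 := Cmod_triangle _ _).
    rewrite Rmult_plus_distr_r. apply Rplus_le_compat.
    + apply H; auto. apply Rle_trans with (2 := Ht), Rmax_l.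
    + apply H'; auto. apply Rle_trans with (2 := Ht), Rmax_r.
Qed.

Lemma sgrowth_const (z0 a : C) (c : R) : (0 <= c)%R -> sgrowth z0 c (fun _ => a).
Proof.
  intros Hc. exists (Cmod a), 0%R. repeat split; try lra; try apply Cmod_ge_0.
  intros s t _ Ht. rewrite <- (Rmult_1_r (Cmod a)) at 1.
  apply Rmult_le_compat_l; [apply Cmod_ge_0|].
  assert (K := exp_ineq1_le (c * t)). nra.
Qed.

Lemma sgrowth_id (z0 : C) (c : R) : (0 < c)%R -> sgrowth z0 c (fun z => z).
Proof.
  intros Hc. exists (Cmod z0 + 1 + / c)%R, 0%R.
  assert (H0 := Cmod_ge_0 z0). assert (Hc' := Rinv_0_lt_compat c Hc).
  repeat split; try lra. intros s t Hs Ht. unfold strip.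
  apply Rle_trans with (Cmod z0 + s + t)%R.
  - apply Rle_trans with (1 := Cmod_triangle _ _).
    apply Rplus_le_compat.
    + apply Rle_trans with (1 := Cmod_triangle _ _). rewrite Cmod_R, Rabs_pos_eq; lra.
    + rewrite Cmod_mult, Cmod_Ci, Cmod_R, Rabs_pos_eq; lra.
  - assert (K := exp_ineq1_le (c * t)).
    apply Rle_trans with ((Cmod z0 + 1 + / c) * (1 + c * t))%R.
    + replace ((Cmod z0 + 1 + / c) * (1 + c * t))%R with
        (Cmod z0 + 1 + / c + c * t * (Cmod z0 + 1) + t)%R by (field; lra).
      assert (0 <= c * t * (Cmod z0 + 1))%R by (repeat apply Rmult_le_pos; lra). lra.
    + apply Rmult_le_compat_l; lra.
Qed.

(** A polynomial costs an arbitrarily small rate: the rate is halved at each coefficient, one half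
    paying for the factor z. *)
Lemma sgrowth_peval (z0 : C) (c : R) (l : list R) : (0 < c)%R -> sgrowth z0 c (peval l).
Proof.
  revert c. induction l as [|a l IH]; intros c Hc.
  - exact (sgrowth_const z0 0 c ltac:(lra)).
  - apply (sgrowth_plus z0 c (fun _ => RtoC a) (fun z => z * peval l z)).
    + apply sgrowth_const. lra.
    + replace c with (c / 2 + c / 2)%R by field. apply sgrowth_mult.
      * apply sgrowth_id. lra.
      * apply IH. lra.
Qed.

Lemma exp_sgrowth (z0 : C) (c : R) (f : C -> C) (u : C) : sgrowth z0 c f ->
  exists B A, (0 <= B)%R /\ (0 <= A)%R /\ forall s t, (0 <= s <= 1)%R -> (A <= t)%R ->
  (Cmod (Cexp (u * (Ci * strip z0 s t)) * f (strip z0 s t)) <= B * exp (- (Re u - c) * t))%R.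
Proof.
  intros (B & A & HB & HA & H).
  set (E := (Rabs (Re u) * Rabs (Im z0) + Rabs (Im u) * (Rabs (Re z0) + 1))%R).
  exists (exp E * B)%R, A. repeat split; auto.
  { apply Rmult_le_pos; auto. left; apply exp_pos. }
  intros s t Hs Ht. rewrite Cmod_mult, Cmod_Cexp.
  replace (exp E * B * exp (- (Re u - c) * t))%R with
    (exp (E - Re u * t) * (B * exp (c * t)))%R.
  - apply Rmult_le_compat; auto using Cmod_ge_0.
    + left; apply exp_pos.
    + apply exp_le. unfold E, strip.
      replace (Re (u * (Ci * (z0 + RtoC s + Ci * RtoC t)))) with
        (- (Re u * Im z0) - Re u * t - Im u * (Re z0 + s))%R
        by (destruct u, z0; unfold Re, Im; simpl; ring).
      assert (K1 : (- (Re u * Im z0) <= Rabs (Re u) * Rabs (Im z0))%R).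
      { rewrite <- Rabs_mult, <- Rabs_Ropp. apply Rle_abs. }
      assert (K2 : (- (Im u * (Re z0 + s)) <= Rabs (Im u) * (Rabs (Re z0) + 1))%R).
      { apply Rle_trans with (Rabs (Im u) * Rabs (Re z0 + s))%R.
        - rewrite <- Rabs_mult, <- (Rabs_Ropp (_ * _)). apply Rle_abs.
        - apply Rmult_le_compat_l; [apply Rabs_pos|].
          apply Rle_trans with (1 := Rabs_triang _ _). rewrite (Rabs_pos_eq s); lra. }
      lra.
  - replace (E - Re u * t)%R with (E + - Re u * t)%R by ring.
    replace (- (Re u - c) * t)%R with (- Re u * t + c * t)%R by ring.
    rewrite !exp_plus. ring.
Qed.

Lemma exp_sgrowth_ray (z0 : C) (c : R) (f : C -> C) (u : C) : upper z0 -> cont_upper f ->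
  sgrowth z0 c f ->
  exists B, forall t, (0 <= t)%R ->
  (Cmod (Cexp (u * (Ci * strip z0 0 t)) * f (strip z0 0 t)) <= B * exp (- (Re u - c) * t))%R.
Proof.
  intros Hz Hf H. destruct (exp_sgrowth z0 c f u H) as (B & A & HB & HA & K).
  (* After compensating the exponential, the missing range [0, A] is a matter of boundedness of a
     continuous function. *)
  set (k := fun t : R => RtoC (exp ((Re u - c) * t)) *
    (Cexp (u * (Ci * strip z0 0 t)) * f (strip z0 0 t))).
  destruct (bounded_on_segment k 0 A HA) as (B' & HB' & K').
  { intros t Ht. unfold k. apply continuous_Cmult; [|apply (continuous_exp_param (fun t => Ci * strip z0 0 t)
      (fun t => f (strip z0 0 t)))].
    - apply continuous_RtoC.
      apply (ex_derive_continuous (fun t => exp ((Re u - c) * t))). auto_derive. auto.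
    - apply continuous_Cmult; [apply continuous_Cconst|].
      exact (pd_continuous _ _ _ (pd_strip_t z0 0 t)).
    - apply cont_strip_t; [exact Hf|apply strip_upper; unfold upper in Hz; lra]. }
  exists (Rmax B B'). intros t Ht. assert (Hx := exp_pos (- (Re u - c) * t)).
  destruct (Rle_dec A t) as [HAt|HAt].
  - apply Rle_trans with (1 := K 0%R t ltac:(lra) HAt). apply Rmult_le_compat_r; [lra|apply Rmax_l].
  - specialize (K' t ltac:(lra)). unfold k in K'. rewrite Cmod_mult, Cmod_R in K'.
    assert (Hx' := exp_pos ((Re u - c) * t)). rewrite Rabs_pos_eq in K' by lra.
    apply Rle_trans with (B' * exp (- (Re u - c) * t))%R.
    + replace (- (Re u - c) * t)%R with (- ((Re u - c) * t))%R by ring. rewrite exp_Ropp.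
      apply Rle_div_r; auto. rewrite Rmult_comm. exact K'.
    + apply Rmult_le_compat_r; [lra|apply Rmax_r].
Qed.

(** * Connected domains *)

Definition connected (U : C -> Prop) : Prop :=
  forall V W : C -> Prop, open V -> open W ->
    (forall u, U u -> V u \/ W u) ->
    (exists u, U u /\ V u) -> (exists u, U u /\ W u) ->
    exists u, U u /\ V u /\ W u.

Lemma connected_union (U U' : C -> Prop) (p : C) :
  connected U -> connected U' -> U p -> U' p -> connected (fun u => U u \/ U' u).
Proof.
  intros HU HU' Hp Hp' V W HV HW Hcov (v & Hv & Vv) (w & Hw & Ww).
  assert (G : forall S : C -> Prop, connected S -> S p -> (forall u, S u -> U u \/ U' u) ->
    (exists q, S q /\ V q) -> (exists q, S q /\ W q) -> exists u, (U u \/ U' u) /\ V u /\ W u).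
  { intros S HS _ Hsub HSv HSw. destruct (HS V W HV HW) as (u & Hu & H); auto.
    exists u; auto. }
  destruct (Hcov p (or_introl Hp)) as [Vp|Wp].
  - destruct Hw as [Hw|Hw]; [apply (G U)|apply (G U')]; auto; eauto.
  - destruct Hv as [Hv|Hv]; [apply (G U)|apply (G U')]; auto; eauto.
Qed.

(** A segment from a point of V to a point of W reduces the claim to the interval [0, 1]; the
    supremum of the times up to which the segment stays in V then leads to a common point. *)
Lemma connected_convex (U : C -> Prop) : convex U -> connected U.
Proof.
  intros HU V W HV HW Hcov (v & Hv & Vv) (w & Hw & Ww).
  set (g := fun t : R => v + RtoC t * (w - v)).
  assert (Hg : forall t, (0 <= t <= 1)%R -> U (g t)) by (intros; apply HU; auto).
  assert (Hop : forall S : C -> Prop, open S -> forall t, S (g t) ->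
    exists d, (0 < d)%R /\ forall s, (Rabs (s - t) < d)%R -> S (g s)).
  { intros S HS t Ht.
    assert (K : locally t (fun s => S (g s))).
    { exact (pd_continuous _ _ _ (pd_affine v (w - v) t) _ (HS _ Ht)). }
    destruct K as [d K]. exists d; split; [apply cond_pos|]. intros s Hs. apply K, Hs. }
  destruct (classic (exists t, (0 <= t <= 1)%R /\ V (g t) /\ W (g t))) as [(t & Ht & H)|Hn].
  { exists (g t); auto. }
  set (S := fun t => (0 <= t <= 1)%R /\ forall s, (0 <= s <= t)%R -> V (g s)).
  assert (S0 : S 0%R).
  { split; [lra|]. intros s Hs. replace s with 0%R by lra. unfold g.
    now replace (v + 0 * (w - v)) with v by ring. }
  destruct (completeness S) as [m [Hm1 Hm2]].
  { exists 1%R. intros t [Ht _]. lra. }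
  { now exists 0%R. }
  assert (Hm : (0 <= m <= 1)%R).
  { split; [apply Hm1; auto|]. apply Hm2. intros t [Ht _]. lra. }
  assert (Below : forall s, (0 <= s < m)%R -> V (g s)).
  { intros s Hs. destruct (classic (V (g s))) as [|Hns]; auto. exfalso.
    assert (m <= s)%R; [|lra]. apply Hm2. intros t [Ht Ht'].
    destruct (Rle_dec t s); auto. exfalso. apply Hns, Ht'. lra. }
  destruct (Hcov _ (Hg m Hm)) as [HVm|HWm].
  - destruct (Hop V HV m HVm) as (d & Hd & K).
    destruct (Req_dec m 1) as [->|Hne].
    + exfalso. apply Hn. exists 1%R. repeat split; try lra; auto. unfold g.
      now replace (v + 1 * (w - v)) with w by ring.
    + exfalso. set (t := Rmin 1 (m + d / 2)).
      assert (Ht1 := Rmin_l 1 (m + d / 2)). assert (Ht2 := Rmin_r 1 (m + d / 2)). fold t in Ht1, Ht2.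
      assert (Ht3 : (m < t)%R) by (unfold t; apply Rmin_glb_lt; lra).
      assert (St : S t).
      { split; [lra|]. intros s Hs. destruct (Rlt_dec s m); [apply Below; lra|].
        apply K. rewrite Rabs_pos_eq; lra. }
      specialize (Hm1 t St). lra.
  - destruct (Hop W HW m HWm) as (d & Hd & K).
    destruct (Req_dec m 0) as [->|Hne].
    + exfalso. apply Hn. exists 0%R. repeat split; try lra; auto.
      apply (proj2 S0). lra.
    + exfalso. apply Hn. set (t := Rmax 0 (m - d / 2)).
      assert (Ht1 := Rmax_l 0 (m - d / 2)). assert (Ht2 := Rmax_r 0 (m - d / 2)). fold t in Ht1, Ht2.
      assert (Ht3 : (t < m)%R) by (unfold t; apply Rmax_lub_lt; lra).
      exists t. repeat split; try lra; [apply Below; lra|].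
      apply K. rewrite Rabs_left1; lra.
Qed.

Lemma convex_comb_lt (a b c t : R) :
  (a < c)%R -> (b < c)%R -> (0 <= t <= 1)%R -> ((1 - t) * a + t * b < c)%R.
Proof. intros Ha Hb Ht. destruct (Req_dec t 0) as [->|Hn]; nra. Qed.

(** The zeros of 1 - e^(iu) are the multiples of 2 pi. This set contains only the zero u = 0 and
    still joins a neighbourhood of 0 to every right half-plane, through the upper half-plane. *)
Definition cont_domain (u : C) : Prop := (Rabs (Re u) < 1)%R \/ (0 < Im u)%R.

Lemma open_Re_Im (P : R -> R -> Prop) :
  (forall x y, P x y -> exists d, (0 < d)%R /\
     forall x' y', (Rabs (x' - x) < d)%R -> (Rabs (y' - y) < d)%R -> P x' y') ->
  open (T := C_UniformSpace) (fun u => P (Re u) (Im u)).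
Proof.
  intros H u Hu. destruct (H _ _ Hu) as (d & Hd & K).
  exists (mkposreal d Hd). intros w [A B]. apply K; assumption.
Qed.

(** A union of three convex sets, a strip and two half-planes, joined at the points i and A + 1 +
    i. *)
Lemma connected_reg_domain (A : R) : connected_open (fun u => cont_domain u \/ (A < Re u)%R).
Proof.
  split.
  - apply (open_Re_Im (fun x y => ((Rabs x < 1)%R \/ (0 < y)%R) \/ (A < x)%R)).
    intros x y [[H|H]|H].
    + exists (1 - Rabs x)%R. split; [lra|]. intros x' y' Hx' _. left; left.
      assert (K := Rabs_triang (x' - x) x). replace (x' - x + x)%R with x' in K by ring. lra.
    + exists y. split; auto. intros x' y' _ Hy'. apply Rabs_def2 in Hy'. left; right; lra.
    + exists (x - A)%R. split; [lra|]. intros x' y' Hx' _. apply Rabs_def2 in Hx'. right; lra.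
  - apply (connected_union cont_domain (fun u => (A < Re u)%R) (A + 1, 1)%R).
    + apply (connected_union (fun u => (Rabs (Re u) < 1)%R) (fun u => (0 < Im u)%R) (0, 1)%R).
      * apply connected_convex. intros [x y] [x' y'] H H' t Ht. simpl in *.
        apply Rabs_def2 in H. apply Rabs_def2 in H'.
        apply Rabs_def1; [assert (K := convex_comb_lt x x' 1 t ltac:(lra) ltac:(lra) Ht); lra|].
        assert (K := convex_comb_lt (- x) (- x') 1 t ltac:(lra) ltac:(lra) Ht). lra.
      * apply connected_convex. exact convex_upper.
      * simpl. rewrite Rabs_R0. lra.
      * simpl. lra.
    + apply connected_convex. intros [x y] [x' y'] H H' t Ht. simpl in *.
      assert (K := convex_comb_lt (- x) (- x') (- A) t ltac:(lra) ltac:(lra) Ht). lra.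
    + right. simpl. lra.
    + simpl. lra.
Qed.

Lemma cont_domain_open (u : C) : cont_domain u ->
  exists d, (0 < d)%R /\ forall h, (Cmod h < d)%R -> cont_domain (u + h).
Proof.
  intros H. assert (Hop : locally (T := C_UniformSpace) u cont_domain).
  { apply (open_Re_Im (fun x y => (Rabs x < 1)%R \/ (0 < y)%R)); auto.
    intros x y [H'|H'].
    + exists (1 - Rabs x)%R. split; [lra|]. intros x' y' Hx' _. left.
      assert (K := Rabs_triang (x' - x) x). replace (x' - x + x)%R with x' in K by ring. lra.
    + exists y. split; auto. intros x' y' _ Hy'. apply Rabs_def2 in Hy'. right; lra. }
  apply locally_C_Cmod in Hop. destruct Hop as (d & Hd & K). exists d; split; auto.
  intros h Hh. apply K. now replace (u + h - u) with h by ring.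
Qed.

(** * Analytic continuation of the regularised integrals *)

(** The entire function (e^(iu) - 1)/(iu), that is, 1 - e^(iu) freed from its zero at u = 0. The
    factor 1 fits the shape [Cexp (u * m t) * f t] of the parameter lemmas. *)
Definition unit_exp_integral (u : C) : C := CI (fun t => Cexp (u * (Ci * RtoC t)) * 1) 0 1.

Lemma ccont_Ci_RtoC (t : R) : ccont (fun t : R => Ci * RtoC t) t.
Proof. apply continuous_Cmult; [apply continuous_Cconst|apply continuous_RtoC, continuous_id]. Qed.

Lemma wd_unit_exp_integral (u : C) : exists d, wd unit_exp_integral u d 0.
Proof.
  eexists. exact (wd_CI_exp_param (fun t => Ci * RtoC t) (fun _ => 1) 0 1 u Rle_0_1
    (fun t _ => ccont_Ci_RtoC t) (fun t _ => continuous_Cconst _ _ t)).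
Qed.

Lemma isI_unit_exp_integral (u : C) :
  isI (fun t => Cexp (u * (Ci * RtoC t)) * 1) 0 1 (unit_exp_integral u).
Proof.
  apply CI_correct; [lra|]. intros t _.
  apply (continuous_exp_param (fun t => Ci * RtoC t) (fun _ => 1)).
  - apply ccont_Ci_RtoC.
  - apply continuous_Cconst.
Qed.

Lemma unit_exp_integral_eq (u : C) : 1 - Cexp (u * Ci) = - (u * Ci * unit_exp_integral u).
Proof.
  assert (K := isI_scal (u * Ci) _ _ _ _ (isI_unit_exp_integral u)).
  assert (L : isI (fun t => u * Ci * (Cexp (u * (Ci * RtoC t)) * 1)) 0 1
     (Cexp (RtoC 1 * (u * Ci)) - Cexp (RtoC 0 * (u * Ci)))).
  { apply (isI_derive (fun t => Cexp (RtoC t * (u * Ci)))); intros t _.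
    - apply pd_eq with (1 := pd_Cexp_line (u * Ci) t); auto.
      replace (u * (Ci * RtoC t)) with (RtoC t * (u * Ci)) by ring. ring.
    - apply continuous_Cmult; [apply continuous_Cconst|].
      apply (continuous_exp_param (fun t => Ci * RtoC t) (fun _ => 1)).
      + apply ccont_Ci_RtoC.
      + apply continuous_Cconst. }
  assert (E : u * Ci * unit_exp_integral u = Cexp (RtoC 1 * (u * Ci)) - Cexp (RtoC 0 * (u * Ci)))
    by (rewrite <- (isI_unique _ _ _ _ K); exact (isI_unique _ _ _ _ L)).
  rewrite E, Cmult_1_l, Cmult_0_l, Cexp_0. ring.
Qed.

(** If |Re u| < 1, the integrand has real part at least exp (-|Im u|) cos 1 > 0. If Im u > 0, then
    |e^(iu)| < 1, so 1 - e^(iu) is not zero. *)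
Lemma unit_exp_integral_neq_0 (u : C) : cont_domain u -> unit_exp_integral u <> 0.
Proof.
  intros [H|H] E.
  - assert (K := isI_Re _ _ _ _ (isI_unit_exp_integral u)). rewrite E in K.
    set (m := (exp (- Rabs (Im u)) * cos 1)%R).
    assert (Hcos : (0 < cos 1)%R) by (apply cos_gt_0; generalize PI2_1; lra).
    assert (Hm : (0 < m)%R) by (apply Rmult_lt_0_compat; auto; apply exp_pos).
    assert (B : (m <= 0)%R); [|lra].
    apply (is_RInt_le (fun _ => m) (fun t => Re (Cexp (u * (Ci * RtoC t)) * 1)) 0 1); try lra.
    + eapply eq_rect; [apply (is_RInt_const (V := R_NormedModule) 0 1 m)|].
      unfold scal; simpl; unfold mult; simpl. ring.
    + exact K.
    + intros t Ht. unfold Cexp, Re, Im, m. simpl.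
      destruct u as [a b]. simpl in *.
      replace (a * (0 * t - 1 * 0) - b * (0 * 0 + 1 * t))%R with (- (b * t))%R by ring.
      replace (a * (0 * 0 + 1 * t) + b * (0 * t - 1 * 0))%R with (a * t)%R by ring.
      replace (exp (- (b * t)) * cos (a * t) * 1 - exp (- (b * t)) * sin (a * t) * 0)%R with
        (exp (- (b * t)) * cos (a * t))%R by ring.
      assert (E1 : (exp (- Rabs b) <= exp (- (b * t)))%R).
      { apply exp_le. assert (b * t <= Rabs b)%R; [|lra].
        apply Rle_trans with (1 := Rle_abs _). rewrite Rabs_mult, (Rabs_pos_eq t) by lra.
        generalize (Rabs_pos b). nra. }
      assert (E2 : (cos 1 <= cos (a * t))%R).
      { assert (E3 : (Rabs (a * t) <= 1)%R).
        { rewrite Rabs_mult, (Rabs_pos_eq t) by lra. generalize (Rabs_pos a). nra. }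
        replace (cos (a * t)) with (cos (Rabs (a * t))).
        - apply cos_decr_1; auto using Rabs_pos; generalize PI2_1; lra.
        - unfold Rabs. destruct Rcase_abs; auto. apply cos_neg. }
      apply Rmult_le_compat; try lra. left; apply exp_pos.
  - assert (K := unit_exp_integral_eq u). rewrite E in K.
    assert (K' : Cexp (u * Ci) = 1).
    { replace (Cexp (u * Ci)) with (1 - (1 - Cexp (u * Ci))) by ring. rewrite K. ring. }
    apply (f_equal Cmod) in K'. rewrite Cmod_Cexp, Cmod_1 in K'.
    replace (Re (u * Ci)) with (- Im u)%R in K' by (destruct u; simpl; ring).
    assert (exp (- Im u) < 1)%R; [|lra]. rewrite <- exp_0. apply exp_increasing. lra.
Qed.

Section Regularisation.

Variables (z0 : C) (N : nat) (phi : nat -> C -> C) (c : R).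
Hypothesis Hz : upper z0.
Hypothesis Hphi : forall i, (i < N)%nat -> hol (phi i) (phi (S i)).
Hypothesis Hcont : forall i, (i <= N)%nat -> cont_upper (phi i).
Hypothesis Hper : forall z, upper z -> phi O (z + 1) = phi O z.
Hypothesis Hgr : forall i, (i <= N)%nat -> sgrowth z0 c (phi i).
Hypothesis HN : (1 <= N)%nat.

Let prodf (i : nat) (l : list R) (w : C) : C := phi i w * peval l w.
(** The ray integrals are controlled for Re u > c + 1/2, the half paying for the polynomial factor;
    this abscissa lies safely inside. *)
Let A0 : R := (c + 1)%R.

Definition ray_integrand (i : nat) (l : list R) (u : C) (t : R) : C :=
  Cexp (u * (Ci * strip z0 0 t)) * (Ci * (phi i (strip z0 0 t) * peval l (strip z0 0 t))).

Definition reg_F (i : nat) (l : list R) (u : C) : C := improper (ray_integrand i l u).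

Lemma peval_cont : forall l, cont_upper (peval l).
Proof. intros l z _. exact (wd_continuous _ _ _ _ (wd_peval l z)). Qed.

Lemma prodf_cont (i : nat) (l : list R) : (i <= N)%nat -> cont_upper (prodf i l).
Proof.
  intros Hi z Hz'. apply (continuous_Cmult _ (phi i) (peval l)); [apply Hcont|apply peval_cont]; auto.
Qed.

Lemma prodf_growth (i : nat) (l : list R) : (i <= N)%nat -> sgrowth z0 (c + / 2) (prodf i l).
Proof. intros Hi. apply sgrowth_mult; auto. apply sgrowth_peval. lra. Qed.

Lemma strip_ray_cont (t : R) : ccont (fun t => strip z0 0 t) t.
Proof. exact (pd_continuous _ _ _ (pd_strip_t z0 0 t)). Qed.

Lemma upper_ray (t : R) : (0 <= t)%R -> upper (strip z0 0 t).
Proof. intros. apply strip_upper. unfold upper in Hz. lra. Qed.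

Lemma prodf_ray_cont (i : nat) (l : list R) : (i <= N)%nat ->
  cont_ray (fun t => Ci * prodf i l (strip z0 0 t)).
Proof.
  intros Hi t Ht. apply continuous_Cmult; [apply continuous_Cconst|].
  apply (cont_strip_t (prodf i l)); [apply prodf_cont; auto|apply upper_ray; auto].
Qed.

Lemma mray_cont : cont_ray (fun t => Ci * strip z0 0 t).
Proof. intros t _. apply continuous_Cmult; [apply continuous_Cconst|apply strip_ray_cont]. Qed.

Lemma ray_integrand_cont (i : nat) (l : list R) (u : C) : (i <= N)%nat ->
  cont_ray (ray_integrand i l u).
Proof.
  intros Hi t Ht.
  apply (continuous_exp_param (fun t => Ci * strip z0 0 t) (fun t => Ci * prodf i l (strip z0 0 t))).
  - apply mray_cont; auto.
  - apply prodf_ray_cont; auto.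
Qed.

Lemma ray_integrand_bound (i : nat) (l : list R) (u : C) : (i <= N)%nat ->
  exists B, forall t, (0 <= t)%R ->
    (Cmod (ray_integrand i l u t) <= B * exp (- (Re u - (c + / 2)) * t))%R.
Proof.
  intros Hi.
  destruct (exp_sgrowth_ray z0 (c + / 2) (prodf i l) u Hz (prodf_cont i l Hi) (prodf_growth i l Hi))
    as (B & HB).
  exists B. intros t Ht. apply Rle_trans with (2 := HB t Ht). right.
  unfold ray_integrand, prodf. rewrite !Cmod_mult, Cmod_Ci. ring.
Qed.

Lemma reg_F_lim (i : nat) (l : list R) (u : C) : (i <= N)%nat -> (c + / 2 < Re u)%R ->
  limI (ray_integrand i l u) (reg_F i l u).
Proof.
  intros Hi Hu. destruct (ray_integrand_bound i l u Hi) as (B & HB).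
  destruct (limI_exists _ B (Re u - (c + / 2)) (ray_integrand_cont i l u Hi)) as (v & Hv & _); auto.
  { lra. }
  unfold reg_F. now rewrite (improper_unique _ v).
Qed.

Lemma reg_F_hol (i : nat) (l : list R) (u : C) : (i <= N)%nat -> (c + / 2 < Re u)%R ->
  exists d, wd (reg_F i l) u d 0.
Proof.
  intros Hi Hu.
  apply (wd_improper_exp_param (fun t => Ci * strip z0 0 t) (fun t => Ci * prodf i l (strip z0 0 t))
    (c + / 2) (Cmod z0) 0 u); auto using Cmod_ge_0.
  - apply mray_cont.
  - apply prodf_ray_cont; auto.
  - intros t Ht. rewrite Cmod_mult, Cmod_Ci, Rmult_1_l. unfold strip.
    apply Rle_trans with (1 := Cmod_triangle _ _).
    rewrite Cmod_mult, Cmod_Ci, Cmod_R, Rabs_pos_eq, Cplus_0_r by auto. lra.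
  - intros v _. apply (ray_integrand_bound i l v Hi).
Qed.

Lemma reg_F_nil (i : nat) (u : C) : (i <= N)%nat -> reg_F i nil u = 0.
Proof.
  intros Hi. apply improper_unique. intros eps He. exists 0%R; split; [lra|]. intros Y HY.
  rewrite (CI_ext _ (fun _ => 0)); auto.
  - rewrite (isI_unique _ _ _ _ (isI_const 0 0 Y)).
    replace (RtoC (Y - 0) * 0 - 0) with (RtoC 0) by ring. now rewrite Cmod_0.
  - intros t Ht. unfold ray_integrand. simpl. ring.
Qed.

Lemma wd_exp_prod (i : nat) (l : list R) (u w : C) : (i < N)%nat -> upper w ->
  wd (fun w => Cexp (u * (Ci * w)) * prodf i l w) w
    (u * Ci * (Cexp (u * (Ci * w)) * prodf i l w)
     + Cexp (u * (Ci * w)) * (prodf (S i) l w + prodf i (pderiv l) w)) 0.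
Proof.
  intros Hi Hw.
  apply wd_eq with (1 := wd_mult _ _ _ _ _ _ _
    (wd_comp Cexp (fun w => u * (Ci * w)) w _ _ _ _ (wd_Cexp (u * (Ci * w))) (wd_scal u _ _ _ _ (wd_scal Ci _ _ _ _ (wd_id w))))
    (wd_mult _ _ _ _ _ _ _ (Hphi i Hi w Hw) (wd_peval l w))); auto.
  - unfold prodf. ring.
  - replace (Cconj (u * (Ci * 1))) with (Cconj u * Cconj Ci) by (rewrite !Cconj_mult, Cconj_RtoC; ring).
    ring.
Qed.

Lemma exp_prod_small (i : nat) (l : list R) (u : C) (eps : R) : (i <= N)%nat ->
  (c + / 2 < Re u)%R -> (0 < eps)%R -> exists Y0, (0 <= Y0)%R /\
  forall s Y, (0 <= s <= 1)%R -> (Y0 <= Y)%R ->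
    (Cmod (Cexp (u * (Ci * strip z0 s Y)) * prodf i l (strip z0 s Y)) < eps)%R.
Proof.
  intros Hi Hu He.
  destruct (exp_sgrowth z0 _ _ u (prodf_growth i l Hi)) as (B & A & HB & HA & K).
  destruct (exp_small B (Re u - (c + / 2)) eps HB ltac:(lra) He) as (Y0 & HY0 & K').
  exists (Rmax A Y0). split; [apply Rle_trans with (1 := HA), Rmax_l|].
  intros s Y Hs HY.
  apply Rle_lt_trans with (1 := K s Y Hs (Rle_trans _ _ _ (Rmax_l _ _) HY)).
  apply K', (Rle_trans _ _ _ (Rmax_r _ _) HY).
Qed.

Definition boundary (i : nat) (l : list R) (u : C) : C :=
  Cexp (u * (Ci * z0)) * (phi i z0 * peval l z0).

(** The differential of e^(iuw) phi_i P is integrated along the ray; its value at height Y tends to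
    0 since Re u exceeds the growth rate of phi_i P. *)
Lemma reg_F_parts (i : nat) (l : list R) (u : C) : (i < N)%nat -> (c + / 2 < Re u)%R ->
  reg_F (S i) l u = - boundary i l u - u * Ci * reg_F i l u - reg_F i (pderiv l) u.
Proof.
  intros Hi Hu.
  set (h := fun w => Cexp (u * (Ci * w)) * prodf i l w).
  assert (L : limI (fun t => u * Ci * ray_integrand i l u t +
     (ray_integrand (S i) l u t + ray_integrand i (pderiv l) u t)) (- boundary i l u)).
  { intros eps He. destruct (exp_prod_small i l u eps ltac:(lia) Hu He) as (Y0 & HY0 & K).
    exists Y0; split; auto. intros Y HY.
    assert (E : CI (fun t => u * Ci * ray_integrand i l u t +
     (ray_integrand (S i) l u t + ray_integrand i (pderiv l) u t)) 0 Y =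
      h (strip z0 0 Y) - h (strip z0 0 0)).
    { apply isI_unique. apply (isI_derive (fun t => h (strip z0 0 t)));
      rewrite Rmin_left, Rmax_right by lra; intros t Ht.
      - assert (Hut : upper (strip z0 0 t)) by (apply upper_ray; lra).
        apply pd_eq with (1 := wd_path h _ t _ _ _ (wd_exp_prod i l u _ Hi Hut) (pd_strip_t z0 0 t)); auto.
        unfold ray_integrand, prodf. ring.
      - apply continuous_Cplus; [apply continuous_Cmult; [apply continuous_Cconst|]|apply continuous_Cplus];
        apply ray_integrand_cont; lia || lra. }
    rewrite E.
    replace (h (strip z0 0 0)) with (boundary i l u).
    - replace (h (strip z0 0 Y) - boundary i l u - - boundary i l u) with (h (strip z0 0 Y)) by ring.
      apply K; lra.
    - unfold h, boundary, prodf. replace (strip z0 0 0) with z0 by (unfold strip; ring). reflexivity. }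
  assert (C1 := ray_integrand_cont i l u ltac:(lia)).
  assert (C2 := ray_integrand_cont (S i) l u ltac:(lia)).
  assert (C3 := ray_integrand_cont i (pderiv l) u ltac:(lia)).
  assert (L1 := reg_F_lim i l u ltac:(lia) Hu).
  assert (L2 := reg_F_lim (S i) l u ltac:(lia) Hu).
  assert (L3 := reg_F_lim i (pderiv l) u ltac:(lia) Hu).
  assert (C4 : cont_ray (fun t => u * Ci * ray_integrand i l u t)).
  { intros t Ht. apply continuous_Cmult; [apply continuous_Cconst|auto]. }
  assert (C5 : cont_ray (fun t => ray_integrand (S i) l u t + ray_integrand i (pderiv l) u t)).
  { intros t Ht. apply continuous_Cplus; auto. }
  assert (L' := limI_plus _ _ _ _ C4 C5 (limI_scal (u * Ci) _ _ C1 L1) (limI_plus _ _ _ _ C2 C3 L2 L3)).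
  rewrite (limI_unique _ _ _ L L'). ring.
Qed.

Definition base_integral (l : list R) (u : C) : C :=
  CI (fun s => Cexp (u * (Ci * strip z0 s 0)) * (phi O (strip z0 s 0) * peval l (strip z0 s 0))) 0 1.

Lemma strip_base_cont (s : R) : ccont (fun s => strip z0 s 0) s.
Proof. exact (pd_continuous _ _ _ (pd_strip_s z0 s 0)). Qed.

Lemma wd_base_integral (l : list R) (u : C) : exists d, wd (base_integral l) u d 0.
Proof.
  eexists. apply (wd_CI_exp_param (fun s => Ci * strip z0 s 0)
    (fun s => phi O (strip z0 s 0) * peval l (strip z0 s 0))); [lra| |]; intros s _.
  - apply continuous_Cmult; [apply continuous_Cconst|apply strip_base_cont].
  - apply (cont_strip_s (prodf O l)); [apply prodf_cont; lia|].
    apply strip_upper. unfold upper in Hz. lra.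
Qed.

(** In the rectangle over [z0, z0 + 1] the upper edge disappears in the limit; on the right edge
    periodicity of phi_0 leaves a factor e^(iu) and the polynomial P + Delta P. *)
Lemma reg_F_shift (l : list R) (u : C) : (c + / 2 < Re u)%R ->
  (1 - Cexp (u * Ci)) * reg_F O l u =
  base_integral l u + Cexp (u * Ci) * reg_F O (pdelta l) u.
Proof.
  intros Hu.
  set (h := fun w => Cexp (u * (Ci * w)) * prodf O l w).
  set (dh := fun w => u * Ci * (Cexp (u * (Ci * w)) * prodf O l w)
     + Cexp (u * (Ci * w)) * (prodf 1 l w + prodf O (pderiv l) w)).
  assert (Hh : hol h dh) by (intros w Hw; apply wd_exp_prod; auto).
  assert (Hch := hol_cont _ _ Hh).
  assert (Hexp : cont_upper (fun w => Cexp (u * (Ci * w)))).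
  { intros w _.
    exact (wd_continuous _ _ _ _ (wd_comp Cexp (fun w => u * (Ci * w)) w _ _ _ _ (wd_Cexp (u * (Ci * w)))
      (wd_scal u _ _ _ _ (wd_scal Ci _ _ _ _ (wd_id w))))). }
  assert (Hdh : cont_upper dh).
  { intros w Hw. apply continuous_Cplus.
    - apply continuous_Cmult; [apply continuous_Cconst|].
      apply continuous_Cmult; [apply (Hexp w Hw)|apply prodf_cont; auto; lia].
    - apply continuous_Cmult; [apply (Hexp w Hw)|].
      apply (continuous_Cplus _ (prodf 1 l) (prodf O (pderiv l))); apply prodf_cont; auto; lia. }
  assert (L : limI (fun t => (Cexp (u * Ci) - 1) * ray_integrand O l u t +
     Cexp (u * Ci) * ray_integrand O (pdelta l) u t) (- base_integral l u)).
  { intros eps He. destruct (exp_prod_small O l u (eps / 2) ltac:(lia) Hu ltac:(lra)) as (Y0 & HY0 & K).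
    exists Y0; split; auto. intros Y HY.
    assert (HR := cauchy_rectangle h dh z0 Y Hh Hdh Hz ltac:(lra)).
    assert (HYz : (- Im z0 < Y)%R) by (unfold upper in Hz; lra).
    assert (Hz' : (0 < Im z0)%R) by exact Hz.
    assert (Hv : forall s t, (0 <= t <= Y)%R -> ccont (fun t : R => h (strip z0 s t)) t).
    { intros s t Ht. exact (cont_strip_t h z0 s t Hch (strip_upper z0 s t ltac:(lra))). }
    assert (HY' : (0 <= Y)%R) by lra.
    assert (E : CI (fun t => (Cexp (u * Ci) - 1) * ray_integrand O l u t +
       Cexp (u * Ci) * ray_integrand O (pdelta l) u t) 0 Y =
      Ci * (CI (fun t => h (strip z0 1 t)) 0 Y - CI (fun t => h (strip z0 0 t)) 0 Y)).
    { apply isI_unique.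
      apply isI_eq with (4 := isI_scal Ci _ _ _ _ (isI_minus _ _ _ _ _ _
        (CI_correct _ 0 Y HY' (Hv 1%R)) (CI_correct _ 0 Y HY' (Hv 0%R)))); auto.
      intros t Ht. unfold h, prodf, ray_integrand.
      replace (strip z0 1 t) with (strip z0 0 t + 1) by (unfold strip; ring).
      rewrite Hper by (apply upper_ray; lra). rewrite peval_pdelta.
      replace (u * (Ci * (strip z0 0 t + 1))) with (u * Ci + u * (Ci * strip z0 0 t)) by ring.
      rewrite Cexp_plus. ring. }
    rewrite E. rewrite <- HR.
    replace (CI (fun s => h (strip z0 s 0)) 0 1) with (base_integral l u) by reflexivity.
    replace (CI (fun s => h (strip z0 s Y)) 0 1 - base_integral l u - - base_integral l u) with
      (CI (fun s => h (strip z0 s Y)) 0 1) by ring.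
    apply Rle_lt_trans with (eps / 2 * (1 - 0))%R; [|lra].
    apply (isI_bound_const (fun s => h (strip z0 s Y))); [lra| |].
    - intros s Hs. left. apply K; auto.
    - apply CI_correct; [lra|]. intros s Hs.
      exact (cont_strip_s h z0 s Y Hch (strip_upper z0 s Y HYz)). }
  assert (C1 := ray_integrand_cont O l u ltac:(lia)).
  assert (C2 := ray_integrand_cont O (pdelta l) u ltac:(lia)).
  assert (L1 := reg_F_lim O l u ltac:(lia) Hu).
  assert (L2 := reg_F_lim O (pdelta l) u ltac:(lia) Hu).
  assert (Cs : forall a k, cont_ray k -> cont_ray (fun t => a * k t)).
  { intros a k Hk t Ht. apply continuous_Cmult; [apply continuous_Cconst|auto]. }
  assert (L' := limI_plus _ _ _ _ (Cs _ _ C1) (Cs _ _ C2) (limI_scal (Cexp (u * Ci) - 1) _ _ C1 L1)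
    (limI_scal (Cexp (u * Ci)) _ _ C2 L2)).
  assert (E := limI_unique _ _ _ L L').
  replace (base_integral l u) with (- - base_integral l u) by ring. rewrite E. ring.
Qed.

(** [d] bounds the order of the pole of [reg_F i l] at u = 0, and [v] is the value there of the
    continuation of u^d times it. *)
Definition continues (d i : nat) (l : list R) (v : C) : Prop :=
  exists h, (forall u, cont_domain u -> exists a, wd h u a 0) /\
    (forall u, cont_domain u -> (A0 < Re u)%R -> h u = u ^ d * reg_F i l u) /\ h 0 = v.

Lemma continues_nil (d i : nat) : (i <= N)%nat -> continues d i nil 0.
Proof.
  intros Hi. exists (fun _ => 0). repeat split.
  - intros u _. exists 0. apply wd_const.
  - intros u _ _. rewrite reg_F_nil by auto. ring.
Qed.

Lemma wd_pow_id (u : C) (d : nat) : exists a, wd (fun u => u ^ d) u a 0.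
Proof. eexists. exact (wd_pow _ _ _ d (wd_id u)). Qed.

Lemma hol_mult (f g : C -> C) (u : C) :
  (exists a, wd f u a 0) -> (exists a, wd g u a 0) -> exists a, wd (fun u => f u * g u) u a 0.
Proof.
  intros [a Ha] [b Hb]. eexists.
  apply wd_eq with (1 := wd_mult _ _ _ _ _ _ _ Ha Hb); auto. ring.
Qed.

Lemma hol_plus (f g : C -> C) (u : C) :
  (exists a, wd f u a 0) -> (exists a, wd g u a 0) -> exists a, wd (fun u => f u + g u) u a 0.
Proof.
  intros [a Ha] [b Hb]. eexists.
  apply wd_eq with (1 := wd_plus _ _ _ _ _ _ _ Ha Hb); auto. ring.
Qed.

Lemma hol_const (a u : C) : exists b, wd (fun _ => a) u b 0.
Proof. eexists. apply wd_const. Qed.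

Lemma hol_exp (a u : C) : exists b, wd (fun u => Cexp (u * a)) u b 0.
Proof.
  eexists. apply wd_eq with (1 := wd_comp Cexp (fun u => u * a) u _ _ _ _ (wd_Cexp (u * a))
    (wd_mult _ _ _ _ _ _ _ (wd_id u) (wd_const a u))); auto.
  replace (Cconj (1 * a + u * 0)) with (Cconj a) by (f_equal; ring). ring.
Qed.

(** The shift equation is solved for [reg_F]. Dividing by 1 - e^(iu) = -iu [unit_exp_integral u]
    costs one power of u, and the difference polynomial is shorter, so the pole order is at most the
    length. *)
Lemma continues_base (d : nat) (l : list R) : (length l <= d)%nat -> exists v, continues d O l v.
Proof.
  revert l. induction d as [|d IH]; intros l Hl.
  - destruct l; [|simpl in Hl; lia]. exists 0. apply continues_nil. lia.
  - destruct (IH (pdelta l)) as (v & h & H1 & H2 & H3).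
    { assert (K := length_pdelta l). lia. }
    eexists. exists (fun u => (Ci * / unit_exp_integral u) *
      (u ^ d * base_integral l u + Cexp (u * Ci) * h u)).
    repeat split.
    + intros u Hu. apply hol_mult; [apply hol_mult; [apply hol_const|]|
        apply hol_plus; apply hol_mult; auto using wd_pow_id, wd_base_integral, hol_exp].
      destruct (wd_unit_exp_integral u) as [a Ha]. eexists.
      apply wd_inv; [apply unit_exp_integral_neq_0; auto|exact Ha].
    + intros u Hu HA. rewrite (H2 u Hu HA).
      assert (K := reg_F_shift l u ltac:(unfold A0 in HA; lra)).
      rewrite unit_exp_integral_eq in K.
      assert (Hn := unit_exp_integral_neq_0 u Hu).
      replace (u ^ d * base_integral l u + Cexp (u * Ci) * (u ^ d * reg_F O (pdelta l) u)) with
        (u ^ d * (base_integral l u + Cexp (u * Ci) * reg_F O (pdelta l) u)) by ring.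
      rewrite <- K. rewrite Cpow_S.
      replace (Ci * / unit_exp_integral u * (u ^ d * (- (u * Ci * unit_exp_integral u) * reg_F O l u)))
        with (- (Ci * Ci) * (u * u ^ d * reg_F O l u) * (unit_exp_integral u * / unit_exp_integral u)) by ring.
      rewrite Ci_sqr, Cinv_r by auto. ring.
Qed.

(** The factor u in front of [reg_F i l] either absorbs one order of its pole (e = 0) or, if u^d
    already suffices, remains and kills the contribution of v1 at u = 0 (e = 1). The boundary term
    survives at 0 only for d = 0. *)
Lemma continues_step (d i : nat) (l : list R) (v1 v2 : C) (e : nat) : (i < N)%nat -> (e <= 1)%nat ->
  continues (d + 1 - e) i l v1 -> continues d i (pderiv l) v2 ->
  continues d (S i) l (- (RtoC 0 ^ d * (phi i z0 * peval l z0)) - Ci * (RtoC 0 ^ e * v1) - v2).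
Proof.
  intros Hi He (h1 & A1 & A2 & A3) (h2 & B1 & B2 & B3).
  exists (fun u => Copp 1 * (u ^ d * boundary i l u) + (- Ci * (u ^ e * h1 u) + Copp 1 * h2 u)).
  repeat split.
  - intros u Hu. apply hol_plus; [|apply hol_plus]; apply hol_mult; auto using hol_const.
    + apply hol_mult; auto using wd_pow_id. apply hol_mult; [apply hol_exp|apply hol_const].
    + apply hol_mult; auto using wd_pow_id.
  - intros u Hu HA. rewrite A2, B2, reg_F_parts by (auto; unfold A0 in HA; lra).
    assert (E : u ^ e * u ^ (d + 1 - e) = u * u ^ d).
    { rewrite <- Cpow_add_r, <- Cpow_S. f_equal. lia. }
    transitivity (Copp 1 * (u ^ d * boundary i l u) + (- Ci * ((u ^ e * u ^ (d + 1 - e)) * reg_F i l u)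
      + Copp 1 * (u ^ d * reg_F i (pderiv l) u))); [ring|]. rewrite E. ring.
  - rewrite A3, B3. unfold boundary. rewrite Cmult_0_l, Cexp_0. ring.
Qed.

Lemma continues_derivative (i : nat) : (i <= N)%nat -> forall d l, (length l <= d)%nat ->
  exists v, continues (d - i) i l v.
Proof.
  induction i as [|i IH]; intros Hi d l Hl.
  - rewrite Nat.sub_0_r. now apply continues_base.
  - destruct (IH ltac:(lia) d l Hl) as [v1 H1].
    destruct (IH ltac:(lia) (pred d) (pderiv l)) as [v2 H2].
    { rewrite length_pderiv. lia. }
    replace (pred d - i)%nat with (d - S i)%nat in H2 by lia.
    (* With truncated subtraction this e is 0 for d > i, while a pole is being lowered, and 1 for d
       <= i, when none is left. *)
    eexists. apply (continues_step _ i l v1 v2 (d - S i + 1 - (d - i))); auto; try lia.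
    replace (d - S i + 1 - (d - S i + 1 - (d - i)))%nat with (d - i)%nat by lia. exact H1.
Qed.

Lemma bracket_S (j : nat) (l : list R) (z : C) :
  bracket (S j) phi (ptower l) z =
  phi (S j) z * peval l z - bracket j phi (ptower (pderiv l)) z.
Proof.
  unfold bracket. rewrite csum_shift. rewrite Nat.sub_0_r.
  rewrite (csum_ext (fun i => sgn (S i) * phi (S j - S i)%nat z * ptower l (S i) z)
    (fun i => Copp 1 * (sgn i * phi (j - i)%nat z * ptower (pderiv l) i z)) (S j)).
  - rewrite csum_scal. unfold sgn at 1, ptower at 1. simpl Nat.iter. simpl Cpow. ring.
  - intros i Hi. rewrite ptower_pderiv, sgn_S. replace (S j - S i)%nat with (j - i)%nat by lia. ring.
Qed.

(** After S j steps the integral of phi_(j+1) P has no pole left, so one further partial integration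
    has no contribution from u times it at u = 0. What remains is the recursion [bracket_S]. *)
Lemma continues_value (j : nat) : forall l, (j < N)%nat -> (length l <= j)%nat ->
  continues O (S j) l (- bracket j phi (ptower l) z0).
Proof.
  induction j as [|j IH]; intros l Hj Hl.
  - destruct l; [|simpl in Hl; lia].
    replace (- bracket 0 phi (ptower nil) z0) with (RtoC 0).
    + apply continues_nil. lia.
    + unfold bracket. simpl csum. unfold ptower; simpl. ring.
  - destruct (continues_derivative (S j) ltac:(lia) (S j) l Hl) as [v1 H1].
    rewrite Nat.sub_diag in H1.
    assert (H2 := IH (pderiv l) ltac:(lia) ltac:(rewrite length_pderiv; lia)).
    assert (K := continues_step O (S j) l v1 _ 1 Hj (le_n 1) H1 H2).
    destruct K as (h & K1 & K2 & K3). exists h. repeat split; auto.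
    rewrite K3, bracket_S. simpl Cpow. ring.
Qed.

Lemma reg_integral_value (j : nat) (l : list R) (f : C -> C) : (j < N)%nat -> (length l <= j)%nat ->
  (forall z, upper z -> f z = phi (S j) z * peval l z) ->
  is_reg_integral_ioo f z0 (- bracket j phi (ptower l) z0).
Proof.
  intros Hj Hl Hf. destruct (continues_value j l Hj Hl) as (h & H1 & H2 & H3).
  (* The two branches agree on the overlap, so near every point [Phi] is one of two holomorphic
     functions. *)
  set (Phi := fun u => if excluded_middle_informative (cont_domain u) then h u else reg_F (S j) l u).
  assert (E1 : forall u, cont_domain u -> Phi u = h u).
  { intros u Hu. unfold Phi. destruct excluded_middle_informative; [auto|contradiction]. }
  assert (E2 : forall u, (A0 < Re u)%R -> Phi u = reg_F (S j) l u).
  { intros u Hu. unfold Phi. destruct excluded_middle_informative; [|auto].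
    rewrite H2 by auto. simpl. ring. }
  exists A0, (fun u => cont_domain u \/ (A0 < Re u)%R), Phi. repeat split.
  - apply connected_reg_domain.
  - apply connected_reg_domain.
  - auto.
  - left; left. simpl. rewrite Rabs_R0. lra.
  - intros u [Hu|Hu].
    + destruct (H1 u Hu) as [a Ha]. exists a. apply wd_is_derive.
      apply wd_ext_loc with (2 := Ha).
      destruct (cont_domain_open u Hu) as (d & Hd & K). exists d; split; auto.
      intros k Hk. symmetry. auto.
    + destruct (reg_F_hol (S j) l u Hj ltac:(unfold A0 in Hu; lra)) as [a Ha].
      exists a. apply wd_is_derive. apply wd_ext_loc with (2 := Ha).
      exists (Re u - A0)%R; split; [lra|]. intros k Hk. symmetry. apply E2.
      replace (Re (u + k)) with (Re u + Re k)%R by (destruct u, k; reflexivity).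
      assert (K := re_le_Cmod k). apply Rabs_le_between in K. lra.
  - intros u Hu. rewrite E2 by auto.
    refine (limI_is_RInt_gen (ray_integrand (S j) l u) _ _ (ray_integrand_cont (S j) l u Hj) _ _).
    + intros t Ht. unfold pullback.
      rewrite (pd_unique (vertical_ray z0) t Ci).
      2: { apply pd_eq with (1 := pd_strip_t z0 0 t); auto. intros s. symmetry. apply vertical_ray_strip. }
      rewrite vertical_ray_strip, Hf by (apply upper_ray; auto).
      unfold ray_integrand. rewrite <- (Cmult_assoc u Ci). ring.
    + apply reg_F_lim; [lia|]. unfold A0 in Hu. lra.
  - rewrite E1, H3; auto. left. simpl. rewrite Rabs_R0. lra.
Qed.

End Regularisation.

(** * Periodic holomorphic functions *)

Lemma upper_add_R (z : C) (s : R) : upper z -> upper (z + RtoC s).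
Proof. unfold upper. destruct z; simpl. lra. Qed.

Lemma pd_add_R (z : C) (s : R) : pd (fun s => z + RtoC s) s 1.
Proof. apply pd_eq with (1 := pd_affine z 1 s); auto. intros; ring. Qed.

Lemma cont_shift (g : C -> C) (z : C) (s : R) : cont_upper g -> upper z ->
  ccont (fun s : R => g (z + RtoC s)) s.
Proof.
  intros Hg Hz. apply (continuous_C_comp _ g); [apply Hg, upper_add_R; auto|].
  exact (pd_continuous _ _ _ (pd_add_R z s)).
Qed.

(** [G] is given separately because the mean of the derivative is known in closed form where this is
    applied (0 or f), which also supplies the continuity that the C^1 criterion demands. *)
Lemma wd_weighted_mean (f df G : C -> C) (w : R -> C) (z : C) :
  hol f df -> cont_upper df -> (forall s, ccont w s) -> cont_upper G ->
  (forall z, upper z -> CI (fun s => w s * df (z + RtoC s)) 0 1 = G z) -> upper z ->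
  wd (fun z => CI (fun s => w s * f (z + RtoC s)) 0 1) z (G z) 0.
Proof.
  intros Hf Hdf Hw HG E Hz. assert (Hcf := hol_cont _ _ Hf).
  set (F := fun z => CI (fun s => w s * f (z + RtoC s)) 0 1).
  assert (Hshift : forall (g : C -> C), cont_upper g -> forall z s, upper z ->
    ccont (fun s : R => w s * g (z + RtoC s)) s).
  { intros g Hg z' s Hz'. apply continuous_Cmult; auto. now apply cont_shift. }
  assert (Hx : forall z, upper z -> pd (fun t => F (t, Im z)) (Re z) (G z)).
  { intros [x y] Hxy. simpl. rewrite <- (E (x, y)) by auto.
    apply (CI_param_derive (fun t s => w s * f ((t, y) + RtoC s)) (fun t s => w s * df ((t, y) + RtoC s))
      0 1 x 1); try lra.
    - intros t s _ _. apply pd_scal.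
      assert (K := wd_partials f ((t, y) + RtoC s) _ _ (Hf _ (upper_add_R (t, y) s Hxy))).
      destruct K as [K _].
      apply pd_eq with (1 := pd_comp _ (fun t => t + s)%R t 1 _ K ltac:(auto_derive; auto)).
      + reflexivity.
      + ring.
    - intros s _. apply continuous_Cmult.
      + apply (continuous_comp (fun p : prod_UniformSpace R_UniformSpace R_UniformSpace => snd p)
          (w : R_UniformSpace -> C_UniformSpace)); [apply continuous_snd|apply Hw].
      + apply (continuous_C_comp _ df); [apply Hdf, (upper_add_R (x, y) s Hxy)|].
        apply continuous_C_intro; simpl.
        * apply (continuous_plus (V := R_NormedModule)); [apply continuous_fst|apply continuous_snd].
        * apply continuous_const.
    - intros t s _ _. apply (Hshift f Hcf (t, y) s Hxy). }
  assert (Hy : forall z, upper z -> pd (fun t => F (Re z, t)) (Im z) (Ci * G z)).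
  { intros [x y] Hxy. simpl.
    assert (E' : CI (fun s => w s * (Ci * df ((x, y) + RtoC s))) 0 1 = Ci * G (x, y)).
    { rewrite <- (E (x, y)) by auto. apply isI_unique.
      apply isI_eq with (4 := isI_scal Ci _ _ _ _ (CI_correct (fun s => w s * df ((x, y) + RtoC s)) 0 1
        ltac:(lra) (fun s _ => Hshift df Hdf (x, y) s Hxy))); auto; [lra|]. intros; ring. }
    rewrite <- E'.
    apply (CI_param_derive (fun t s => w s * f ((x, t) + RtoC s))
      (fun t s => w s * (Ci * df ((x, t) + RtoC s))) 0 1 y y); try lra; try exact Hxy.
    - intros t s Ht _. apply pd_scal. apply Rabs_def2 in Ht.
      assert (Hxt : upper (x, t)) by (unfold upper; simpl; lra).
      assert (K := wd_partials f ((x, t) + RtoC s) _ _ (Hf _ (upper_add_R (x, t) s Hxt))).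
      destruct K as [_ K].
      apply pd_eq with (1 := pd_comp _ (fun t => t + 0)%R t 1 _ K ltac:(auto_derive; auto)).
      + reflexivity.
      + ring.
    - intros s _. apply continuous_Cmult; [|apply continuous_Cmult; [apply continuous_Cconst|]].
      + apply (continuous_comp (fun p : prod_UniformSpace R_UniformSpace R_UniformSpace => snd p)
          (w : R_UniformSpace -> C_UniformSpace)); [apply continuous_snd|apply Hw].
      + apply (continuous_C_comp _ df); [apply Hdf, (upper_add_R (x, y) s Hxy)|].
        apply continuous_C_intro; simpl.
        * apply (continuous_plus (V := R_NormedModule)); [apply continuous_const|apply continuous_snd].
        * apply (continuous_plus (V := R_NormedModule)); [apply continuous_fst|apply continuous_const].
    - intros t s Ht _. apply Rabs_def2 in Ht. apply (Hshift f Hcf (x, t) s).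
      unfold upper; simpl; lra. }
  apply wd_eq with (1 := wd_of_partials upper F G (fun z => Ci * G z) z
    ltac:(destruct (upper_open z Hz) as (d & Hd & K); exists d; split; auto;
      intros w' Hw'; replace w' with (z + (w' - z)) by ring; auto)
    ltac:(intros w' Hw'; split; [apply Hx|apply Hy]; auto) (HG z Hz)
    ltac:(apply continuous_Cmult; [apply continuous_Cconst|apply HG; auto])); auto.
  - rewrite Ci_mult_Ci. field.
  - rewrite Ci_mult_Ci. field.
Qed.

Definition mean (f : C -> C) (z : C) : C := CI (fun s => f (z + RtoC s)) 0 1.

Lemma mean_correct (f : C -> C) (z : C) : cont_upper f -> upper z ->
  isI (fun s => f (z + RtoC s)) 0 1 (mean f z).
Proof.
  intros Hf Hz. apply CI_correct; [lra|]. intros s _. now apply cont_shift.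
Qed.

Definition periodic (f : C -> C) : Prop := forall z, upper z -> f (z + 1) = f z.

(** The derivative of the mean is the integral of f' over [z, z + 1], that is, f(z + 1) - f(z) =
    0. *)
Lemma mean_constant (f df : C -> C) (z w : C) : hol f df -> cont_upper df -> periodic f ->
  upper z -> upper w -> mean f z = mean f w.
Proof.
  intros Hf Hdf Hp Hz Hw.
  assert (D : forall z, upper z -> wd (fun z => CI (fun s => 1 * f (z + RtoC s)) 0 1) z 0 0).
  { intros z' Hz'. apply (wd_weighted_mean f df (fun _ => 0) (fun _ => 1)); auto.
    - intros s. apply continuous_Cconst.
    - intros s _. apply continuous_Cconst.
    - intros z'' Hz''. apply isI_unique.
      assert (K : isI (fun s => df (z'' + RtoC s)) 0 1 (f (z'' + 1) - f (z'' + 0))).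
      { apply (isI_derive (fun s => f (z'' + RtoC s))); intros s _.
        - apply pd_eq with (1 := wd_path f _ s _ _ _ (Hf _ (upper_add_R z'' s Hz'')) (pd_add_R z'' s)); auto.
          ring.
        - now apply cont_shift. }
      apply isI_eq with (4 := K); [lra| |].
      + intros; ring.
      + rewrite Hp by auto. replace (z'' + 0) with z'' by ring. ring. }
  assert (K := wd_zero_constant upper _ convex_upper D z w Hz Hw).
  assert (E : forall z, mean f z = CI (fun s => 1 * f (z + RtoC s)) 0 1).
  { intros z'. unfold mean. apply CI_ext; [lra|]. intros; ring. }
  rewrite !E. exact K.
Qed.

(** Mean zero says that the constant Fourier coefficient vanishes, the condition for a periodic
    primitive. *)
Definition nice (f : C -> C) : Prop :=
  (exists df, hol f df /\ cont_upper df) /\ periodic f /\ (forall z, upper z -> mean f z = 0).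

Definition egrowth (c : R) (f : C -> C) : Prop :=
  exists B A, (0 <= B)%R /\ forall z, upper z -> (A <= Im z)%R -> (Cmod (f z) <= B * exp (c * Im z))%R.

Lemma sub_mean_nice (f df : C -> C) (z0 : C) : hol f df -> cont_upper df -> periodic f -> upper z0 ->
  nice (fun z => f z - mean f z0).
Proof.
  intros Hf Hdf Hp Hz0. split; [|split].
  - exists df. split; auto. intros z Hz.
    apply wd_eq with (1 := wd_minus _ _ _ _ _ _ _ (Hf z Hz) (wd_const (mean f z0) z)); intros; auto; ring.
  - intros z Hz. now rewrite Hp.
  - intros z Hz. unfold mean at 1.
    rewrite (isI_unique _ _ _ _ (isI_minus _ _ _ _ _ _ (mean_correct f z (hol_cont _ _ Hf) Hz)
      (isI_const (mean f z0) 0 1))).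
    rewrite (mean_constant f df z z0) by auto. rewrite Rminus_0_r. ring.
Qed.

Lemma egrowth_sub_const (c : R) (f : C -> C) (a : C) : (0 <= c)%R -> egrowth c f ->
  egrowth c (fun z => f z - a).
Proof.
  intros Hc (B & A & HB & H). exists (B + Cmod a)%R, A. split.
  { generalize (Cmod_ge_0 a); lra. }
  intros z Hz HA. unfold Cminus. apply Rle_trans with (1 := Cmod_triangle _ _). rewrite Cmod_opp.
  rewrite Rmult_plus_distr_r. apply Rplus_le_compat; auto.
  assert (K := exp_ineq1_le (c * Im z)). unfold upper in Hz.
  assert (0 <= c * Im z)%R by (apply Rmult_le_pos; lra).
  generalize (Cmod_ge_0 a). intros. nra.
Qed.

Lemma ccont_half (s : R) : ccont (fun s : R => RtoC s - / 2) s.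
Proof.
  apply continuous_Cminus; [apply continuous_RtoC, continuous_id|apply continuous_Cconst].
Qed.

(* Integration by parts against the kernel s - 1/2 produces the primitive. *)
Lemma periodic_primitive (f : C -> C) (c : R) : (0 <= c)%R -> nice f -> egrowth c f ->
  exists F, hol F f /\ nice F /\ egrowth c F.
Proof.
  intros Hc ((df & Hf & Hdf) & Hp & Hm) Hg. assert (Hcf := hol_cont _ _ Hf).
  set (T := fun z => CI (fun s => (RtoC s - / 2) * f (z + RtoC s)) 0 1).
  assert (HT : hol T f).
  { intros z Hz.
    refine (wd_weighted_mean f df f (fun s => RtoC s - / 2) z Hf Hdf ccont_half Hcf _ Hz).
    intros z' Hz'. apply isI_unique.
    assert (K : isI (fun s => 1 * f (z' + RtoC s) + (RtoC s - / 2) * df (z' + RtoC s)) 0 1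
      ((RtoC 1 - / 2) * f (z' + 1) - (RtoC 0 - / 2) * f (z' + 0))).
    { apply (isI_derive (fun s => (RtoC s - / 2) * f (z' + RtoC s))); intros s _.
      - apply pd_eq with (1 := pd_mult _ _ _ _ _
          (pd_minus _ _ _ _ _ (pd_RtoC (fun s => s) s 1 ltac:(auto_derive; auto)) (pd_const (/ 2) s))
          (wd_path f _ s _ _ _ (Hf _ (upper_add_R z' s Hz')) (pd_add_R z' s))); auto. ring.
      - exact (continuous_Cplus _ _ _ _
          (continuous_Cmult _ _ _ _ (continuous_Cconst _ 1 s) (cont_shift f z' s Hcf Hz'))
          (continuous_Cmult _ _ _ _ (ccont_half s) (cont_shift df z' s Hdf Hz'))). }
    assert (K' := isI_minus _ _ _ _ _ _ K (mean_correct f z' Hcf Hz')).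
    apply isI_eq with (4 := K'); [lra| |].
    - intros; ring.
    - rewrite Hm, Hp by auto. replace (z' + 0) with z' by ring. field. }
  assert (HpT : periodic T).
  { intros z Hz. unfold T. apply CI_ext; [lra|]. intros s Hs.
    replace (z + 1 + RtoC s) with ((z + RtoC s) + 1) by ring. rewrite Hp; auto. apply upper_add_R; auto. }
  assert (HgT : egrowth c T).
  { destruct Hg as (B & A & HB & H). exists B, A. split; auto. intros z Hz HA.
    apply Rle_trans with (B * exp (c * Im z) * (1 - 0))%R; [|lra].
    apply (isI_bound_const (fun s => (RtoC s - / 2) * f (z + RtoC s))); [lra| |].
    - intros s Hs. rewrite Cmod_mult.
      assert (E : (Cmod (RtoC s - / 2) <= 1)%R).
      { replace (RtoC s - / 2) with (RtoC (s - / 2)).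
        - rewrite Cmod_R. apply Rabs_le. lra.
        - rewrite RtoC_minus, RtoC_inv by lra. reflexivity. }
      specialize (H (z + RtoC s) (upper_add_R z s Hz)).
      replace (Im (z + RtoC s)) with (Im z) in H by (destruct z; simpl; ring).
      specialize (H HA). assert (H0 := Cmod_ge_0 (f (z + RtoC s))).
      assert (H1 := Cmod_ge_0 (RtoC s - / 2)). nra.
    - apply CI_correct; [lra|]. intros s _.
      exact (continuous_Cmult _ _ _ _ (ccont_half s) (cont_shift f z s Hcf Hz)). }
  assert (Hi : upper Ci) by (unfold upper; simpl; lra).
  exists (fun z => T z - mean T Ci). split; [|split].
  - intros z Hz. apply wd_eq with (1 := wd_minus _ _ _ _ _ _ _ (HT z Hz) (wd_const (mean T Ci) z));
    intros; auto; ring.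
  - apply (sub_mean_nice T f); auto.
  - apply egrowth_sub_const; auto.
Qed.

Lemma periodic_primitives (f : C -> C) (c : R) (m : nat) : (0 <= c)%R -> nice f -> egrowth c f ->
  exists psi : nat -> C -> C, psi m = f /\ (forall i, (i < m)%nat -> hol (psi i) (psi (S i))) /\
    forall i, (i <= m)%nat -> nice (psi i) /\ egrowth c (psi i).
Proof.
  intros Hc Hf Hg. induction m as [|m (psi & E & H1 & H2)].
  - exists (fun _ => f). split; [reflexivity|]. split; [intros; lia|]. intros; auto.
  - destruct (H2 O ltac:(lia)) as [Hn He].
    destruct (periodic_primitive _ c Hc Hn He) as (F & HF & HFn & HFe).
    exists (fun i => match i with O => F | S i => psi i end). split; [exact E|]. split.
    + intros [|i] Hi; auto. apply H1. lia.
    + intros [|i] Hi; auto. apply H2. lia.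
Qed.

Lemma egrowth_sgrowth (c : R) (f : C -> C) (z0 : C) : upper z0 -> egrowth c f -> sgrowth z0 c f.
Proof.
  intros Hz (B & A & HB & H). exists (B * exp (c * Im z0))%R, (Rabs A). repeat split.
  - apply Rmult_le_pos; auto. left; apply exp_pos.
  - apply Rabs_pos.
  - intros s t Hs Ht. rewrite Rmult_assoc, <- exp_plus, <- Rmult_plus_distr_l.
    assert (E : Im (strip z0 s t) = (Im z0 + t)%R) by (destruct z0; simpl; ring).
    rewrite <- E. unfold upper in Hz. assert (K := Rle_abs A). assert (K' := Rabs_pos A). apply H.
    + unfold upper. rewrite E. lra.
    + rewrite E. lra.
Qed.

Lemma egrowth_le (c c' : R) (f : C -> C) : (c <= c')%R -> egrowth c f -> egrowth c' f.
Proof.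
  intros Hc (B & A & HB & H). exists B, A. split; auto. intros z Hz HA.
  apply Rle_trans with (1 := H z Hz HA). apply Rmult_le_compat_l; auto. apply exp_le.
  unfold upper in Hz. apply Rmult_le_compat_r; lra.
Qed.

Lemma egrowth_ext (c : R) (f g : C -> C) : (forall z, upper z -> f z = g z) -> egrowth c f -> egrowth c g.
Proof.
  intros E (B & A & HB & H). exists B, A. split; auto. intros z Hz. rewrite <- E by auto. auto.
Qed.

Lemma egrowth_plus (c : R) (f g : C -> C) : egrowth c f -> egrowth c g -> egrowth c (fun z => f z + g z).
Proof.
  intros (B & A & HB & H) (B' & A' & HB' & H'). exists (B + B')%R, (Rmax A A'). split; [lra|].
  intros z Hz HA. apply Rle_trans with (1 := Cmod_triangle _ _). rewrite Rmult_plus_distr_r.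
  apply Rplus_le_compat; [apply H|apply H']; auto.
  - apply Rle_trans with (2 := HA), Rmax_l.
  - apply Rle_trans with (2 := HA), Rmax_r.
Qed.

Lemma egrowth_mult (c c' : R) (f g : C -> C) : egrowth c f -> egrowth c' g ->
  egrowth (c + c') (fun z => f z * g z).
Proof.
  intros (B & A & HB & H) (B' & A' & HB' & H'). exists (B * B')%R, (Rmax A A'). split.
  { apply Rmult_le_pos; auto. }
  intros z Hz HA. rewrite Cmod_mult.
  replace (B * B' * exp ((c + c') * Im z))%R with ((B * exp (c * Im z)) * (B' * exp (c' * Im z)))%R.
  - apply Rmult_le_compat; auto using Cmod_ge_0; [apply H|apply H']; auto.
    + apply Rle_trans with (2 := HA), Rmax_l.
    + apply Rle_trans with (2 := HA), Rmax_r.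
  - rewrite Rmult_plus_distr_r, exp_plus. ring.
Qed.

Lemma egrowth_const (a : C) : egrowth 0 (fun _ => a).
Proof.
  exists (Cmod a), 0%R. split; [apply Cmod_ge_0|]. intros. rewrite Rmult_0_l, exp_0. lra.
Qed.

Lemma egrowth_conj (c : R) (f : C -> C) : egrowth c f -> egrowth c (fun z => Cconj (f z)).
Proof.
  intros (B & A & HB & H). exists B, A. split; auto. intros. rewrite Cmod_conj. auto.
Qed.

(** * Cauchy's estimate *)

Definition circle (z : C) (r th : R) : C := z + RtoC r * Cexp (RtoC th * Ci).

Lemma pd_circle_r (z : C) (r th : R) : pd (fun r => circle z r th) r (Cexp (RtoC th * Ci)).
Proof. apply pd_affine. Qed.

Lemma pd_circle_th (z : C) (r th : R) :
  pd (fun th => circle z r th) th (RtoC r * (Ci * Cexp (RtoC th * Ci))).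
Proof.
  apply pd_eq with (1 := pd_plus _ _ _ _ _ (pd_const z th)
    (pd_scal (RtoC r) _ _ _ (pd_Cexp_line Ci th))); auto. ring.
Qed.

Lemma Cexp_2PI : Cexp (RtoC (2 * PI) * Ci) = 1.
Proof.
  unfold Cexp. replace (Re (RtoC (2 * PI) * Ci)) with 0%R by (simpl; ring).
  replace (Im (RtoC (2 * PI) * Ci)) with (2 * PI)%R by (simpl; ring).
  rewrite exp_0, cos_2PI, sin_2PI. apply C_pair_intro; unfold Re, Im; simpl; ring.
Qed.

Lemma Cexp_ang_0 : Cexp (RtoC 0 * Ci) = 1.
Proof. rewrite Cmult_0_l. apply Cexp_0. Qed.

Lemma Cmod_ang (th : R) : Cmod (Cexp (RtoC th * Ci)) = 1%R.
Proof. rewrite Cmod_Cexp. replace (Re (RtoC th * Ci)) with 0%R by (simpl; ring). apply exp_0. Qed.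

Lemma circle_Im (z : C) (r th : R) : (Rabs (Im (circle z r th) - Im z) <= Rabs r)%R.
Proof.
  replace (Im (circle z r th) - Im z)%R with (Im (RtoC r * Cexp (RtoC th * Ci)))
    by (unfold circle; destruct z; simpl; ring).
  apply Rle_trans with (1 := Im_le_Cmod _). rewrite Cmod_mult, Cmod_ang, Cmod_R. lra.
Qed.

Lemma circle_upper (z : C) (r th : R) : (Rabs r < Im z)%R -> upper (circle z r th).
Proof.
  intros H. assert (K := circle_Im z r th). apply Rabs_le_between in K. unfold upper. lra.
Qed.

Lemma ccont_ang (th : R) : ccont (fun th : R => Cexp (RtoC th * Ci)) th.
Proof. exact (pd_continuous _ _ _ (pd_Cexp_line Ci th)). Qed.

Lemma circle_continuous_2d (z : C) (g : C -> C) (r th : R) : cont_upper g -> (Rabs r < Im z)%R ->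
  continuous (T := prod_UniformSpace R_UniformSpace R_UniformSpace) (U := C_UniformSpace)
    (fun p => g (circle z (fst p) (snd p))) (r, th).
Proof.
  intros Hg Hr. apply (continuous_C_comp _ g); [apply Hg, circle_upper; auto|].
  apply continuous_Cplus; [apply continuous_Cconst|]. apply continuous_Cmult.
  - apply continuous_RtoC. apply continuous_fst.
  - apply (continuous_C_comp _ Cexp); [apply continuous_Cexp|].
    apply continuous_Cmult; [|apply continuous_Cconst]. apply continuous_RtoC, continuous_snd.
Qed.

Lemma circle_continuous (z : C) (g : C -> C) (r th : R) : cont_upper g -> (Rabs r < Im z)%R ->
  ccont (fun th => g (circle z r th)) th.
Proof.
  intros Hg Hr. apply (continuous_C_comp _ g); [apply Hg, circle_upper; auto|].
  exact (pd_continuous _ _ _ (pd_circle_th z r th)).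
Qed.

Lemma pd_circle_mean (f df : C -> C) (w : R -> C) (z : C) (r : R) :
  hol f df -> cont_upper df -> (forall th, ccont w th) -> (0 <= r < Im z)%R ->
  pd (fun r => CI (fun th => w th * f (circle z r th)) 0 (2 * PI)) r
    (CI (fun th => w th * (df (circle z r th) * Cexp (RtoC th * Ci))) 0 (2 * PI)).
Proof.
  intros Hf Hdf Hw Hr. assert (HPI := PI_RGT_0). assert (Hcf := hol_cont _ _ Hf).
  assert (Hr' : forall r', (Rabs (r' - r) < Im z - r)%R -> (Rabs r' < Im z)%R).
  { intros r' H. assert (K := Rabs_triang (r' - r) r). replace (r' - r + r)%R with r' in K by ring.
    rewrite (Rabs_pos_eq r) in K by lra. lra. }
  apply (CI_param_derive (fun r th => w th * f (circle z r th))
    (fun r th => w th * (df (circle z r th) * Cexp (RtoC th * Ci))) 0 (2 * PI) r (Im z - r)); try lra.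
  - intros r' th H _. apply pd_scal.
    apply pd_eq with (1 := wd_path f _ r' _ _ _ (Hf _ (circle_upper z r' th (Hr' r' H))) (pd_circle_r z r' th)); auto.
    ring.
  - intros th _. apply continuous_Cmult; [|apply continuous_Cmult].
    + apply (continuous_comp (fun p : prod_UniformSpace R_UniformSpace R_UniformSpace => snd p)
        (w : R_UniformSpace -> C_UniformSpace)); [apply continuous_snd|apply Hw].
    + apply circle_continuous_2d; auto. rewrite Rabs_pos_eq; lra.
    + apply (continuous_C_comp _ Cexp); [apply continuous_Cexp|].
      apply continuous_Cmult; [|apply continuous_Cconst]. apply continuous_RtoC, continuous_snd.
  - intros r' th H _. apply continuous_Cmult; auto. apply circle_continuous; auto.
Qed.

(** The r-derivative of the circle integral is 1/(ir) times the integral of d/dtheta f(z + r e^(i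
    theta)) over a full turn, hence 0; at r = 0 the integral of e^(i theta) vanishes instead. *)
Lemma circle_mean_value (f df : C -> C) (z : C) (r : R) :
  hol f df -> cont_upper df -> (0 <= r < Im z)%R ->
  CI (fun th => 1 * f (circle z r th)) 0 (2 * PI) = RtoC (2 * PI) * f z.
Proof.
  intros Hf Hdf Hr. assert (HPI := PI_RGT_0).
  set (m := fun r => CI (fun th => 1 * f (circle z r th)) 0 (2 * PI)).
  assert (D : forall s, (0 <= s <= r)%R -> pd m s 0).
  { intros s Hs.
    assert (K := pd_circle_mean f df (fun _ => 1) z s Hf Hdf (fun th => continuous_Cconst _ _ th) ltac:(lra)).
    apply pd_eq with (1 := K); auto.
    destruct (Req_dec s 0) as [->|Hn].
    - apply isI_unique.
      assert (L : isI (fun th => Ci * Cexp (RtoC th * Ci)) 0 (2 * PI)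
        (Cexp (RtoC (2 * PI) * Ci) - Cexp (RtoC 0 * Ci))).
      { apply (isI_derive (fun th => Cexp (RtoC th * Ci))); intros th _.
        - apply pd_Cexp_line.
        - apply continuous_Cmult; [apply continuous_Cconst|apply ccont_ang]. }
      rewrite Cexp_2PI, Cexp_ang_0 in L.
      apply isI_eq with (4 := isI_scal (- Ci * df z) _ _ _ _ L); [lra| |ring].
      intros th _. replace (circle z 0 th) with z by (unfold circle; ring).
      replace (- Ci * df z * (Ci * Cexp (RtoC th * Ci))) with (- (Ci * Ci) * (df z * Cexp (RtoC th * Ci))) by ring.
      rewrite Ci_sqr. ring.
    - apply isI_unique.
      assert (L : isI (fun th => df (circle z s th) * (RtoC s * (Ci * Cexp (RtoC th * Ci)))) 0 (2 * PI)
        (f (circle z s (2 * PI)) - f (circle z s 0))).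
      { apply (isI_derive (fun th => f (circle z s th))); intros th _.
        - apply pd_eq with (1 := wd_path f _ th _ _ _ (Hf _ (circle_upper z s th
            ltac:(rewrite Rabs_pos_eq; lra))) (pd_circle_th z s th)); auto. ring.
        - apply continuous_Cmult; [apply circle_continuous; auto; rewrite Rabs_pos_eq; lra|].
          exact (continuous_Cmult _ _ _ _ (continuous_Cconst _ (RtoC s) th)
            (continuous_Cmult _ _ _ _ (continuous_Cconst _ Ci th) (ccont_ang th))). }
      unfold circle in L at 2 3. rewrite Cexp_2PI, Cexp_ang_0 in L.
      apply isI_eq with (4 := isI_scal (- Ci * / RtoC s) _ _ _ _ L); [lra| |ring].
      intros th _. assert (Hs0 : RtoC s <> 0) by (intros E; apply Hn; now apply RtoC_inj in E).
      transitivity (- (Ci * Ci) * (df (circle z s th) * Cexp (RtoC th * Ci)) * (RtoC s * / RtoC s)); [ring|].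
      rewrite Ci_sqr, Cinv_r by auto. ring. }
  assert (K := pd_mean_value m (fun _ => 0) 0 r 0 ltac:(lra) D
    ltac:(intros; cbv beta; rewrite Cmod_0; lra)).
  rewrite Rmult_0_l in K.
  assert (E : m r = m 0%R).
  { replace (m r) with (m 0%R + (m r - m 0%R)) by ring.
    rewrite (Cmod_eq_0 (m r - m 0%R)); [ring|]. apply Rle_antisym; auto using Cmod_ge_0. }
  fold (m r). rewrite E. unfold m. apply isI_unique.
  apply isI_eq with (4 := isI_const (f z) 0 (2 * PI)); [lra| |].
  - intros th _. replace (circle z 0 th) with z by (unfold circle; ring). ring.
  - now rewrite Rminus_0_r.
Qed.

(** Let q(r) be the integral of e^(-i theta) f(z + r e^(i theta)). Then q(0) = 0, and q' is the
    circle integral of f1, which is 2 pi f1(z) by the mean value property; so q(1) = 2 pi f1(z), and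
    q(1) is bounded by 2 pi B. *)
Lemma cauchy_estimate (f f1 f2 : C -> C) (z : C) (B : R) :
  hol f f1 -> hol f1 f2 -> cont_upper f2 -> (1 < Im z)%R ->
  (forall w, (Rabs (Im w - Im z) <= 1)%R -> (Cmod (f w) <= B)%R) -> (Cmod (f1 z) <= B)%R.
Proof.
  intros Hf Hf1 Hf2 Hz HB. assert (HPI := PI_RGT_0). assert (Hcf := hol_cont _ _ Hf).
  assert (Hcf1 := hol_cont _ _ Hf1).
  set (w := fun th : R => Cexp (RtoC th * - Ci)).
  assert (Hw : forall th, ccont w th).
  { intros th. exact (pd_continuous _ _ _ (pd_Cexp_line (- Ci) th)). }
  assert (Hww : forall th, w th * Cexp (RtoC th * Ci) = 1).
  { intros th. unfold w. rewrite <- Cexp_plus.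
    replace (RtoC th * - Ci + RtoC th * Ci) with (RtoC 0) by ring. apply Cexp_0. }
  set (q := fun r => CI (fun th => w th * f (circle z r th)) 0 (2 * PI)).
  assert (D : forall r, (0 <= r <= 1)%R -> pd (fun r => q r - RtoC r * (RtoC (2 * PI) * f1 z)) r 0).
  { intros r Hr.
    assert (K := pd_circle_mean f f1 w z r Hf Hcf1 Hw ltac:(lra)).
    apply pd_eq with (1 := pd_minus _ _ _ _ _ K (pd_affine 0 (RtoC (2 * PI) * f1 z) r)).
    - intros s. unfold q. ring.
    - rewrite <- (circle_mean_value f1 f2 z r) by (auto; lra).
      rewrite (CI_ext (fun th => w th * (f1 (circle z r th) * Cexp (RtoC th * Ci)))
        (fun th => 1 * f1 (circle z r th))); [ring|lra|].
      intros th _. rewrite <- (Hww th). ring. }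
  assert (K := pd_mean_value _ (fun _ => 0) 0 1 0 ltac:(lra) D
    ltac:(intros; cbv beta; rewrite Cmod_0; lra)).
  cbv beta in K. rewrite Rmult_0_l in K.
  assert (Q0 : q 0%R = 0).
  { unfold q. apply isI_unique.
    assert (L : isI (fun th => - Ci * Cexp (RtoC th * - Ci)) 0 (2 * PI)
        (Cexp (RtoC (2 * PI) * - Ci) - Cexp (RtoC 0 * - Ci))).
    { apply (isI_derive (fun th => Cexp (RtoC th * - Ci))); intros th _.
      - apply pd_Cexp_line.
      - apply continuous_Cmult; [apply continuous_Cconst|apply Hw]. }
    apply isI_eq with (4 := isI_scal (Ci * f z) _ _ _ _ L); [lra| |].
    - intros th _. replace (circle z 0 th) with z by (unfold circle; ring).
      fold (w th). replace (Ci * f z * (- Ci * w th)) with (- (Ci * Ci) * (w th * f z)) by ring.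
      rewrite Ci_sqr. ring.
    - assert (E := Hww (2 * PI)%R). rewrite Cexp_2PI in E. unfold w in E.
      replace (Cexp (RtoC (2 * PI) * - Ci)) with (RtoC 1) by (rewrite <- E; ring).
      replace (RtoC 0 * - Ci) with (RtoC 0) by ring. rewrite Cexp_0. ring. }
  rewrite Q0 in K.
  assert (E : q 1%R = RtoC (2 * PI) * f1 z).
  { assert (E0 : q 1%R - 1 * (RtoC (2 * PI) * f1 z) - (0 - 0 * (RtoC (2 * PI) * f1 z)) = 0).
    { apply Cmod_eq_0. apply Rle_antisym; auto using Cmod_ge_0. }
    replace (q 1%R) with (RtoC (2 * PI) * f1 z +
      (q 1%R - 1 * (RtoC (2 * PI) * f1 z) - (0 - 0 * (RtoC (2 * PI) * f1 z)))) by ring.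
    rewrite E0. ring. }
  assert (Hq : (Cmod (q 1%R) <= B * (2 * PI - 0))%R).
  { apply (isI_bound_const (fun th => w th * f (circle z 1 th))); [lra| |].
    - intros th _. rewrite Cmod_mult.
      replace (Cmod (w th)) with 1%R.
      + rewrite Rmult_1_l. apply HB. apply Rle_trans with (1 := circle_Im z 1 th).
        rewrite Rabs_R1. lra.
      + unfold w. rewrite Cmod_Cexp. replace (Re (RtoC th * - Ci)) with 0%R by (simpl; ring).
        now rewrite exp_0.
    - apply CI_correct; [lra|]. intros th _. apply continuous_Cmult; auto.
      apply circle_continuous; auto. rewrite Rabs_R1. lra. }
  rewrite E, Cmod_mult, Cmod_R, Rabs_pos_eq, Rminus_0_r in Hq by lra. nra.
Qed.

Lemma egrowth_derivative (c : R) (f f1 f2 : C -> C) : (0 <= c)%R ->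
  hol f f1 -> hol f1 f2 -> cont_upper f2 -> egrowth c f -> egrowth c f1.
Proof.
  (* The unit disc around z must stay above height A and inside the half-plane; a change of height
     by at most 1 costs the factor exp c. *)
  intros Hc Hf Hf1 Hf2 (B & A & HB & H). exists (B * exp c)%R, (Rmax (A + 1) 2). split.
  { apply Rmult_le_pos; auto. left; apply exp_pos. }
  intros z Hz HA.
  assert (H1 := Rle_trans _ _ _ (Rmax_l _ _) HA). assert (H2 := Rle_trans _ _ _ (Rmax_r _ _) HA).
  apply (cauchy_estimate f f1 f2); auto; [lra|].
  intros w Hw. apply Rabs_le_between in Hw.
  apply Rle_trans with (B * exp (c * Im w))%R.
  - apply H; [unfold upper|]; lra.
  - rewrite Rmult_assoc, <- exp_plus. apply Rmult_le_compat_l; auto. apply exp_le. nra.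
Qed.

(** * Smooth functions on the upper half-plane *)

Lemma continuous_ext_upper (f g : C -> C) (z : C) : (forall w, upper w -> f w = g w) -> upper z ->
  continuous f z -> continuous g z.
Proof.
  intros E Hz H. apply (continuous_C_eps g z). intros eps He.
  apply locally_C_Cmod.
  destruct (continuous_C_delta f z H eps He) as (d & Hd & K).
  destruct (upper_open z Hz) as (d' & Hd' & K').
  exists (Rmin d d'); split; [apply Rmin_pos; auto|]. intros w Hw.
  rewrite <- !E; auto.
  - apply K. apply Rlt_le_trans with (1 := Hw), Rmin_l.
  - replace w with (z + (w - z)) by ring. apply K'. apply Rlt_le_trans with (1 := Hw), Rmin_r.
Qed.

Lemma locally_gt_0 (y : R) : (0 < y)%R -> locally y (fun t => (0 < t)%R).
Proof.
  intros Hy. exists (mkposreal y Hy). intros t Ht. apply Rabs_def2 in Ht. simpl in Ht.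
  unfold minus, plus, opp in Ht; simpl in Ht. lra.
Qed.

Lemma pd_ext_upper (f g : C -> C) (z v w : C) : (forall w, upper w -> f w = g w) -> upper z ->
  pd (fun t => f (t, Im z)) (Re z) v -> pd (fun t => f (Re z, t)) (Im z) w ->
  pd (fun t => g (t, Im z)) (Re z) v /\ pd (fun t => g (Re z, t)) (Im z) w.
Proof.
  intros E Hz Hx [Hy1 Hy2]. split.
  - apply pd_eq with (1 := Hx); auto.
  - split.
    + apply is_derive_ext_loc with (2 := Hy1).
      refine (filter_imp _ _ _ (locally_gt_0 (Im z) Hz)). intros t Ht. now rewrite E.
    + apply is_derive_ext_loc with (2 := Hy2).
      refine (filter_imp _ _ _ (locally_gt_0 (Im z) Hz)). intros t Ht. now rewrite E.
Qed.

Lemma partials_unique (f : C -> C) (z v w : C) :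
  pd (fun t => f (t, Im z)) (Re z) v -> pd (fun t => f (Re z, t)) (Im z) w ->
  ex_partials f z /\ partial_x f z = v /\ partial_y f z = w.
Proof.
  intros Hx Hy.
  assert (Ex : partial_x f z = v) by exact (pd_unique (fun t => f (t, Im z)) (Re z) v Hx).
  assert (Ey : partial_y f z = w) by exact (pd_unique (fun t => f (Re z, t)) (Im z) w Hy).
  rewrite pd_ex_partials, Ex, Ey. auto.
Qed.

Lemma partials_ext_upper (f g : C -> C) (z : C) : (forall w, upper w -> f w = g w) -> upper z ->
  ex_partials f z ->
  ex_partials g z /\ partial_x g z = partial_x f z /\ partial_y g z = partial_y f z.
Proof.
  intros E Hz H. apply pd_ex_partials in H.
  destruct (pd_ext_upper f g z _ _ E Hz (proj1 H) (proj2 H)). now apply partials_unique.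
Qed.

Lemma Cn_upper_ext (n : nat) (f g : C -> C) : (forall w, upper w -> f w = g w) ->
  Cn_upper n f -> Cn_upper n g.
Proof.
  revert f g. induction n as [|n IH]; intros f g E [Hc H]; (split;
    [intros z Hz; apply continuous_ext_upper with (1 := E); auto|]); auto.
  destruct H as (Hp & Hx & Hy). split; [|split].
  - intros z Hz. now apply (partials_ext_upper f g z E Hz (Hp z Hz)).
  - apply IH with (2 := Hx). intros z Hz. symmetry. now apply (partials_ext_upper f g z E Hz (Hp z Hz)).
  - apply IH with (2 := Hy). intros z Hz. symmetry. now apply (partials_ext_upper f g z E Hz (Hp z Hz)).
Qed.

Lemma partials_lin (a b : C) (f g : C -> C) (z : C) : ex_partials f z -> ex_partials g z ->
  ex_partials (fun z => a * f z + b * g z) z /\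
  partial_x (fun z => a * f z + b * g z) z = a * partial_x f z + b * partial_x g z /\
  partial_y (fun z => a * f z + b * g z) z = a * partial_y f z + b * partial_y g z.
Proof.
  rewrite (pd_ex_partials f), (pd_ex_partials g). intros [Hf1 Hf2] [Hg1 Hg2].
  apply partials_unique.
  - exact (pd_plus _ _ _ _ _ (pd_scal a _ _ _ Hf1) (pd_scal b _ _ _ Hg1)).
  - exact (pd_plus _ _ _ _ _ (pd_scal a _ _ _ Hf2) (pd_scal b _ _ _ Hg2)).
Qed.

Lemma Cn_upper_lin (n : nat) (a b : C) (f g : C -> C) : Cn_upper n f -> Cn_upper n g ->
  Cn_upper n (fun z => a * f z + b * g z).
Proof.
  revert f g. induction n as [|n IH]; intros f g [Hf Hf'] [Hg Hg']; (split;
    [intros z Hz; exact (continuous_Cplus _ _ _ _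
       (continuous_Cmult _ _ _ _ (continuous_Cconst _ a z) (Hf z Hz))
       (continuous_Cmult _ _ _ _ (continuous_Cconst _ b z) (Hg z Hz)))|]); auto.
  destruct Hf' as (Hp & Hx & Hy). destruct Hg' as (Hp' & Hx' & Hy'). split; [|split].
  - intros z Hz. now apply partials_lin; auto.
  - apply Cn_upper_ext with (2 := IH _ _ Hx Hx'). intros z Hz. symmetry.
    now apply (partials_lin a b f g z (Hp z Hz) (Hp' z Hz)).
  - apply Cn_upper_ext with (2 := IH _ _ Hy Hy'). intros z Hz. symmetry.
    now apply (partials_lin a b f g z (Hp z Hz) (Hp' z Hz)).
Qed.

Lemma smooth_partial_x (f : C -> C) : smooth_upper f -> smooth_upper (partial_x f).
Proof. intros H n. now destruct (H (S n)) as (_ & _ & Hx & _). Qed.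
Lemma smooth_partial_y (f : C -> C) : smooth_upper f -> smooth_upper (partial_y f).
Proof. intros H n. now destruct (H (S n)) as (_ & _ & _ & Hy). Qed.
Lemma smooth_cont (f : C -> C) : smooth_upper f -> cont_upper f.
Proof. intros H. now destruct (H O) as (Hc & _). Qed.
Lemma smooth_ex_partials (f : C -> C) (z : C) : smooth_upper f -> upper z -> ex_partials f z.
Proof. intros H Hz. destruct (H 1%nat) as (_ & Hp & _). now apply Hp. Qed.

Lemma smooth_lin (a b : C) (f g : C -> C) : smooth_upper f -> smooth_upper g ->
  smooth_upper (fun z => a * f z + b * g z).
Proof. intros Hf Hg n. now apply Cn_upper_lin. Qed.

Lemma smooth_ext (f g : C -> C) : (forall z, upper z -> f z = g z) -> smooth_upper f -> smooth_upper g.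
Proof. intros E H n. now apply Cn_upper_ext with (1 := E). Qed.

Lemma smooth_scal (a : C) (f : C -> C) : smooth_upper f -> smooth_upper (fun z => a * f z).
Proof.
  intros H. apply smooth_ext with (2 := smooth_lin a 0 f f H H). intros; ring.
Qed.

Lemma partial_z_lin (f : C -> C) (z : C) :
  partial_z f z = / 2 * partial_x f z + (- (/ 2 * Ci)) * partial_y f z.
Proof. unfold partial_z. ring. Qed.

Lemma partial_zbar_lin (f : C -> C) (z : C) :
  partial_zbar f z = / 2 * partial_x f z + (/ 2 * Ci) * partial_y f z.
Proof. unfold partial_zbar. ring. Qed.

Lemma smooth_partial_z (f : C -> C) : smooth_upper f -> smooth_upper (partial_z f).
Proof.
  intros H. eapply smooth_ext; [|apply (smooth_lin (/ 2) (- (/ 2 * Ci)) (partial_x f) (partial_y f));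
    auto using smooth_partial_x, smooth_partial_y].
  intros z _. symmetry. apply partial_z_lin.
Qed.

Lemma smooth_partial_zbar (f : C -> C) : smooth_upper f -> smooth_upper (partial_zbar f).
Proof.
  intros H. eapply smooth_ext; [|apply (smooth_lin (/ 2) (/ 2 * Ci) (partial_x f) (partial_y f));
    auto using smooth_partial_x, smooth_partial_y].
  intros z _. symmetry. apply partial_zbar_lin.
Qed.

Lemma smooth_wd (f : C -> C) (z : C) : smooth_upper f -> upper z ->
  wd f z (partial_z f z) (partial_zbar f z).
Proof.
  intros H Hz. apply (wd_of_partials upper f (partial_x f) (partial_y f)).
  - destruct (upper_open z Hz) as (d & Hd & K). exists d; split; auto.
    intros w Hw. replace w with (z + (w - z)) by ring. auto.
  - intros w Hw. apply pd_ex_partials, smooth_ex_partials; auto.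
  - apply (smooth_cont _ (smooth_partial_x f H)); auto.
  - apply (smooth_cont _ (smooth_partial_y f H)); auto.
Qed.

Lemma continuity_2d_C (p : C -> R) (f : C -> C) (x y : R) :
  (forall (T : UniformSpace) (f : T -> C) x, continuous (U := C_UniformSpace) f x ->
     continuous (fun t => p (f t)) x) ->
  continuous f (x, y) -> continuity_2d_pt (fun u v => p (f (u, v))) x y.
Proof.
  intros Hp Hf. apply continuity_2d_pt_filterlim.
  assert (K := Hp _ f _ Hf).
  intros P HP. destruct (K P HP) as [d Hd]. exists d. intros [u v] Huv. exact (Hd (u, v) Huv).
Qed.

Lemma schwarz_upper (f : C -> C) (z : C) : smooth_upper f -> upper z ->
  partial_x (partial_y f) z = partial_y (partial_x f) z.
Proof.
  intros H Hz. assert (Hx := smooth_partial_x f H). assert (Hy := smooth_partial_y f H).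
  destruct z as [x y].
  assert (L : forall P : R -> R -> Prop, (forall u v, (0 < v)%R -> P u v) -> locally_2d P x y).
  { intros P HP. exists (mkposreal y Hz). intros u v _ Hv. apply HP.
    apply Rabs_def2 in Hv. simpl in Hv. lra. }
  apply C_pair_intro.
  - apply (Schwarz (fun u v => Re (f (u, v))) x y).
    + apply L. intros u v Hv.
      destruct (smooth_ex_partials f (u, v) H Hv) as (A1 & _ & A2 & _).
      destruct (smooth_ex_partials _ (u, v) Hy Hv) as (A3 & _ & _ & _).
      destruct (smooth_ex_partials _ (u, v) Hx Hv) as (_ & _ & A4 & _).
      auto.
    + apply (continuity_2d_C Re (partial_x (partial_y f))).
      * intros T g t. apply continuous_Re.
      * apply (smooth_cont _ (smooth_partial_x _ Hy)); auto.
    + apply (continuity_2d_C Re (partial_y (partial_x f))).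
      * intros T g t. apply continuous_Re.
      * apply (smooth_cont _ (smooth_partial_y _ Hx)); auto.
  - apply (Schwarz (fun u v => Im (f (u, v))) x y).
    + apply L. intros u v Hv.
      destruct (smooth_ex_partials f (u, v) H Hv) as (_ & A1 & _ & A2).
      destruct (smooth_ex_partials _ (u, v) Hy Hv) as (_ & A3 & _ & _).
      destruct (smooth_ex_partials _ (u, v) Hx Hv) as (_ & _ & _ & A4).
      auto.
    + apply (continuity_2d_C Im (partial_x (partial_y f))).
      * intros T g t. apply continuous_Im.
      * apply (smooth_cont _ (smooth_partial_x _ Hy)); auto.
    + apply (continuity_2d_C Im (partial_y (partial_x f))).
      * intros T g t. apply continuous_Im.
      * apply (smooth_cont _ (smooth_partial_y _ Hx)); auto.
Qed.

Lemma partial_z_zbar_comm (f : C -> C) (z : C) : smooth_upper f -> upper z ->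
  partial_zbar (partial_z f) z = partial_z (partial_zbar f) z.
Proof.
  intros H Hz. assert (Hx := smooth_partial_x f H). assert (Hy := smooth_partial_y f H).
  assert (G : forall g a b, smooth_upper g -> (forall z, g z = a * partial_x f z + b * partial_y f z) ->
    partial_x g z = a * partial_x (partial_x f) z + b * partial_x (partial_y f) z /\
    partial_y g z = a * partial_y (partial_x f) z + b * partial_y (partial_y f) z).
  { intros g a b Hg E.
    assert (Hgz := smooth_ex_partials g z Hg Hz).
    assert (K := partials_ext_upper g _ z (fun w _ => E w) Hz Hgz).
    assert (K' := partials_lin a b _ _ z (smooth_ex_partials _ z Hx Hz) (smooth_ex_partials _ z Hy Hz)).
    destruct K as (_ & K1 & K2). destruct K' as (_ & K3 & K4).
    rewrite <- K1, <- K2, K3, K4. auto. }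
  destruct (G _ _ _ (smooth_partial_z f H) (partial_z_lin f)) as [E1 E2].
  destruct (G _ _ _ (smooth_partial_zbar f H) (partial_zbar_lin f)) as [E3 E4].
  rewrite partial_zbar_lin, E1, E2, partial_z_lin, E3, E4, (schwarz_upper f z H Hz). ring.
Qed.

(** * Splitting of a harmonic Maass form *)

Lemma wd_pow_gen (f : C -> C) (z a b : C) (m : nat) : wd f z a b ->
  wd (fun w => f w ^ m) z (INR m * f z ^ pred m * a) (INR m * f z ^ pred m * b).
Proof.
  intros H. induction m as [|m IH].
  - apply wd_eq with (1 := wd_const 1 z); auto; simpl; ring.
  - destruct m as [|m].
    + apply wd_eq with (1 := H); intros; simpl; ring.
    + change (pred (S (S m))) with (S m). change (pred (S m)) with m in IH.
      apply wd_eq with (1 := wd_mult _ _ _ _ _ _ _ H IH).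
      * intros w. now rewrite <- Cpow_S.
      * rewrite (S_INR (S m)), RtoC_plus, !Cpow_S. ring.
      * rewrite (S_INR (S m)), RtoC_plus, !Cpow_S. ring.
Qed.

(** The divided power of 2 i Im z, normalised so that differentiation in z lowers the index without
    a factor. *)
Definition im_pow (m : nat) (z : C) : C := (z - Cconj z) ^ m / INR (fact m).

Lemma wd_z_minus_conj (z : C) : wd (fun w => w - Cconj w) z 1 (Copp 1).
Proof.
  apply wd_eq with (1 := wd_minus _ _ _ _ _ _ _ (wd_id z) (wd_conj _ _ _ _ (wd_id z))); auto.
  - replace (Cconj 0) with (RtoC 0) by (apply C_pair_intro; simpl; ring). ring.
  - replace (Cconj 1) with (RtoC 1) by (apply C_pair_intro; simpl; ring). ring.
Qed.

Lemma wd_im_pow_S (m : nat) (z : C) : exists b, wd (im_pow (S m)) z (im_pow m z) b.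
Proof.
  eexists. apply wd_eq with (1 := wd_scal (/ INR (fact (S m))) _ _ _ _
    (wd_pow_gen _ _ _ _ (S m) (wd_z_minus_conj z))); [| |reflexivity].
  - intros w. unfold im_pow, Cdiv. ring.
  - unfold im_pow. change (pred (S m)) with m.
    assert (E : RtoC (INR (fact (S m))) = RtoC (INR (S m)) * RtoC (INR (fact m))).
    { rewrite <- RtoC_mult, <- mult_INR. reflexivity. }
    rewrite E. field. split; [apply INR_fact_neq|].
    intros H. apply RtoC_inj in H. now apply (not_0_INR (S m)).
Qed.

(* Here [e] lists successive derivatives, with e_(n+1) the cusp form; the index
   [r] is the number of derivatives in z. *)
Definition nonhol_part (n : nat) (e : nat -> C -> C) (r : nat) (z : C) : C :=
  Cconj (taylor (S n - r) (fun l => e (r + l)%nat z) (Cconj z - z)).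

Lemma im_pow_conj (m : nat) (z : C) : Cconj ((Cconj z - z) ^ m / INR (fact m)) = im_pow m z.
Proof.
  unfold im_pow, Cdiv. rewrite Cconj_mult, Cpow_conj, Cconj_minus, Cconj_invol. f_equal.
  rewrite <- RtoC_inv by apply INR_fact_neq_0. apply Cconj_RtoC.
Qed.

(** Conjugation exchanges the two parts of [wd_taylor]: the surviving top term becomes the
    zbar-derivative and the shifted sum the z-derivative. *)
Lemma wd_nonhol_part (n : nat) (e : nat -> C -> C) (r : nat) (z : C) :
  (forall i, (i <= n)%nat -> hol (e i) (e (S i))) -> upper z -> (r <= n)%nat ->
  wd (nonhol_part n e r) z (nonhol_part n e (S r) z) (Cconj (e (S n) z) * im_pow (n - r) z).
Proof.
  intros He Hz Hr.
  assert (Hy : wd (fun w => Cconj w - w) z (Copp 1) 1).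
  { apply wd_eq with (1 := wd_opp _ _ _ _ (wd_z_minus_conj z)); intros; ring. }
  assert (Hl : forall l, (l <= n - r)%nat -> wd (e (r + l)%nat) z (e (r + S l)%nat z) 0).
  { intros l Hl. replace (r + S l)%nat with (S (r + l)) by lia. apply He; auto. lia. }
  assert (K := wd_conj _ _ _ _ (wd_taylor (n - r) (fun l => e (r + l)%nat) (fun w => Cconj w - w) z 1 Hl Hy)).
  unfold nonhol_part. replace (S n - r)%nat with (S (n - r)) by lia.
  replace (S n - S r)%nat with (n - r)%nat by lia.
  apply wd_eq with (1 := K); auto.
  - f_equal. rewrite Cmult_1_l. apply csum_ext. intros i _.
    now replace (r + S i)%nat with (S r + i)%nat by lia.
  - rewrite Cconj_mult, im_pow_conj. now replace (r + S (n - r))%nat with (S n) by lia.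
Qed.

Lemma nonhol_part_zero (n : nat) (e : nat -> C -> C) (r : nat) (z : C) : (n < r)%nat ->
  nonhol_part n e r z = 0.
Proof.
  intros H. unfold nonhol_part. replace (S n - r)%nat with O by lia.
  apply C_pair_intro; simpl; ring.
Qed.

Lemma sgn_add_pow (m l : nat) (y : C) : sgn (m + l) * y ^ l = sgn m * (- y) ^ l.
Proof.
  unfold sgn. rewrite Cpow_add_r. replace (- y) with (Copp 1 * y) by ring.
  rewrite Cpow_mult_l. ring.
Qed.

(** Summed along m = j - i, the factor at conj e_(n-m) is the Taylor expansion of P^(m) from z to
    conj z, hence P^(m)(conj z), and this is the conjugate of P^(m)(z) because P is real. *)
Lemma bracket_nonhol_part (n : nat) (e : nat -> C -> C) (l : list R) (z : C) :
  (length l <= S n)%nat ->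
  bracket n (nonhol_part n e) (ptower l) z = Cconj (bracket n e (ptower l) z).
Proof.
  intros Hl. unfold bracket. rewrite csum_conj.
  transitivity (csum (fun j => csum (fun i => sgn j * ptower l j z * Cconj (e (n - j + i)%nat z) * im_pow i z) (S j)) (S n)).
  - apply csum_ext. intros j Hj. unfold nonhol_part.
    replace (S n - (n - j))%nat with (S j) by lia. unfold taylor. rewrite csum_conj.
    transitivity ((sgn j * ptower l j z) * csum (fun i => Cconj (e (n - j + i)%nat z *
      ((Cconj z - z) ^ i / INR (fact i)))) (S j)); [ring|].
    rewrite <- csum_scal. apply csum_ext. intros i _.
    rewrite Cconj_mult, im_pow_conj. ring.
  - rewrite (csum_triangle (fun j i => sgn j * ptower l j z * Cconj (e (n - j + i)%nat z) * im_pow i z)).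
    apply csum_ext. intros m Hm.
    rewrite !Cconj_mult, ptower_conj.
    rewrite <- (ptower_taylor l n m z (Cconj z) Hl) by lia. unfold taylor.
    rewrite <- csum_scal. apply csum_ext. intros i Hi.
    replace (n - (m + i) + i)%nat with (n - m)%nat by lia.
    replace (Cconj (sgn m)) with (sgn m).
    + unfold im_pow, Cdiv.
      transitivity ((sgn (m + i) * (z - Cconj z) ^ i) * (ptower l (m + i) z * Cconj (e (n - m)%nat z)
        * / INR (fact i))); [ring|].
      rewrite sgn_add_pow. replace (- (z - Cconj z)) with (Cconj z - z) by ring. ring.
    + unfold sgn. rewrite Cpow_conj. f_equal. apply C_pair_intro; simpl; ring.
Qed.

Lemma egrowth_im_pow (c : R) (i : nat) : (0 < c)%R -> egrowth c (im_pow i).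
Proof.
  intros Hc.
  assert (H1 : forall d, (0 < d)%R -> egrowth d (fun z => z - Cconj z)).
  { intros d Hd. exists (2 / d)%R, 0%R. split.
    { apply Rmult_le_pos; [lra|]. left. now apply Rinv_0_lt_compat. }
    intros z Hz _. unfold upper in Hz.
    replace (z - Cconj z) with (RtoC (2 * Im z) * Ci)
      by (destruct z; apply C_pair_intro; unfold Re, Im; simpl; ring).
    rewrite Cmod_mult, Cmod_Ci, Cmod_R, Rabs_pos_eq by lra.
    assert (K := exp_ineq1_le (d * Im z)).
    replace (2 * Im z * 1)%R with (2 / d * (d * Im z))%R by (field; lra).
    apply Rmult_le_compat_l; [|lra].
    apply Rmult_le_pos; [lra|]. left. now apply Rinv_0_lt_compat. }
  assert (H2 : forall i d, (0 < d)%R -> egrowth d (fun z => (z - Cconj z) ^ i)).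
  { clear i. induction i as [|i IH]; intros d Hd.
    - apply (egrowth_le 0); [lra|]. exact (egrowth_const 1).
    - apply egrowth_ext with (fun z => (z - Cconj z) * (z - Cconj z) ^ i).
      + intros z _. now rewrite Cpow_S.
      + replace d with (d / 2 + d / 2)%R by field. apply egrowth_mult; [apply H1|apply IH]; lra. }
  replace c with (c + 0)%R by ring.
  apply (egrowth_mult c 0 (fun z => (z - Cconj z) ^ i) (fun _ => / INR (fact i))); auto.
  apply egrowth_const.
Qed.

Lemma egrowth_nonhol_part (n : nat) (e : nat -> C -> C) :
  (forall i, (i <= n)%nat -> egrowth 0 (e i)) -> egrowth 1 (nonhol_part n e 0).
Proof.
  intros He. apply egrowth_ext with
    (fun z => csum (fun l => Cconj (e l z) * im_pow l z) (S n)).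
  - intros z _. unfold nonhol_part, taylor. rewrite csum_conj, Nat.sub_0_r.
    apply csum_ext. intros i _. now rewrite Cconj_mult, im_pow_conj.
  - assert (G : forall N, (N <= S n)%nat -> egrowth 1 (fun z => csum (fun l => Cconj (e l z) * im_pow l z) N)).
    { induction N as [|N IH]; intros HN.
      - apply (egrowth_le 0); [lra|]. exact (egrowth_const 0).
      - apply (egrowth_plus 1 (fun z => csum (fun l => Cconj (e l z) * im_pow l z) N)); [apply IH; lia|].
        replace 1%R with (0 + 1)%R by ring. apply egrowth_mult.
        + apply egrowth_conj, He. lia.
        + apply egrowth_im_pow; lra. }
    apply G. lia.
Qed.

Lemma nonhol_part_periodic (n : nat) (e : nat -> C -> C) (r : nat) :
  (forall i, (i <= n)%nat -> periodic (e i)) -> periodic (nonhol_part n e r).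
Proof.
  intros He z Hz. unfold nonhol_part, taylor. f_equal.
  replace (Cconj (z + 1) - (z + 1)) with (Cconj z - z)
    by (apply C_pair_intro; unfold Re, Im; simpl; ring).
  apply csum_ext. intros i Hi. rewrite (He (r + i)%nat) by (auto; lia). reflexivity.
Qed.

Lemma CpowZ_of_nat (a : C) (m : nat) : CpowZ a (Z.of_nat m) = a ^ m.
Proof. destruct m; simpl; auto. now rewrite SuccNat2Pos.id_succ. Qed.

Lemma CpowZ_neg_of_nat (a : C) (m : nat) : CpowZ a (- Z.of_nat m) = / a ^ m.
Proof.
  destruct m; simpl; [field|]. now rewrite SuccNat2Pos.id_succ.
Qed.

Section Maass.

Variables (k : nat) (M : C -> C).
Hypothesis Hk : (1 <= k)%nat.
Hypothesis HM : Hcusp k M.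

Let n : nat := (2 * k - 2)%nat.
Let g : C -> C := xi (2 - 2 * Z.of_nat k) M.

Lemma weight_eq : (2 - 2 * Z.of_nat k)%Z = (- Z.of_nat n)%Z.
Proof. unfold n. lia. Qed.

(** The plain r-th derivative in z, written through [Dop_iter] so that its top index is a scalar
    multiple of D^(2k-1) M by definition. *)
Definition maass_derivative (r : nat) (z : C) : C := (2 * RtoC PI * Ci) ^ r * Dop_iter r M z.

Lemma two_pi_i_neq_0 : 2 * RtoC PI * Ci <> 0.
Proof.
  assert (H := PI_RGT_0). intros E. apply (f_equal snd) in E. simpl in E. lra.
Qed.

Lemma smooth_M : smooth_upper M.
Proof. apply HM. Qed.

Lemma smooth_Dop_iter (r : nat) : smooth_upper (Dop_iter r M).
Proof.
  induction r as [|r IH]; [exact smooth_M|].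
  apply (smooth_scal (/ (2 * RtoC PI * Ci)) (partial_z (Dop_iter r M))).
  now apply smooth_partial_z.
Qed.

Lemma smooth_maass_derivative (r : nat) : smooth_upper (maass_derivative r).
Proof. apply smooth_scal, smooth_Dop_iter. Qed.

Lemma partial_z_maass_derivative (r : nat) (z : C) : upper z ->
  partial_z (maass_derivative r) z = maass_derivative (S r) z.
Proof.
  intros Hz.
  refine (eq_trans (wd_partial_z (maass_derivative r) z _ _
    (wd_scal ((2 * RtoC PI * Ci) ^ r) _ _ _ _ (smooth_wd _ z (smooth_Dop_iter r) Hz))) _).
  unfold maass_derivative. change (Dop_iter (S r) M z) with
    (/ (2 * RtoC PI * Ci) * partial_z (Dop_iter r M) z).
  assert (H := two_pi_i_neq_0). rewrite Cpow_S.
  replace (2 * RtoC PI * Ci * (2 * RtoC PI * Ci) ^ r * (/ (2 * RtoC PI * Ci) * partial_z (Dop_iter r M) z))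
    with ((2 * RtoC PI * Ci * / (2 * RtoC PI * Ci)) * ((2 * RtoC PI * Ci) ^ r * partial_z (Dop_iter r M) z)) by ring.
  rewrite Cinv_r by auto. ring.
Qed.

Lemma wd_maass_derivative (r : nat) (z : C) : upper z ->
  wd (maass_derivative r) z (maass_derivative (S r) z) (partial_zbar (maass_derivative r) z).
Proof.
  intros Hz. rewrite <- partial_z_maass_derivative by auto.
  apply smooth_wd; auto. apply smooth_maass_derivative.
Qed.

(** Solving the definition of xi gives (i/2) y^n conj g for the zbar-derivative of M; this is the
    constant left after writing y^n through (2iy)^n / n!. *)
Definition shadow_const : C := Ci * RtoC (INR (fact n)) / (2 * (2 * Ci) ^ n).

Lemma two_i_pow_neq_0 : (2 * Ci) ^ n <> 0.
Proof. apply Cpow_nz. intros E. apply (f_equal snd) in E. simpl in E. lra. Qed.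

Lemma xi_unfold (z : C) : upper z ->
  g z = 2 * Ci * / (RtoC (Im z) ^ n) * Cconj (partial_zbar M z).
Proof.
  intros Hz. unfold g, xi. rewrite weight_eq, powerRZ_neg', <- pow_powerRZ.
  rewrite RtoC_inv, RtoC_pow; [reflexivity|].
  apply pow_nonzero. apply Rgt_not_eq. exact Hz.
Qed.

Lemma Im_pow_neq_0 (z : C) : upper z -> RtoC (Im z) ^ n <> 0.
Proof.
  intros Hz. apply Cpow_nz. intros E. apply RtoC_inj in E. unfold upper in Hz. lra.
Qed.

Lemma partial_zbar_maass (z : C) : upper z ->
  partial_zbar M z = shadow_const * (Cconj (g z) * im_pow n z).
Proof.
  intros Hz. rewrite (xi_unfold z Hz). rewrite !Cconj_mult, Cconj_invol.
  assert (H1 := Im_pow_neq_0 z Hz). assert (H2 := two_i_pow_neq_0).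
  replace (Cconj (/ RtoC (Im z) ^ n)) with (/ RtoC (Im z) ^ n).
  2: { rewrite <- RtoC_pow, <- RtoC_inv, Cconj_RtoC; [reflexivity|].
       apply pow_nonzero. unfold upper in Hz. lra. }
  unfold shadow_const, im_pow.
  replace (z - Cconj z) with (2 * Ci * RtoC (Im z))
    by (destruct z; apply C_pair_intro; unfold Re, Im; simpl; ring).
  rewrite (Cpow_mult_l (2 * Ci) (RtoC (Im z)) n).
  replace (Cconj 2 * Cconj Ci) with (- (2 * Ci)) by (apply C_pair_intro; simpl; ring).
  transitivity (- (Ci * Ci) * partial_zbar M z).
  { rewrite Ci_sqr. ring. }
  assert (H3 := INR_fact_neq n).
  revert H1 H2. generalize ((2 * Ci) ^ n) (RtoC (Im z) ^ n). intros p q H1 H2. field. repeat split; auto.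
Qed.

Lemma cusp_facts : cusp_form (2 * Z.of_nat k) g.
Proof. apply HM. Qed.

Lemma hol_g : hol g (partial_x g).
Proof.
  intros z Hz. destruct (proj1 cusp_facts z Hz) as [a Ha]. apply is_derive_wd in Ha.
  assert (K : forall b : C, wd g z b 0 -> wd g z (partial_x g z) 0).
  { intros b Hb. replace (partial_x g z) with b; auto.
    rewrite (wd_partial_x _ _ _ _ Hb). ring. }
  exact (K a Ha).
Qed.

Lemma Im_pow_inv_continuous (z : C) : upper z -> continuous (fun z => / (RtoC (Im z) ^ n)) z.
Proof.
  intros Hz.
  assert (E : forall w, / (2 * Ci) * (w - Cconj w) = RtoC (Im w)).
  { intros w. replace (w - Cconj w) with (2 * Ci * RtoC (Im w))
      by (destruct w; apply C_pair_intro; unfold Re, Im; simpl; ring).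
    field. intros E. apply (f_equal snd) in E. simpl in E. lra. }
  assert (Hne : (/ (2 * Ci) * (z - Cconj z)) ^ n <> 0) by (rewrite E; now apply Im_pow_neq_0).
  assert (K := wd_comp (fun w => / w) (fun z => (/ (2 * Ci) * (z - Cconj z)) ^ n) z _ _ _ _
    (wd_inv_id _ Hne) (wd_pow_gen _ _ _ _ n (wd_scal (/ (2 * Ci)) _ _ _ _ (wd_z_minus_conj z)))).
  apply wd_eq with (g := fun z => / (RtoC (Im z) ^ n)) (4 := eq_refl) (3 := eq_refl) in K.
  - exact (wd_continuous _ _ _ _ K).
  - intros w. cbv beta. now rewrite E.
Qed.

(** Continuity of g' is inherited from M: g is y^(-n) times the conjugate of a smooth function, and
    differentiation in x leaves y^(-n) alone. *)
Lemma cont_partial_x_g : cont_upper (partial_x g).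
Proof.
  assert (Hs := smooth_partial_zbar M smooth_M).
  assert (E : forall z, upper z ->
    2 * Ci * / (RtoC (Im z) ^ n) * Cconj (partial_x (partial_zbar M) z) = partial_x g z).
  { intros z Hz. symmetry.
    apply (pd_unique (fun t => g (t, Im z)) (Re z)).
    destruct (proj1 (pd_ex_partials _ z) (smooth_ex_partials _ z Hs Hz)) as [K _].
    apply pd_eq with (1 := pd_scal (2 * Ci * / (RtoC (Im z) ^ n)) _ _ _
      (wd_path Cconj _ _ _ _ _ (wd_conj _ _ _ _ (wd_id _)) K)).
    - intros t. now rewrite xi_unfold.
    - replace (Cconj 0) with (RtoC 0) by (apply C_pair_intro; simpl; ring).
      replace (Cconj 1) with (RtoC 1) by (apply C_pair_intro; simpl; ring). ring. }
  intros z Hz. apply continuous_ext_upper with (1 := E); auto.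
  exact (continuous_Cmult _ _ _ _
    (continuous_Cmult _ _ _ _ (continuous_Cconst _ (2 * Ci) z) (Im_pow_inv_continuous z Hz))
    (continuous_Cconj _ _ _ (smooth_cont _ (smooth_partial_x _ Hs) z Hz))).
Qed.

Lemma modular_periodic (w : Z) (f : C -> C) : modular w f -> periodic f.
Proof.
  intros H z Hz. rewrite <- (H (Mat2 1 1 0 1) eq_refl z Hz).
  unfold slash, moebius, autfactor, ZtoC. simpl.
  replace (0 * z + 1) with (RtoC 1) by ring.
  replace ((1 * z + 1) / 1) with (z + 1) by field.
  replace (CpowZ 1 (- w)) with (RtoC 1); [ring|].
  destruct (- w)%Z; simpl; rewrite ?Cpow_1_l; auto. field.
Qed.

Lemma periodic_g : periodic g.
Proof. exact (modular_periodic _ _ (proj1 (proj2 cusp_facts))). Qed.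

Lemma egrowth_g : egrowth 0 g.
Proof.
  destruct (proj2 (proj2 cusp_facts) 1%R Rlt_0_1) as [A H].
  exists 1%R, A. split; [lra|]. intros z Hz HA. rewrite Rmult_0_l, exp_0.
  left. rewrite Rmult_1_l. now apply H.
Qed.

Lemma nice_g : nice g.
Proof.
  split; [|split].
  - exists (partial_x g). split; [exact hol_g|exact cont_partial_x_g].
  - exact periodic_g.
  - intros z Hz. apply Cmod_eq_0, Rle_antisym; [|apply Cmod_ge_0].
    apply le_epsilon. intros eps He. rewrite Rplus_0_l.
    (* The mean does not depend on the point, so it may be computed at a height where |g| < eps. *)
    destruct (proj2 (proj2 cusp_facts) eps He) as [A H].
    set (w := (0, Rmax 1 A)%R : C).
    assert (Hw : upper w) by (unfold upper, w; simpl; generalize (Rmax_l 1 A); lra).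
    rewrite (mean_constant g (partial_x g) z w); auto using hol_g, cont_partial_x_g, periodic_g.
    apply Rle_trans with (eps * (1 - 0))%R; [|lra].
    apply (isI_bound_const (fun s => g (w + RtoC s))); [lra| |].
    + intros s _. left. assert (E : Im (w + RtoC s) = Rmax 1 A) by (simpl; ring).
      apply H; rewrite E; [generalize (Rmax_l 1 A); lra|apply Rmax_r].
    + apply mean_correct; auto. exact (hol_cont _ _ hol_g).
Qed.

(** The two Wirtinger derivatives commute and conj g is antiholomorphic, so each z-derivative lowers
    only the divided power of 2iy. After n + 1 of them nothing is left: the top derivative is
    holomorphic. *)
Lemma partial_zbar_maass_derivative (r : nat) (z : C) : upper z ->
  partial_zbar (maass_derivative r) z =
  if Nat.leb r n then shadow_const * (Cconj (g z) * im_pow (n - r) z) else 0.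
Proof.
  revert z. induction r as [|r IH]; intros z Hz.
  - simpl. rewrite Nat.sub_0_r, <- partial_zbar_maass by auto.
    assert (K := wd_maass_derivative 0 z Hz).
    symmetry. apply (wd_partial_zbar M z (maass_derivative 1 z)).
    apply wd_eq with (1 := K); auto. intros w. unfold maass_derivative. simpl. ring.
  - assert (E : partial_zbar (maass_derivative (S r)) z =
      partial_z (partial_zbar (maass_derivative r)) z).
    { rewrite <- partial_z_zbar_comm by (auto; apply smooth_maass_derivative).
      apply (wd_partial_zbar _ z (partial_z (partial_z (maass_derivative r)) z)).
      apply wd_ext_upper with (3 := smooth_wd _ z
        (smooth_partial_z _ (smooth_maass_derivative r)) Hz); auto.
      intros w Hw. now apply partial_z_maass_derivative. }
    rewrite E. clear E.
    assert (Hgz := wd_conj _ _ _ _ (hol_g z Hz)).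
    replace (Cconj 0) with (RtoC 0) in Hgz by (apply C_pair_intro; simpl; ring).
    destruct (Nat.leb_spec r n) as [Hr|Hr].
    + destruct (Nat.leb_spec (S r) n) as [Hr'|Hr'].
      * destruct (wd_im_pow_S (n - S r) z) as [b Hb].
        assert (K := wd_scal shadow_const _ _ _ _ (wd_mult _ _ _ _ _ _ _ Hgz Hb)).
        refine (eq_trans (wd_partial_z _ _ _ _ (wd_ext_upper _ _ _ _ _ _ Hz K)) _).
        -- intros w Hw. rewrite IH by auto.
           replace (n - r)%nat with (S (n - S r)) by lia. reflexivity.
        -- ring.
      * assert (K := wd_scal shadow_const _ _ _ _ Hgz).
        refine (eq_trans (wd_partial_z _ _ _ _ (wd_ext_upper _ _ _ _ _ _ Hz K)) _).
        -- intros w Hw. rewrite IH by auto.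
           replace (n - r)%nat with O by lia. unfold im_pow. simpl. field.
        -- ring.
    + destruct (Nat.leb_spec (S r) n) as [Hr'|Hr']; [lia|].
      refine (wd_partial_z _ _ _ 0 (wd_ext_upper _ _ _ _ _ _ Hz (wd_const 0 z))).
      intros w Hw. now rewrite IH by auto.
Qed.

Lemma periodic_maass : periodic M.
Proof. exact (modular_periodic _ _ (proj1 (proj2 (proj1 HM)))). Qed.

Lemma egrowth_maass : exists c, (1 <= c)%R /\ egrowth c M.
Proof.
  destruct (proj2 (proj2 (proj2 (proj1 HM)))) as (A & B & c & H).
  exists (Rmax 1 c). split; [apply Rmax_l|].
  apply (egrowth_le c); [apply Rmax_r|]. exists (Rabs B), A. split; [apply Rabs_pos|].
  intros z Hz HA. apply Rle_trans with (1 := H z Hz HA).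
  apply Rmult_le_compat_r; [left; apply exp_pos|apply Rle_abs].
Qed.

(* Towers of derivatives, shifted by one so that index 0 is a primitive. *)
Definition tower (N : nat) (c : R) (phi : nat -> C -> C) : Prop :=
  (0 <= c)%R /\ (forall i, (i < N)%nat -> hol (phi i) (phi (S i))) /\
  (forall i, (i <= N)%nat -> cont_upper (phi i)) /\ periodic (phi O) /\
  (forall i, (i <= N)%nat -> egrowth c (phi i)).

(** Integrating g n + 1 times gives the Eichler integral [psi 1]; one more integration provides the
    extra primitive for the regularised integral. *)
Lemma shadow_tower : exists psi, tower (S (S n)) 0 psi /\
  (forall i, (i <= S (S n))%nat -> periodic (psi i)) /\
  psi (S (S n)) = g.
Proof.
  destruct (periodic_primitives g 0 (S (S n)) (Rle_refl 0) nice_g egrowth_g) as (psi & E & H1 & H2).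
  exists psi. split; [|split]; auto.
  - split; [lra|]. split; [auto|]. split; [|split].
    + intros i Hi. destruct (H2 i Hi) as [((df & Hf & _) & _) _]. exact (hol_cont _ _ Hf).
    + apply (H2 O). lia.
    + intros i Hi. apply H2; auto.
  - intros i Hi. apply H2; auto.
Qed.

(** Subtracting [shadow_const] times the explicit part cancels the zbar-derivatives at every order.
    The holomorphic rest has the mean a0, which is removed before taking a periodic primitive. *)
Lemma holomorphic_tower (e : nat -> C -> C) :
  (forall i, (i <= n)%nat -> hol (e i) (e (S i))) -> e (S n) = g ->
  (forall i, (i <= n)%nat -> periodic (e i)) -> (forall i, (i <= n)%nat -> egrowth 0 (e i)) ->
  exists (c : R) (phi : nat -> C -> C) (a0 : C), tower (S (S n)) c phi /\
    (forall i z, upper z -> maass_derivative i z =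
       phi (S i) z + shadow_const * nonhol_part n e i z + (if Nat.eqb i 0 then a0 else 0)).
Proof.
  intros He Hg Hp Hgr.
  set (f := fun r z => maass_derivative r z - shadow_const * nonhol_part n e r z).
  assert (Hf : forall r, hol (f r) (f (S r))).
  { intros r z Hz. destruct (le_lt_dec r n) as [Hr|Hr].
    - apply wd_eq with (1 := wd_minus _ _ _ _ _ _ _ (wd_maass_derivative r z Hz)
        (wd_scal shadow_const _ _ _ _ (wd_nonhol_part n e r z He Hz Hr))); auto.
      rewrite partial_zbar_maass_derivative by auto.
      destruct (Nat.leb_spec r n); [|lia]. rewrite Hg. ring.
    - assert (K := wd_maass_derivative r z Hz).
      rewrite partial_zbar_maass_derivative in K by auto.
      destruct (Nat.leb_spec r n); [lia|].
      apply wd_eq with (1 := K); auto; intros; unfold f;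
      rewrite nonhol_part_zero by lia; ring. }
  assert (Hcont : forall r, cont_upper (f r)) by (intros r; exact (hol_cont _ _ (Hf r))).
  destruct egrowth_maass as (c & Hc & HcM).
  assert (Hf0 : egrowth c (f O)).
  { apply egrowth_ext with (fun z => M z + (- shadow_const) * nonhol_part n e 0 z).
    - intros z _. unfold f, maass_derivative. simpl. ring.
    - apply (egrowth_plus c M); auto. apply (egrowth_le 1); auto.
      replace 1%R with (0 + 1)%R by ring. apply (egrowth_mult 0 1 (fun _ => - shadow_const)).
      + apply egrowth_const.
      + now apply egrowth_nonhol_part. }
  assert (Hfr : forall r, egrowth c (f r)).
  { induction r as [|r IH]; auto.
    apply (egrowth_derivative c (f r) (f (S r)) (f (S (S r)))); auto. lra. }
  assert (Hper : periodic (f O)).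
  { intros z Hz. unfold f, maass_derivative. simpl. rewrite periodic_maass by auto.
    rewrite nonhol_part_periodic; auto. }
  assert (Hi : upper Ci) by (unfold upper; simpl; lra).
  set (a0 := mean (f O) Ci).
  assert (Hn := sub_mean_nice (f O) (f 1%nat) Ci (Hf O) (Hcont 1%nat) Hper Hi).
  assert (Hge := egrowth_sub_const c (f O) a0 ltac:(lra) Hf0).
  destruct (periodic_primitive _ c ltac:(lra) Hn Hge) as (F & HF & (_ & HFp & _) & HFg).
  (* Index 0 is the primitive, index 1 is M+ - a0, and from index 2 on the constant has been
     differentiated away; hence a0 enters the splitting only at i = 0. *)
  exists c, (fun i => match i with O => F | S O => fun z => f O z - a0 | S (S i) => f (S i) end), a0.
  split; [split; [|split; [|split; [|split]]]|].
  - lra.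
  - intros [|[|i]] _; [exact HF| |apply Hf].
    intros z Hz. apply wd_eq with (1 := wd_minus _ _ _ _ _ _ _ (Hf O z Hz) (wd_const a0 z));
    intros; auto; ring.
  - intros [|[|i]] _; [exact (hol_cont _ _ HF)| |apply Hcont].
    intros z Hz. exact (continuous_Cminus _ _ _ _ (Hcont O z Hz) (continuous_Cconst _ a0 z)).
  - exact HFp.
  - intros [|[|i]] _; auto.
  - intros [|i] z Hz; simpl; unfold f; ring.
Qed.

End Maass.

(** * Matrices and quadratic forms *)

Definition mat2_mul (s g : mat2) : mat2 :=
  Mat2 (m11 s * m11 g + m12 s * m21 g) (m11 s * m12 g + m12 s * m22 g)
       (m21 s * m11 g + m22 s * m21 g) (m21 s * m12 g + m22 s * m22 g).

Lemma SL2Z_inv (s : mat2) : SL2Z s -> SL2Z (mat2_inv s).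
Proof. unfold SL2Z, mat2_inv. simpl. lia. Qed.

Lemma SL2Z_mul (s g : mat2) : SL2Z s -> SL2Z g -> SL2Z (mat2_mul s g).
Proof.
  unfold SL2Z, mat2_mul. simpl. intros Hs Hg.
  transitivity ((m11 s * m22 s - m12 s * m21 s) * (m11 g * m22 g - m12 g * m21 g))%Z; [ring|].
  now rewrite Hs, Hg.
Qed.

Lemma ZtoC_plus (a b : Z) : ZtoC (a + b) = ZtoC a + ZtoC b.
Proof. unfold ZtoC. now rewrite plus_IZR, RtoC_plus. Qed.
Lemma ZtoC_mult (a b : Z) : ZtoC (a * b) = ZtoC a * ZtoC b.
Proof. unfold ZtoC. now rewrite mult_IZR, RtoC_mult. Qed.
Lemma ZtoC_opp (a : Z) : ZtoC (- a) = - ZtoC a.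
Proof. unfold ZtoC. now rewrite opp_IZR, RtoC_opp. Qed.

Lemma autfactor_mul (s g : mat2) (z : C) : SL2Z g -> upper z ->
  autfactor (mat2_mul s g) z = autfactor s (moebius g z) * autfactor g z.
Proof.
  intros Hg Hz. assert (H := autfactor_neq_0 g z Hg Hz).
  unfold moebius. unfold autfactor at 1 2. unfold mat2_mul; simpl.
  rewrite !ZtoC_plus, !ZtoC_mult.
  transitivity (ZtoC (m21 s) * (ZtoC (m11 g) * z + ZtoC (m12 g)) * (autfactor g z * / autfactor g z)
    + ZtoC (m22 s) * autfactor g z); [rewrite Cinv_r by auto; unfold autfactor|unfold Cdiv]; ring.
Qed.

Lemma moebius_mul (s g : mat2) (z : C) : SL2Z s -> SL2Z g -> upper z ->
  moebius s (moebius g z) = moebius (mat2_mul s g) z.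
Proof.
  intros Hs Hg Hz. assert (H := autfactor_neq_0 g z Hg Hz).
  assert (H' := autfactor_neq_0 s _ Hs (moebius_upper g z Hg Hz)).
  unfold moebius at 3. rewrite autfactor_mul by auto. unfold moebius at 1.
  unfold mat2_mul; simpl. rewrite !ZtoC_plus, !ZtoC_mult.
  transitivity ((ZtoC (m11 s) * (moebius g z * autfactor g z) + ZtoC (m12 s) * autfactor g z)
    / (autfactor s (moebius g z) * autfactor g z)).
  - field. auto.
  - f_equal. unfold moebius.
    replace ((ZtoC (m11 g) * z + ZtoC (m12 g)) / autfactor g z * autfactor g z)
      with (ZtoC (m11 g) * z + ZtoC (m12 g)) by (field; auto).
    unfold autfactor. ring.
Qed.

Definition mat2_one : mat2 := Mat2 1 0 0 1.

Lemma mat2_mul_inv (s : mat2) : SL2Z s -> mat2_mul s (mat2_inv s) = mat2_one.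
Proof.
  unfold SL2Z, mat2_mul, mat2_inv, mat2_one. simpl. intros H. f_equal; lia.
Qed.

Lemma moebius_one (z : C) : moebius mat2_one z = z.
Proof. unfold moebius, autfactor, mat2_one, ZtoC. simpl. field. Qed.

Lemma moebius_inv (s : mat2) (z : C) : SL2Z s -> upper z ->
  moebius s (moebius (mat2_inv s) z) = z.
Proof.
  intros Hs Hz. rewrite moebius_mul, mat2_mul_inv by auto using SL2Z_inv. apply moebius_one.
Qed.

Lemma autfactor_inv (s : mat2) (z : C) : SL2Z s -> upper z ->
  autfactor s (moebius (mat2_inv s) z) * autfactor (mat2_inv s) z = 1.
Proof.
  intros Hs Hz. rewrite <- autfactor_mul, mat2_mul_inv by auto using SL2Z_inv.
  unfold autfactor, mat2_one, ZtoC. simpl. ring.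
Qed.

Definition qact (Q : bqf) (s : mat2) : bqf :=
  BQF (qa Q * m11 s * m11 s + qb Q * m11 s * m21 s + qc Q * m21 s * m21 s)
      (2 * qa Q * m11 s * m12 s + qb Q * (m11 s * m22 s + m12 s * m21 s) + 2 * qc Q * m21 s * m22 s)
      (qa Q * m12 s * m12 s + qb Q * m12 s * m22 s + qc Q * m22 s * m22 s).

Lemma qact_mul (Q : bqf) (s g : mat2) : qact (qact Q s) g = qact Q (mat2_mul s g).
Proof. unfold qact, mat2_mul. cbn [qa qb qc m11 m12 m21 m22]. f_equal; ring. Qed.

Lemma qeval_qact (Q : bqf) (s : mat2) (z : C) : SL2Z s -> upper z ->
  qeval (qact Q s) z = autfactor s z ^ 2 * qeval Q (moebius s z).
Proof.
  intros Hs Hz. assert (H := autfactor_neq_0 s z Hs Hz).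
  set (N := ZtoC (m11 s) * z + ZtoC (m12 s)).
  transitivity (ZtoC (qa Q) * (N * N) + ZtoC (qb Q) * (N * autfactor s z)
    + ZtoC (qc Q) * (autfactor s z * autfactor s z)).
  - unfold qeval, qact, N, autfactor. cbn [qa qb qc m11 m12 m21 m22]. repeat rewrite ?ZtoC_plus, ?ZtoC_mult.
    change (ZtoC 2) with (RtoC 2). ring.
  - unfold qeval, moebius. fold N. simpl. field. auto.
Qed.

(** The zero leading coefficient is dropped for a = 0, so that [length] sees the smaller degree at a
    cusp on the geodesic. *)
Definition qpoly (Q : bqf) : list R :=
  if Z.eq_dec (qa Q) 0 then IZR (qc Q) :: IZR (qb Q) :: nil
  else IZR (qc Q) :: IZR (qb Q) :: IZR (qa Q) :: nil.

Definition cycle_poly (k : nat) (Q : bqf) : list R := ppow (qpoly Q) (k - 1).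

Lemma peval_cycle_poly (k : nat) (Q : bqf) (z : C) :
  peval (cycle_poly k Q) z = qeval Q z ^ (k - 1).
Proof.
  unfold cycle_poly. rewrite peval_ppow. f_equal.
  unfold qpoly, qeval, ZtoC. destruct Z.eq_dec as [->|_]; simpl; ring.
Qed.

Lemma length_cycle_poly (k : nat) (Q : bqf) : (length (cycle_poly k Q) <= S (2 * k - 2))%nat.
Proof.
  assert (H := length_ppow (qpoly Q) 2 (k - 1)). unfold cycle_poly.
  assert (length (qpoly Q) <= 3)%nat by (unfold qpoly; destruct Z.eq_dec; simpl; lia).
  lia.
Qed.

(** For a = 0 the polynomial Q^(k-1) has degree at most k - 1 < 2k - 2 unless k = 1, when it is 1.
    The value is thus independent of Q, which makes the a0 terms at the two endpoints equal. *)
Lemma cycle_poly_top (k : nat) (Q : bqf) (z : C) : (1 <= k)%nat -> qa Q = 0%Z ->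
  ptower (cycle_poly k Q) (2 * k - 2) z = if Nat.eqb k 1 then 1 else 0.
Proof.
  intros Hk Ha. destruct (Nat.eqb_spec k 1) as [->|Hn].
  - unfold ptower, cycle_poly. simpl. ring.
  - apply ptower_zero.
    assert (H := length_ppow (qpoly Q) 1 (k - 1)). unfold cycle_poly.
    assert (length (qpoly Q) <= 2)%nat by (unfold qpoly; destruct Z.eq_dec; [simpl; lia|contradiction]).
    lia.
Qed.

Lemma peval_cycle_poly_qact (k : nat) (Q : bqf) (s : mat2) (z : C) : (1 <= k)%nat ->
  SL2Z s -> upper z ->
  peval (cycle_poly k (qact Q s)) z =
  autfactor s z ^ (2 * k - 2) * peval (cycle_poly k Q) (moebius s z).
Proof.
  intros Hk Hs Hz. rewrite !peval_cycle_poly, qeval_qact, Cpow_mult_l by auto.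
  replace (2 * k - 2)%nat with (2 * (k - 1))%nat by lia. now rewrite Cpow_mult_r.
Qed.

(** * Stabilisers of the cusps *)

(** The quotient s^(-1) s' fixes i-infinity: the first columns of s and s' are proportional, so its
    lower left entry vanishes and its diagonal is 1, 1 or -1, -1. *)
Lemma same_cusp_translation (s s' : mat2) (a : cusp) : maps_ioo_to s a -> maps_ioo_to s' a ->
  exists g, SL2Z g /\ mat2_mul s g = s' /\ m21 g = 0%Z /\ m11 g = m22 g /\ (m11 g * m11 g = 1)%Z.
Proof.
  intros [Hs Ha] [Hs' Ha'].
  exists (mat2_mul (mat2_inv s) s').
  assert (H21 : m21 (mat2_mul (mat2_inv s) s') = 0%Z).
  { unfold mat2_mul, mat2_inv; simpl.
    assert (E : (m11 s * m21 s' = m21 s * m11 s')%Z).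
    { destruct a as [|x].
      - rewrite Ha, Ha'. ring.
      - destruct Ha as [Hn Hx], Ha' as [Hn' Hx']. apply eq_IZR. rewrite !mult_IZR.
        assert (IZR (m21 s) <> 0)%R by (intros E; apply Hn; now apply eq_IZR in E).
        assert (IZR (m21 s') <> 0)%R by (intros E; apply Hn'; now apply eq_IZR in E).
        replace (IZR (m11 s)) with (x * IZR (m21 s))%R by (rewrite <- Hx; field; auto).
        replace (IZR (m11 s')) with (x * IZR (m21 s'))%R by (rewrite <- Hx'; field; auto).
        ring. }
    lia. }
  assert (Hg : SL2Z (mat2_mul (mat2_inv s) s')) by (apply SL2Z_mul; auto using SL2Z_inv).
  split; [auto|]. split; [|split; [auto|]].
  - destruct s as [p q r t], s' as [p' q' r' t']. unfold SL2Z, mat2_mul, mat2_inv in *. simpl in *.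
    f_equal.
    + transitivity (p' * (p * t - q * r))%Z; [ring|rewrite Hs; ring].
    + transitivity (q' * (p * t - q * r))%Z; [ring|rewrite Hs; ring].
    + transitivity (r' * (p * t - q * r))%Z; [ring|rewrite Hs; ring].
    + transitivity (t' * (p * t - q * r))%Z; [ring|rewrite Hs; ring].
  - unfold SL2Z in Hg. rewrite H21 in Hg.
    set (e := m11 (mat2_mul (mat2_inv s) s')) in *. set (e' := m22 (mat2_mul (mat2_inv s) s')) in *.
    assert (Hee : (e * e' = 1)%Z) by lia.
    destruct (Z.mul_eq_1 _ _ Hee) as [E|E]; rewrite E in *; lia.
Qed.

Lemma periodic_Z (f : C -> C) (z : C) (m : Z) : periodic f -> upper z -> f (z + ZtoC m) = f z.
Proof.
  intros Hf Hz.
  assert (N : forall j : nat, forall z, upper z -> f (z + ZtoC (Z.of_nat j)) = f z).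
  { induction j as [|j IH]; intros w Hw.
    - f_equal. unfold ZtoC. simpl. ring.
    - rewrite Nat2Z.inj_succ. unfold Z.succ. rewrite ZtoC_plus.
      replace (w + (ZtoC (Z.of_nat j) + ZtoC 1)) with ((w + ZtoC (Z.of_nat j)) + 1)
        by (unfold ZtoC; ring).
      rewrite Hf by (apply upper_add_R; auto). auto. }
  destruct (Z_le_gt_dec 0 m) as [Hm|Hm].
  - rewrite <- (Z2Nat.id m Hm). auto.
  - rewrite <- (N (Z.to_nat (- m)) (z + ZtoC m)) by (apply upper_add_R; auto).
    f_equal. rewrite Z2Nat.id by lia. rewrite ZtoC_opp. ring.
Qed.

(** The leading coefficient of the transformed form is m21^2 Q(x, 1), where x is the image of
    i-infinity, and x is a root. *)
Lemma qact_endpoint (Q : bqf) (s : mat2) (x : R) : m21 s <> 0%Z ->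
  (IZR (m11 s) / IZR (m21 s) = x)%R ->
  (IZR (qa Q) * x * x + IZR (qb Q) * x + IZR (qc Q) = 0)%R -> qa (qact Q s) = 0%Z.
Proof.
  intros Hn Hx Hq. apply eq_IZR. unfold qact. cbn [qa qb qc m11 m12 m21 m22]. rewrite !plus_IZR, !mult_IZR.
  assert (IZR (m21 s) <> 0)%R by (intros E; apply Hn; now apply eq_IZR in E).
  replace (IZR (m11 s)) with (x * IZR (m21 s))%R by (rewrite <- Hx; field; auto).
  transitivity ((IZR (qa Q) * x * x + IZR (qb Q) * x + IZR (qc Q)) * (IZR (m21 s) * IZR (m21 s)))%R;
  [ring|rewrite Hq; ring].
Qed.

Lemma geodesic_endpoint (Q : bqf) (s : mat2) (a : cusp) : (0 < qdisc Q)%Z ->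
  a = geodesic_start Q \/ a = geodesic_end Q -> maps_ioo_to s a -> qa (qact Q s) = 0%Z.
Proof.
  intros HD Ha [_ Hs]. unfold geodesic_start, geodesic_end in Ha.
  destruct (Z.eq_dec (qa Q) 0) as [E|E].
  - assert (Hb : IZR (qb Q) <> 0%R).
    { intros Eb. apply eq_IZR in Eb. unfold qdisc in HD. rewrite E, Eb in HD. lia. }
    destruct Ha as [-> | ->].
    + destruct Hs as [Hn Hx]. apply (qact_endpoint Q s _ Hn Hx). rewrite E. field. auto.
    + unfold qact. cbn [qa qb qc m11 m12 m21 m22]. rewrite E, Hs. ring.
  - assert (Hd : (sqrt (IZR (qdisc Q)) * sqrt (IZR (qdisc Q)) = IZR (qdisc Q))%R).
    { apply sqrt_sqrt. apply IZR_le. lia. }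
    assert (Hd' : IZR (qdisc Q) = (IZR (qb Q) * IZR (qb Q) - 4 * IZR (qa Q) * IZR (qc Q))%R).
    { unfold qdisc. now rewrite minus_IZR, !mult_IZR. }
    assert (Hn0 : IZR (qa Q) <> 0%R) by (intros E'; apply E; now apply eq_IZR in E').
    rewrite Hd' in Hd. rewrite Hd' in Ha.
    set (d := sqrt (IZR (qb Q) * IZR (qb Q) - 4 * IZR (qa Q) * IZR (qc Q))) in *.
    destruct Ha as [-> | ->]; destruct Hs as [Hn Hx]; apply (qact_endpoint Q s _ Hn Hx).
    + transitivity ((d * d - (IZR (qb Q) * IZR (qb Q) - 4 * IZR (qa Q) * IZR (qc Q))) / (4 * IZR (qa Q)))%R.
      * field. auto.
      * rewrite Hd. field. auto.
    + transitivity ((d * d - (IZR (qb Q) * IZR (qb Q) - 4 * IZR (qa Q) * IZR (qc Q))) / (4 * IZR (qa Q)))%R.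
      * field. auto.
      * rewrite Hd. field. auto.
Qed.

(** * Automorphs of a form *)

Lemma positive_pell_unique (D t u t' u' : Z) :
  smallest_pell D t u -> smallest_pell D t' u' -> t = t' /\ u = u'.
Proof.
  intros [H H1] [H' H1']. destruct (H1 _ _ H'). destruct (H1' _ _ H). lia.
Qed.

Lemma is_gQ_unique (Q : bqf) (g g' : mat2) : is_gQ Q g -> is_gQ Q g' -> g = g'.
Proof.
  intros (t & u & H & ->) (t' & u' & H' & ->).
  destruct (positive_pell_unique _ _ _ _ _ H H') as [-> ->]. reflexivity.
Qed.

Lemma content_neq_0 (Q : bqf) : (0 < qdisc Q)%Z -> content Q <> 0%Z.
Proof.
  intros H E. unfold content in E. apply Z.gcd_eq_0 in E. destruct E as [E Ec].
  apply Z.gcd_eq_0 in E. destruct E as [Ea Eb]. unfold qdisc in H. rewrite Ea, Eb in H. lia.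
Qed.

Lemma primitive_part_scale (Q : bqf) : (0 < qdisc Q)%Z ->
  let P := primitive_part Q in
  (qa Q = content Q * qa P /\ qb Q = content Q * qb P /\ qc Q = content Q * qc P)%Z.
Proof.
  intros H P. assert (Hc := content_neq_0 Q H).
  assert (D1 : (content Q | Z.gcd (qa Q) (qb Q))%Z) by apply Z.gcd_divide_l.
  assert (D2 : (content Q | qc Q)%Z) by apply Z.gcd_divide_r.
  assert (D3 : (content Q | qa Q)%Z) by (apply Z.divide_trans with (1 := D1), Z.gcd_divide_l).
  assert (D4 : (content Q | qb Q)%Z) by (apply Z.divide_trans with (1 := D1), Z.gcd_divide_r).
  unfold P, primitive_part; simpl.
  repeat split; apply Z_div_exact_full_2; auto; apply Z.mod_divide; auto.
Qed.

Lemma qact_automorph (m a b c x y u : Z) : (x - y = b * u)%Z -> (x * y + a * c * u * u = 1)%Z ->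
  qact (BQF (m * a) (m * b) (m * c)) (Mat2 x (c * u) (- (a * u)) y) = BQF (m * a) (m * b) (m * c).
Proof.
  intros Hxy H. assert (E : x = (y + b * u)%Z) by lia. subst x.
  unfold qact. cbn [qa qb qc m11 m12 m21 m22]. f_equal.
  - transitivity (m * a * ((y + b * u) * y + a * c * u * u))%Z; [ring|rewrite H; ring].
  - transitivity (m * b * ((y + b * u) * y + a * c * u * u))%Z; [ring|rewrite H; ring].
  - transitivity (m * c * ((y + b * u) * y + a * c * u * u))%Z; [ring|rewrite H; ring].
Qed.

Lemma is_gQ_spec (Q : bqf) (g : mat2) : (0 < qdisc Q)%Z -> is_gQ Q g ->
  SL2Z g /\ qact Q g = Q.
Proof.
  intros HQ (t & u & [(Ht & Hu & Hp) _] & ->).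
  destruct (primitive_part_scale Q HQ) as (Ea & Eb & Ec).
  set (P := primitive_part Q) in *. unfold qdisc in Hp.
  set (a := qa P) in *. set (b := qb P) in *. set (c := qc P) in *.
  (* The product (t + bu)(t - bu) = 4 - 4acu^2 is even and its two factors have the same parity. *)
  assert (Hpar : ((t + b * u) mod 2 = 0)%Z).
  { assert (E : ((t + b * u) * (t - b * u) = 2 * (2 - 2 * a * c * u * u))%Z) by lia.
    assert (E2 : ((t - b * u) mod 2 = (t + b * u) mod 2)%Z).
    { replace (t - b * u)%Z with (t + b * u + (- (b * u)) * 2)%Z by ring. apply Z_mod_plus_full. }
    assert (E3 : (((t + b * u) * (t - b * u)) mod 2 = 0)%Z).
    { rewrite E, Z.mul_comm. apply Z_mod_mult. }
    rewrite Zmult_mod, E2 in E3.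
    destruct (Z_mod_lt (t + b * u) 2 ltac:(lia)).
    assert (Hc : ((t + b * u) mod 2 = 0 \/ (t + b * u) mod 2 = 1)%Z) by lia.
    destruct Hc as [Hc|Hc]; auto. rewrite Hc in E3. discriminate. }
  set (x := ((t + b * u) / 2)%Z). set (y := ((t - b * u) / 2)%Z).
  assert (Hx : (t + b * u = 2 * x)%Z) by (apply Z_div_exact_full_2; auto; lia).
  assert (Hy : (t - b * u = 2 * y)%Z).
  { apply Z_div_exact_full_2; [lia|].
    replace (t - b * u)%Z with (t + b * u + (- (b * u)) * 2)%Z by ring. now rewrite Z_mod_plus_full. }
  assert (Hxy : (x - y = b * u)%Z) by lia.
  assert (Hdet : (x * y + a * c * u * u = 1)%Z) by nia.
  split.
  - unfold SL2Z; simpl. lia.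
  - assert (EQ : Q = BQF (content Q * a) (content Q * b) (content Q * c)).
    { rewrite <- Ea, <- Eb, <- Ec. now destruct Q. }
    transitivity (qact (BQF (content Q * a) (content Q * b) (content Q * c))
      (Mat2 x (c * u) (- (a * u)) y)); [now rewrite <- EQ|].
    rewrite EQ at 4. now apply qact_automorph.
Qed.

Lemma geodesic_moebius (Q : bqf) (g : mat2) (z : C) : SL2Z g -> qact Q g = Q ->
  geodesic Q z -> geodesic Q (moebius g z).
Proof.
  intros Hg HQ [Hz H]. split; [now apply moebius_upper|].
  assert (HA := autfactor_neq_0 g z Hg Hz).
  set (A := autfactor g z) in *. set (N := ZtoC (m11 g) * z + ZtoC (m12 g)).
  (* The Hermitian form attached to Q vanishes at z. *)
  set (B := fun z w : C => ZtoC (qa Q) * (z * w) + ZtoC (qb Q) * (/ 2 * (z + w)) + ZtoC (qc Q)).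
  assert (HB : forall z, B z (Cconj z) =
    RtoC (IZR (qa Q) * Cmod z ^ 2 + IZR (qb Q) * Re z + IZR (qc Q))).
  { intros w. rewrite !RtoC_plus, !RtoC_mult. unfold B.
    replace (/ 2 * (w + Cconj w)) with (RtoC (Re w)).
    - rewrite RtoC_pow, <- RtoC_pow, Cmod2_conj. reflexivity.
    - replace (w + Cconj w) with (2 * RtoC (Re w))
        by (destruct w; apply C_pair_intro; unfold Re, Im; simpl; ring).
      field. }
  assert (E : B z (Cconj z) = A * Cconj A * B (moebius g z) (Cconj (moebius g z))).
  { assert (HcA : Cconj A <> 0).
    { apply Cmod_gt_0. rewrite Cmod_conj. now apply Cmod_gt_0. }
    assert (Em : moebius g z * A = N) by (unfold moebius; fold A N; field; auto).
    assert (Ecm : Cconj (moebius g z) * Cconj A = Cconj N) by (rewrite <- Cconj_mult; now rewrite Em).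
    transitivity (ZtoC (qa Q) * (N * Cconj N) + ZtoC (qb Q) * (/ 2 * (N * Cconj A + Cconj N * A))
      + ZtoC (qc Q) * (A * Cconj A)).
    - unfold B. rewrite <- HQ at 1 2 3. unfold qact; cbn [qa qb qc m11 m12 m21 m22].
      unfold N, A, autfactor. rewrite !Cconj_plus, !Cconj_mult.
      assert (Hr : forall m, Cconj (ZtoC m) = ZtoC m) by (intros; apply Cconj_RtoC).
      rewrite !Hr. repeat rewrite ?ZtoC_plus, ?ZtoC_mult.
      change (ZtoC 2) with (RtoC 2). field.
    - rewrite <- Ecm, <- Em. unfold B. ring. }
  rewrite !HB, H in E.
  assert (E' : Cconj A * A <> 0).
  { apply Cmult_neq_0; auto. apply Cmod_gt_0. rewrite Cmod_conj. now apply Cmod_gt_0. }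
  assert (G : forall v : C, RtoC 0 = A * Cconj A * v -> v = 0).
  { intros v Hv. transitivity (/ (Cconj A * A) * (A * Cconj A * v)).
    - field. split; auto. apply Cmod_gt_0. rewrite Cmod_conj. now apply Cmod_gt_0.
    - rewrite <- Hv. ring. }
  now apply RtoC_inj, G.
Qed.

Lemma geodesic_semicircle (Q : bqf) (z : C) : (0 < qdisc Q)%Z -> qa Q <> 0%Z -> geodesic Q z ->
  exists th, (0 < th < PI)%R /\ semicircle Q th = z.
Proof.
  intros HD Ha [Hz H]. destruct z as [x y]. unfold upper in Hz. simpl in Hz, H.
  assert (Hn0 : IZR (qa Q) <> 0%R) by (intros E'; apply Ha; now apply eq_IZR in E').

  assert (Hd' : IZR (qdisc Q) = (IZR (qb Q) * IZR (qb Q) - 4 * IZR (qa Q) * IZR (qc Q))%R).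
  { unfold qdisc. now rewrite minus_IZR, !mult_IZR. }
  assert (HD' : (0 < IZR (qdisc Q))%R) by (apply IZR_lt; lia).
  set (r := (sqrt (IZR (qdisc Q)) / (2 * Rabs (IZR (qa Q))))%R).
  assert (Hr : (0 < r)%R).
  { apply Rdiv_lt_0_compat; [now apply sqrt_lt_R0|]. assert (K := Rabs_pos_lt _ Hn0). lra. }
  assert (Hr2 : (r * r = IZR (qdisc Q) / (4 * (IZR (qa Q) * IZR (qa Q))))%R).
  { unfold r. assert (K := Rabs_pos_lt _ Hn0).
    transitivity ((sqrt (IZR (qdisc Q)) * sqrt (IZR (qdisc Q))) / (4 * (Rabs (IZR (qa Q)) * Rabs (IZR (qa Q)))))%R.
    - field. lra.
    - rewrite sqrt_sqrt by lra. rewrite <- Rabs_mult, Rabs_pos_eq; [reflexivity|nra]. }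
  set (v := (x + IZR (qb Q) / (2 * IZR (qa Q)))%R).
  assert (Hc : (v * v + y * y = r * r)%R).
  { rewrite Hr2, Hd'. unfold v.
    assert (E : (IZR (qa Q) * (x * x + y * y) + IZR (qb Q) * x + IZR (qc Q) = 0)%R).
    { revert H. replace (Cmod (x, y) * (Cmod (x, y) * 1))%R with (x * x + y * y)%R; auto.
      transitivity (Cmod (x, y) ^ 2)%R; [rewrite Cmod2_alt; unfold Re, Im; simpl; ring|simpl; ring]. }
    replace (IZR (qc Q)) with (- (IZR (qa Q) * (x * x + y * y) + IZR (qb Q) * x))%R by lra.
    field. auto. }
  (* Strict because y > 0 in v^2 + y^2 = r^2; this keeps the angle arccos (v/r) inside (0, PI). *)
  assert (Hv : (-1 < v / r < 1)%R).
  { assert (E : ((v / r) * (v / r) < 1)%R).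
    { replace ((v / r) * (v / r))%R with (v * v / (r * r))%R by (field; lra).
      apply Rlt_div_l; nra. }
    nra. }
  exists (acos (v / r)). split; [now apply acos_bound_lt|].
  unfold semicircle. fold r. rewrite cos_acos, sin_acos by lra.
  assert (Es : sqrt (1 - (v / r)²) = (y / r)%R).
  { replace (1 - (v / r)²)%R with ((y / r) * (y / r))%R.
    - apply sqrt_square. apply Rmult_le_pos; [lra|]. left. now apply Rinv_0_lt_compat.
    - unfold Rsqr. replace (y / r * (y / r))%R with ((y * y) / (r * r))%R by (field; lra).
      replace (y * y)%R with (r * r - v * v)%R by lra. field. lra. }
  rewrite Es. apply C_pair_intro; simpl; unfold v; field; lra || auto.
Qed.

(** * Cycle integrals *)

(** The additional primitive [psi 0] meets only the (n+1)-st derivative of the polynomial, which is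
    zero. *)
Lemma bracket_shift_top (n : nat) (psi : nat -> C -> C) (l : list R) (z : C) : (length l <= S n)%nat ->
  bracket (S n) psi (ptower l) z = bracket n (fun i => psi (S i)) (ptower l) z.
Proof.
  intros Hl. unfold bracket. rewrite csum_S, (ptower_zero l (S n)) by auto.
  rewrite Cmult_0_r, Cplus_0_r. apply csum_ext. intros i Hi.
  now replace (S n - i)%nat with (S (n - i)) by lia.
Qed.

Lemma bracket_scal (n : nat) (c : C) (f p : nat -> C -> C) (z : C) :
  bracket n (fun i z => c * f i z) p z = c * bracket n f p z.
Proof. unfold bracket. rewrite <- csum_scal. apply csum_ext. intros; ring. Qed.

Lemma tower_scal (N : nat) (c : R) (a : C) (phi : nat -> C -> C) : tower N c phi ->
  tower N c (fun i z => a * phi i z).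
Proof.
  intros (H0 & H1 & H2 & H3 & H4). split; [auto|]. split; [|split; [|split]].
  - intros i Hi z Hz. apply wd_eq with (1 := wd_scal a _ _ _ _ (H1 i Hi z Hz)); auto. ring.
  - intros i Hi z Hz. exact (continuous_Cmult _ _ _ _ (continuous_Cconst _ a z) (H2 i Hi z Hz)).
  - intros z Hz. now rewrite H3.
  - intros i Hi. replace c with (0 + c)%R by ring.
    apply (egrowth_mult 0 c (fun _ => a)); auto. apply egrowth_const.
Qed.

Lemma tower_reg_integral (n : nat) (c : R) (phi : nat -> C -> C) (l : list R) (f : C -> C) (z : C) :
  tower (S (S n)) c phi -> upper z -> (length l <= S n)%nat ->
  (forall z, upper z -> f z = phi (S (S n)) z * peval l z) ->
  is_reg_integral_ioo f z (- bracket n (fun i => phi (S i)) (ptower l) z).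
Proof.
  intros (H0 & H1 & H2 & H3 & H4) Hz Hl Hf. rewrite <- bracket_shift_top by auto.
  refine (reg_integral_value z (S (S n)) phi c Hz H1 H2 H3 _ _ (S n) l f _ _ Hf); try lia.
  intros i Hi. apply egrowth_sgrowth; auto.
Qed.

Section CycleIntegrals.

Variables (k : nat) (M : C -> C).
Hypothesis Hk : (1 <= k)%nat.
Hypothesis HM : Hcusp k M.

Let n : nat := (2 * k - 2)%nat.
Let g : C -> C := xi (2 - 2 * Z.of_nat k) M.
Let Mr : nat -> C -> C := maass_derivative M.

Variables (psi phi : nat -> C -> C) (c : R) (a0 : C).
Hypothesis Hpsi : tower (S (S n)) 0 psi.
Hypothesis Hpsi1 : periodic (psi 1%nat).
Hypothesis Hpsig : psi (S (S n)) = g.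
Hypothesis Hphi : tower (S (S n)) c phi.
Hypothesis Hsplit : forall i z, upper z -> Mr i z =
  phi (S i) z + shadow_const k * nonhol_part n (fun i => psi (S i)) i z + (if Nat.eqb i 0 then a0 else 0).

Let E (i : nat) : C -> C := psi (S i).
Let F (i : nat) : C -> C := phi (S i).
Let kap : C := shadow_const k.

Definition dop_const : C := / (2 * RtoC PI * Ci) ^ S n.

Lemma Dop_iter_eq (z : C) : Dop_iter (2 * k - 1) M z = dop_const * Mr (S n) z.
Proof.
  replace (2 * k - 1)%nat with (S n) by (unfold n; lia).
  unfold dop_const, Mr, maass_derivative.
  assert (H := Cpow_nz _ (S n) two_pi_i_neq_0).
  rewrite Cmult_assoc, Cinv_l by auto. ring.
Qed.

Definition eichler (Q : bqf) (z : C) : C := bracket n E (ptower (cycle_poly k Q)) z.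
Definition eichler_hol (Q : bqf) (z : C) : C := bracket n F (ptower (cycle_poly k Q)) z.
Definition eichler_maass (Q : bqf) (z : C) : C := bracket n Mr (ptower (cycle_poly k Q)) z.

Lemma ptower_top_zero (Q : bqf) (z : C) : ptower (cycle_poly k Q) (S n) z = 0.
Proof. apply ptower_zero, length_cycle_poly. Qed.

Lemma Mr_top (z : C) : upper z -> Mr (S n) z = phi (S (S n)) z.
Proof.
  intros Hz. rewrite Hsplit by auto. rewrite nonhol_part_zero by lia. simpl. ring.
Qed.

Lemma wd_eichler (Q : bqf) (z : C) : upper z ->
  wd (eichler Q) z (g z * peval (cycle_poly k Q) z) 0.
Proof.
  intros Hz. destruct Hpsi as (_ & H1 & _).
  assert (K := wd_bracket n E (ptower (cycle_poly k Q)) (fun _ => 0) z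
    ltac:(intros i Hi; apply H1; auto; lia)
    (fun i _ => wd_ptower _ i z) (ptower_top_zero Q z)).
  apply wd_eq with (1 := K); auto.
  - unfold E. now rewrite Hpsig.
  - apply csum_zero. intros; ring.
Qed.

Lemma wd_eichler_hol (Q : bqf) (z : C) : upper z ->
  wd (eichler_hol Q) z (Mr (S n) z * peval (cycle_poly k Q) z) 0.
Proof.
  intros Hz. destruct Hphi as (_ & H1 & _).
  assert (K := wd_bracket n F (ptower (cycle_poly k Q)) (fun _ => 0) z
    ltac:(intros i Hi; apply H1; auto; lia)
    (fun i _ => wd_ptower _ i z) (ptower_top_zero Q z)).
  apply wd_eq with (1 := K); auto.
  - unfold F. now rewrite Mr_top.
  - apply csum_zero. intros; ring.
Qed.

Lemma wdz_Mr (i : nat) (z : C) : upper z -> wdz (Mr i) z (Mr (S i) z).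
Proof. intros Hz. eexists. exact (wd_maass_derivative k M HM i z Hz). Qed.

Lemma wdz_eichler_maass (Q : bqf) (z : C) : upper z ->
  wdz (eichler_maass Q) z (Mr (S n) z * peval (cycle_poly k Q) z).
Proof.
  intros Hz. eexists.
  exact (wd_bracket n Mr (ptower (cycle_poly k Q)) (fun i => partial_zbar (Mr i) z) z
    (fun i _ => wd_maass_derivative k M HM i z Hz)
    (fun i _ => wd_ptower _ i z) (ptower_top_zero Q z)).
Qed.

Lemma wdz_ptower (l : list R) (i : nat) (z : C) : wdz (ptower l i) z (ptower l (S i) z).
Proof. eexists. apply wd_ptower. Qed.

Lemma M_modular (s : mat2) (z : C) : SL2Z s -> upper z ->
  Mr O z = autfactor s z ^ n * Mr O (moebius s z).
Proof.
  intros Hs Hz. assert (K := proj1 (proj2 (proj1 HM)) s Hs z Hz).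
  unfold slash in K. rewrite (weight_eq k Hk), Z.opp_involutive, CpowZ_of_nat in K.
  unfold Mr, maass_derivative. simpl. fold n in K. rewrite !Cmult_1_l. now rewrite K.
Qed.

Lemma eichler_maass_moebius (Q : bqf) (s : mat2) (z : C) : SL2Z s -> upper z ->
  eichler_maass (qact Q s) z = eichler_maass Q (moebius s z).
Proof.
  intros Hs Hz. unfold eichler_maass.
  apply bracket_moebius; auto; intros; auto using wdz_Mr, wdz_ptower, M_modular.
  apply peval_cycle_poly_qact; auto.
Qed.

(* Differentiating the invariance of the bracket gives the modularity of the
   (2k-1)-st derivative (Bol's identity). *)
Lemma Mr_slash (Q : bqf) (s : mat2) (z : C) : SL2Z s -> upper z ->
  Mr (S n) (moebius s z) * peval (cycle_poly k Q) (moebius s z) * (/ autfactor s z * / autfactor s z) =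
  Mr (S n) z * peval (cycle_poly k (qact Q s)) z.
Proof.
  intros Hs Hz.
  destruct (wdz_eichler_maass (qact Q s) z Hz) as [b Hb].
  destruct (wdz_eichler_maass Q _ (moebius_upper s z Hs Hz)) as [b' Hb'].
  assert (K := wd_comp _ _ _ _ _ _ _ Hb' (wd_moebius s z Hs Hz)).
  assert (K' := wd_ext_upper _ _ _ _ _ (fun w Hw => eq_sym (eichler_maass_moebius Q s w Hs Hw)) Hz K).
  destruct (wd_unique _ _ _ _ _ _ K' Hb) as [<- _].
  replace (Cconj 0) with (RtoC 0) by (apply C_pair_intro; simpl; ring). ring.
Qed.

Lemma g_slash (Q : bqf) (s : mat2) (z : C) : SL2Z s -> upper z ->
  g (moebius s z) * peval (cycle_poly k Q) (moebius s z) * (/ autfactor s z * / autfactor s z) =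
  g z * peval (cycle_poly k (qact Q s)) z.
Proof.
  intros Hs Hz. assert (HA := autfactor_neq_0 s z Hs Hz).
  assert (K := proj1 (proj2 (cusp_facts k M HM)) s Hs z Hz).
  unfold slash in K. replace (- (2 * Z.of_nat k))%Z with (- Z.of_nat (S (S n)))%Z in K by (unfold n; lia).
  rewrite CpowZ_neg_of_nat in K. fold g in K. rewrite <- K.
  rewrite peval_cycle_poly_qact by auto. fold n. rewrite !Cpow_S.
  assert (HA' := Cpow_nz _ n HA). field. auto.
Qed.

Lemma reg_integral_g (Q : bqf) (s : mat2) (z : C) : SL2Z s -> upper z ->
  is_reg_integral_ioo (slash 2 (fun z => g z * Cpow (qeval Q z) (k - 1)) s) z (- eichler (qact Q s) z).
Proof.
  intros Hs Hz. apply (tower_reg_integral n 0 psi); auto.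
  - apply length_cycle_poly.
  - intros w Hw. rewrite Hpsig, <- g_slash, peval_cycle_poly by auto. unfold slash. simpl.
    assert (HA := autfactor_neq_0 s w Hs Hw). field. auto.
Qed.

Lemma reg_integral_Dop (Q : bqf) (s : mat2) (z : C) : SL2Z s -> upper z ->
  is_reg_integral_ioo (slash 2 (fun z => Dop_iter (2 * k - 1) M z * Cpow (qeval Q z) (k - 1)) s) z
    (- (dop_const * eichler_hol (qact Q s) z)).
Proof.
  intros Hs Hz. unfold eichler_hol. rewrite <- bracket_scal.
  apply (tower_reg_integral n c (fun i z => dop_const * phi i z)); auto.
  - now apply tower_scal.
  - apply length_cycle_poly.
  - intros w Hw. rewrite <- Mr_top, <- Cmult_assoc, <- Mr_slash by auto.
    unfold slash. rewrite Dop_iter_eq, peval_cycle_poly. simpl.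
    assert (HA := autfactor_neq_0 s w Hs Hw). field. auto.
Qed.

(** Linearity of the bracket in its first argument. The constant a0 occurs at derivative index 0
    only, where it is paired with the n-th derivative of the polynomial. *)
Lemma eichler_split (Q : bqf) (z : C) : upper z ->
  eichler_maass Q z = eichler_hol Q z + kap * Cconj (eichler Q z)
    + a0 * sgn n * ptower (cycle_poly k Q) n z.
Proof.
  intros Hz. unfold eichler, eichler_hol, eichler_maass.
  rewrite <- bracket_nonhol_part by apply length_cycle_poly.
  unfold bracket.
  transitivity (csum (fun i => (sgn i * F (n - i)%nat z * ptower (cycle_poly k Q) i z
    + kap * (sgn i * nonhol_part n E (n - i) z * ptower (cycle_poly k Q) i z))
    + (if Nat.eqb (n - i) 0 then a0 else 0) * sgn i * ptower (cycle_poly k Q) i z) (S n)).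
  - apply csum_ext. intros i Hi. rewrite Hsplit by auto. unfold F, kap, E. ring.
  - rewrite !csum_plus, csum_scal. f_equal.
    rewrite csum_S, csum_zero.
    + rewrite Nat.sub_diag. simpl. ring.
    + intros i Hi. destruct (Nat.eqb_spec (n - i) 0); [lia|ring].
Qed.

(** ** Square discriminants *)

(** For the Eichler integral only periodicity is available. This suffices: two matrices for one cusp
    differ by a translation up to sign, and the sign disappears because n is even. *)
Lemma eichler_same_cusp (Q : bqf) (s s' : mat2) (a : cusp) (z : C) :
  maps_ioo_to s a -> maps_ioo_to s' a -> upper z ->
  eichler (qact Q s) (moebius (mat2_inv s) z) = eichler (qact Q s') (moebius (mat2_inv s') z).
Proof.
  intros Ha Ha' Hz.
  destruct (same_cusp_translation s s' a Ha Ha') as (t & Ht & E1 & H21 & H11 & Hsq).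
  assert (Hs := proj1 Ha). assert (Hs' := proj1 Ha').
  set (w := moebius (mat2_inv s') z).
  assert (Hw : upper w) by (apply moebius_upper; auto using SL2Z_inv).
  assert (Ew : moebius (mat2_inv s) z = moebius t w).
  { rewrite <- (moebius_inv s' z) at 1 by auto. fold w. rewrite <- E1.
    rewrite <- moebius_mul by auto.
    assert (Hs'' := SL2Z_inv s Hs). set (v := moebius t w).
    assert (Hv : upper v) by (apply moebius_upper; auto).
    rewrite moebius_mul by auto.
    replace (mat2_mul (mat2_inv s) s) with mat2_one; [apply moebius_one|].
    unfold mat2_mul, mat2_inv, mat2_one, SL2Z in *. simpl. f_equal; lia. }
  rewrite Ew, <- E1, <- qact_mul. symmetry. unfold eichler.
  destruct Hpsi as (_ & Hh & _).
  apply bracket_moebius; auto; intros; auto using wdz_ptower.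
  1,2: eexists; apply Hh; auto; lia.
  - assert (Em : autfactor t z0 = ZtoC (m22 t)) by (unfold autfactor; rewrite H21; unfold ZtoC; ring).
    assert (E2 : ZtoC (m22 t) * ZtoC (m22 t) = 1).
    { rewrite <- ZtoC_mult. now rewrite <- H11, Hsq. }
    assert (Hn : ZtoC (m22 t) <> 0).
    { intros E0. rewrite E0, Cmult_0_l in E2. apply (f_equal fst) in E2. simpl in E2. lra. }
    rewrite Em. replace (ZtoC (m22 t) ^ n) with (RtoC 1).
    + rewrite Cmult_1_l.
      replace (moebius t z0) with (z0 + ZtoC (m12 t * m22 t)).
      * symmetry. now apply periodic_Z.
      * unfold moebius. rewrite Em, H11, ZtoC_mult.
        transitivity ((ZtoC (m22 t) * z0 + ZtoC (m12 t) * (ZtoC (m22 t) * ZtoC (m22 t))) / ZtoC (m22 t)).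
        -- field. auto.
        -- rewrite E2. field. auto.
    + unfold n. replace (2 * k - 2)%nat with (2 * (k - 1))%nat by lia.
      rewrite Cpow_mult_r. simpl (_ ^ 2). rewrite Cmult_1_r, E2. now rewrite Cpow_1_l.
  - apply peval_cycle_poly_qact; auto.
Qed.

(** Whatever the cusp, pulling back from i-infinity gives a primitive of the same function g
    Q^(k-1), so the values at two cusps differ by a constant in z. *)
Lemma wd_eichler_inv (Q : bqf) (s : mat2) (z : C) : SL2Z s -> upper z ->
  wd (fun z => eichler (qact Q s) (moebius (mat2_inv s) z)) z (g z * peval (cycle_poly k Q) z) 0.
Proof.
  intros Hs Hz. assert (Hs' := SL2Z_inv s Hs).
  assert (Hw := moebius_upper _ z Hs' Hz).
  assert (K := wd_comp _ _ _ _ _ _ _ (wd_eichler (qact Q s) _ Hw) (wd_moebius _ z Hs' Hz)).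
  apply wd_eq with (1 := K); auto.
  - rewrite <- g_slash, moebius_inv by auto.
    assert (E1 := autfactor_inv s z Hs Hz).
    assert (H1 := autfactor_neq_0 _ _ Hs Hw). assert (H2 := autfactor_neq_0 _ _ Hs' Hz).
    transitivity (g z * peval (cycle_poly k Q) z * (/ (autfactor s (moebius (mat2_inv s) z) * autfactor (mat2_inv s) z)
      * / (autfactor s (moebius (mat2_inv s) z) * autfactor (mat2_inv s) z))); [field; auto|].
    rewrite E1. field.
  - replace (Cconj (/ autfactor (mat2_inv s) z * / autfactor (mat2_inv s) z)) with
      (Cconj (/ autfactor (mat2_inv s) z * / autfactor (mat2_inv s) z)) by reflexivity. ring.
Qed.

(** At each endpoint the value for D^(2k-1) M is the invariant bracket, the conjugate of the value
    for g and an a0 term. The first and the last are the same at both endpoints, so only the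
    conjugates remain in the difference. *)
Lemma square_cycle_integrals (Q : bqf) : (0 < qdisc Q)%Z -> exists I J : C,
  is_reg_integral (fun z => g z * Cpow (qeval Q z) (k - 1)) (geodesic_start Q) (geodesic_end Q) I /\
  is_reg_integral (fun z => Dop_iter (2 * k - 1) M z * Cpow (qeval Q z) (k - 1))
    (geodesic_start Q) (geodesic_end Q) J /\
  J = - (dop_const * kap * Cconj I).
Proof.
  intros HD. set (a := geodesic_start Q). set (b := geodesic_end Q).
  (* The common n-th derivative of the polynomials at the two endpoints. *)
  set (lead := if Nat.eqb k 1 then RtoC 1 else RtoC 0).
  assert (Val : forall x, x = a \/ x = b -> exists V : C -> C,
    (forall z, upper z -> is_reg_integral_to (fun z => g z * Cpow (qeval Q z) (k - 1)) z x (V z)) /\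
    (forall z, upper z -> is_reg_integral_to
       (fun z => Dop_iter (2 * k - 1) M z * Cpow (qeval Q z) (k - 1)) z x
       (- (dop_const * (eichler_maass Q z + kap * Cconj (V z) - a0 * sgn n * lead)))) /\
    ((exists s, maps_ioo_to s x) -> forall z, upper z -> wd V z (- (g z * peval (cycle_poly k Q) z)) 0)).
  { intros x Hx. destruct (classic (exists s, maps_ioo_to s x)) as [[s Hs]|Hno].
    - exists (fun z => - eichler (qact Q s) (moebius (mat2_inv s) z)).
      assert (Hs0 := proj1 Hs). split; [|split].
      + intros z Hz s' Hs'. rewrite (eichler_same_cusp Q s s' x) by auto.
        apply reg_integral_g; [apply Hs'|]. apply moebius_upper; auto. apply SL2Z_inv, Hs'.
      + intros z Hz s' Hs'. assert (Hs'0 := proj1 Hs').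
        assert (Hw : upper (moebius (mat2_inv s') z)) by (apply moebius_upper; auto using SL2Z_inv).
        rewrite (eichler_same_cusp Q s s' x) by auto.
        assert (Es := eichler_split (qact Q s') _ Hw).
        rewrite eichler_maass_moebius, moebius_inv in Es by auto.
        assert (Hq : qa (qact Q s') = 0%Z) by (apply (geodesic_endpoint Q s' x); auto).
        unfold n in Es at 2. rewrite (cycle_poly_top k _ _ Hk Hq) in Es.
        replace (- (dop_const * (eichler_maass Q z + kap * Cconj (- eichler (qact Q s') (moebius (mat2_inv s') z))
          - a0 * sgn n * lead))) with (- (dop_const * eichler_hol (qact Q s') (moebius (mat2_inv s') z))).
        * apply reg_integral_Dop; auto.
        * rewrite Es, Cconj_opp. unfold lead. ring.
      + intros _ z Hz. apply wd_eq with (1 := wd_opp _ _ _ _ (wd_eichler_inv Q s z Hs0 Hz)); auto. ring.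
    (* If no matrix sends i-infinity to x, [is_reg_integral_to] holds vacuously, and 0 is a default
       value. *)
    - exists (fun _ => 0). split; [|split].
      + intros z Hz s Hs. exfalso. eauto.
      + intros z Hz s Hs. exfalso. eauto.
      + intros H. contradiction. }
  destruct (Val a (or_introl eq_refl)) as (Va & A1 & A2 & A3).
  destruct (Val b (or_intror eq_refl)) as (Vb & B1 & B2 & B3).
  assert (Hi : upper Ci) by (unfold upper; simpl; lra).
  destruct (classic ((exists s, maps_ioo_to s a) /\ (exists s, maps_ioo_to s b))) as [[Ha Hb]|Hno].
  - assert (D : forall z, upper z -> wd (fun z => Vb z - Va z) z 0 0).
    { intros z Hz. apply wd_eq with (1 := wd_minus _ _ _ _ _ _ _ (B3 Hb z Hz) (A3 Ha z Hz)); auto; ring. }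
    set (I := Vb Ci - Va Ci).
    assert (EI : forall z, upper z -> I = Vb z - Va z).
    { intros z Hz. exact (wd_zero_constant upper _ convex_upper D Ci z Hi Hz). }
    exists I, (- (dop_const * kap * Cconj I)). split; [|split; [|reflexivity]].
    + intros z Hz. exists (Va z), (Vb z). auto.
    (* [eichler_maass Q z] and the a0 term occur at both ends and cancel. *)
    + intros z Hz. eexists. eexists. split; [exact (A2 z Hz)|]. split; [exact (B2 z Hz)|].
      rewrite (EI z Hz), Cconj_minus. ring.
  (* Here one endpoint has no matrix; its value is free and is chosen equal to the other one, so
     that both integrals are 0. *)
  - exists 0, 0. split; [|split].
    3: { replace (Cconj 0) with (RtoC 0) by (apply C_pair_intro; simpl; ring). ring. }
    + intros z Hz. destruct (classic (exists s, maps_ioo_to s a)) as [Ha|Ha].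
      * exists (Va z), (Va z). split; [auto|]. split; [|ring].
        intros s Hs. exfalso. apply Hno. eauto.
      * exists (Vb z), (Vb z). split; [|split; [auto|ring]].
        intros s Hs. exfalso. eauto.
    + intros z Hz. destruct (classic (exists s, maps_ioo_to s a)) as [Ha|Ha].
      * eexists. eexists. split; [exact (A2 z Hz)|]. split; [|symmetry; apply Cplus_opp_r].
        intros s Hs. exfalso. apply Hno. eauto.
      * eexists. eexists. split; [|split; [exact (B2 z Hz)|symmetry; apply Cplus_opp_r]].
        intros s Hs. exfalso. eauto.
Qed.

(** ** Non-square discriminants *)

Lemma pd_semicircle (Q : bqf) (t : R) :
  let r := (sqrt (IZR (qdisc Q)) / (2 * Rabs (IZR (qa Q))))%R in
  pd (semicircle Q) t (- r * sin t, r * cos t)%R.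
Proof.
  intros r. split; unfold semicircle, Re, Im; simpl; fold r; auto_derive; auto; ring.
Qed.

Lemma semicircle_upper (Q : bqf) (t : R) : (0 < qdisc Q)%Z -> qa Q <> 0%Z -> (0 < t < PI)%R ->
  upper (semicircle Q t).
Proof.
  intros HD Ha Ht. unfold upper, semicircle. simpl.
  apply Rmult_lt_0_compat; [|apply sin_gt_0; lra].
  assert (Hn0 : IZR (qa Q) <> 0%R) by (intros E'; apply Ha; now apply eq_IZR in E').
  assert (K := Rabs_pos_lt _ Hn0).
  apply Rdiv_lt_0_compat; [|lra]. apply sqrt_lt_R0. apply IZR_lt. lia.
Qed.

(** The fundamental theorem along the angle. Either angle may be the larger one, so no orientation
    has to be discussed. *)
Lemma arc_integral (Q : bqf) (f h dh : C -> C) (z z' : C) : (0 < qdisc Q)%Z -> qa Q <> 0%Z ->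
  hol h dh -> cont_upper dh -> (forall z, upper z -> f z = dh z) ->
  geodesic Q z -> geodesic Q z' -> is_arc_integral f Q z z' (h z' - h z).
Proof.
  intros HD Ha Hh Hdh Hf Hz Hz'.
  destruct (geodesic_semicircle Q z HD Ha Hz) as (th & Hth & E1).
  destruct (geodesic_semicircle Q z' HD Ha Hz') as (th' & Hth' & E1').
  exists th, th'. repeat split; try apply Hth; try apply Hth'; auto.
  rewrite <- E1, <- E1'.
  set (r := (sqrt (IZR (qdisc Q)) / (2 * Rabs (IZR (qa Q))))%R).
  set (v := fun t : R => (- r * sin t, r * cos t)%R : C).
  assert (Hr : forall t, (Rmin th th' <= t <= Rmax th th')%R -> (0 < t < PI)%R).
  { intros t Ht. assert (0 < Rmin th th')%R by (apply Rmin_glb_lt; lra).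
    assert (Rmax th th' < PI)%R by (apply Rmax_lub_lt; lra). lra. }
  assert (K : isI (fun t => dh (semicircle Q t) * v t) th th' (h (semicircle Q th') - h (semicircle Q th))).
  { apply (isI_derive (fun t => h (semicircle Q t))).
    - intros t Ht. apply Hr in Ht.
      apply pd_eq with (1 := wd_path h _ t _ _ _ (Hh _ (semicircle_upper Q t HD Ha Ht)) (pd_semicircle Q t)); auto.
      fold r. fold (v t). ring.
    - intros t Ht. apply Hr in Ht. apply continuous_Cmult.
      + apply (continuous_C_comp _ dh); [apply Hdh, semicircle_upper; auto|].
        exact (pd_continuous _ _ _ (pd_semicircle Q t)).
      + unfold v. apply continuous_C_intro; simpl.
        * apply (ex_derive_continuous (fun t => - r * sin t)%R). auto_derive. auto.
        * apply (ex_derive_continuous (fun t => r * cos t)%R). auto_derive. auto. }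
  apply (is_RInt_ext (V := C_R_NormedModule)) with (2 := K).
  intros t Ht. unfold pullback. rewrite (pd_unique _ _ _ (pd_semicircle Q t)). fold r. fold (v t).
  rewrite Hf; auto. apply semicircle_upper; auto. apply Hr. lra.
Qed.

Lemma nonsquare_cycle_integrals (Q : bqf) : (0 < qdisc Q)%Z -> ~ is_square (qdisc Q) -> exists I J : C,
  (forall s z, is_gQ Q s -> geodesic Q z ->
     is_arc_integral (fun z => g z * Cpow (qeval Q z) (k - 1)) Q z (moebius s z) I) /\
  (forall s z, is_gQ Q s -> geodesic Q z ->
     is_arc_integral (fun z => Dop_iter (2 * k - 1) M z * Cpow (qeval Q z) (k - 1)) Q z (moebius s z) J) /\
  J = - (dop_const * kap * Cconj I).
Proof.
  intros HD Hns.
  (* For a = 0 the discriminant would be b^2. *)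
  assert (Ha : qa Q <> 0%Z).
  { intros E0. apply Hns. exists (qb Q). unfold qdisc. rewrite E0. ring. }
  destruct (classic (exists s, is_gQ Q s)) as [[s Hs]|Hno].
  (* Without a smallest Pell solution both integral claims are vacuous, and 0, 0 satisfies the
     relation. *)
  2: { exists 0, 0. split; [|split].
    - intros s z Hs. exfalso. eauto.
    - intros s z Hs. exfalso. eauto.
    - replace (Cconj 0) with (RtoC 0) by (apply C_pair_intro; simpl; ring). ring. }
  destruct (is_gQ_spec Q s HD Hs) as [Hsl HQ].
  assert (Hi : upper Ci) by (unfold upper; simpl; lra).
  (* As s fixes Q, the differential g Q^(k-1) dz is s-invariant; hence the increment from z to sz
     does not depend on z. *)
  assert (D : forall z, upper z -> wd (fun z => eichler Q (moebius s z) - eichler Q z) z 0 0).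
  { intros z Hz.
    assert (K := wd_comp _ _ _ _ _ _ _ (wd_eichler Q _ (moebius_upper s z Hsl Hz)) (wd_moebius s z Hsl Hz)).
    apply wd_eq with (1 := wd_minus _ _ _ _ _ _ _ K (wd_eichler Q z Hz)); auto.
    - assert (G := g_slash Q s z Hsl Hz). rewrite HQ in G. rewrite <- G. ring.
    - ring. }
  set (I := eichler Q (moebius s Ci) - eichler Q Ci).
  assert (EI : forall z, upper z -> I = eichler Q (moebius s z) - eichler Q z).
  { intros z Hz. exact (wd_zero_constant upper _ convex_upper D Ci z Hi Hz). }
  (* The n-th derivative of a polynomial of degree at most n is constant, so the a0 term takes the
     same value at z and sz. *)
  assert (HL : forall z w, ptower (cycle_poly k Q) n z = ptower (cycle_poly k Q) n w).
  { intros z w. apply (wd_zero_constant _ (ptower (cycle_poly k Q) n) convex_full); auto.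
    intros v _. assert (K := wd_ptower (cycle_poly k Q) n v). now rewrite ptower_top_zero in K. }
  exists I, (- (dop_const * kap * Cconj I)). split; [|split; [|reflexivity]].
  - intros s' z Hs' Hz. rewrite (is_gQ_unique Q s' s Hs' Hs).
    rewrite (EI z (proj1 Hz)).
    apply (arc_integral Q _ (eichler Q) (fun z => g z * peval (cycle_poly k Q) z)); auto.
    + intros w Hw. now apply wd_eichler.
    + intros w Hw. exact (continuous_Cmult _ _ _ _ (hol_cont _ _ (hol_g k M HM) w Hw)
        (peval_cont _ w Hw)).
    + intros w Hw. now rewrite peval_cycle_poly.
    + now apply geodesic_moebius.
  - intros s' z Hs' Hz. rewrite (is_gQ_unique Q s' s Hs' Hs).
    assert (Hzu := proj1 Hz). assert (Hsz := moebius_upper s z Hsl Hzu).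
    (* [eichler_maass Q] agrees at z and sz because s fixes Q, so the increment of [eichler_hol] is
       -kap times the conjugate of the increment of [eichler]. *)
    assert (EJ : - (dop_const * kap * Cconj I) =
      dop_const * eichler_hol Q (moebius s z) - dop_const * eichler_hol Q z).
    { assert (E1 := eichler_split Q z Hzu). assert (E2 := eichler_split Q _ Hsz).
      rewrite <- eichler_maass_moebius, HQ, E1 in E2 by auto.
      rewrite (HL (moebius s z) z) in E2. rewrite (EI z Hzu), Cconj_minus.
      assert (E3 : eichler_hol Q (moebius s z) =
        eichler_hol Q z + kap * Cconj (eichler Q z) - kap * Cconj (eichler Q (moebius s z))).
      { transitivity ((eichler_hol Q (moebius s z) + kap * Cconj (eichler Q (moebius s z)) +
          a0 * sgn n * ptower (cycle_poly k Q) n z) - kap * Cconj (eichler Q (moebius s z))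
          - a0 * sgn n * ptower (cycle_poly k Q) n z); [ring|]. rewrite <- E2. ring. }
      rewrite E3. ring. }
    rewrite EJ.
    apply (arc_integral Q _ (fun z => dop_const * eichler_hol Q z)
      (fun z => dop_const * (Mr (S n) z * peval (cycle_poly k Q) z))); auto.
    + intros w Hw. apply wd_eq with (1 := wd_scal dop_const _ _ _ _ (wd_eichler_hol Q w Hw)); auto. ring.
    + intros w Hw. exact (continuous_Cmult _ _ _ _ (continuous_Cconst _ dop_const w)
        (continuous_Cmult _ _ _ _ (smooth_cont _ (smooth_maass_derivative k M HM (S n)) w Hw)
          (peval_cont _ w Hw))).
    + intros w Hw. rewrite Dop_iter_eq, peval_cycle_poly. ring.
    + now apply geodesic_moebius.
Qed.

(** * The constant and the conclusion *)

(** One factor 2 pi i meets i/2 and gives 1/(4 pi); the remaining n factors are (2 pi i)(2i) = -4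
    pi, and their sign disappears because n is even. *)
Lemma const_eq : dop_const * kap = RtoC (INR (fact (2 * k - 2)) / (4 * PI) ^ (2 * k - 1)).
Proof.
  unfold dop_const, kap, shadow_const. fold n.
  assert (HPI := PI_RGT_0).
  replace (2 * k - 1)%nat with (S n) by (unfold n; lia).
  unfold Rdiv. rewrite RtoC_mult, RtoC_inv, RtoC_pow, RtoC_mult by (apply pow_nonzero; lra).
  assert (H1 : RtoC PI <> 0) by (intros E0; apply RtoC_inj in E0; lra).
  assert (H2 : Ci <> 0) by (intros E0; apply (f_equal snd) in E0; simpl in E0; lra).
  assert (E1 : (2 * RtoC PI * Ci) ^ n * (2 * Ci) ^ n = (4 * RtoC PI) ^ n).
  { rewrite <- Cpow_mult_l.
    replace (2 * RtoC PI * Ci * (2 * Ci)) with ((4 * RtoC PI) * (Ci * Ci)) by ring.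
    rewrite Ci_sqr, Cpow_mult_l. unfold n. replace (2 * k - 2)%nat with (2 * (k - 1))%nat by lia.
    rewrite (Cpow_mult_r (Copp 1)). replace (Copp 1 ^ 2) with (RtoC 1) by (simpl; ring).
    rewrite Cpow_1_l. ring. }
  rewrite !Cpow_S, <- E1.
  assert (H3 := Cpow_nz _ n two_pi_i_neq_0). assert (H4 := two_i_pow_neq_0 k). fold n in H4.
  revert H3 H4. generalize ((2 * RtoC PI * Ci) ^ n) ((2 * Ci) ^ n). intros p q Hp Hq.
  field. repeat split; auto.
Qed.

End CycleIntegrals.

Lemma solve_proportion (I J : C) (r : R) : r <> 0%R ->
  J = - (RtoC (/ r) * Cconj I) -> I = - RtoC r * Cconj J.
Proof.
  intros Hr ->. rewrite Cconj_opp, Cconj_mult, Cconj_invol, Cconj_RtoC, RtoC_inv by auto.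
  field. intros E. apply Hr. now apply RtoC_inj in E.
Qed.

Theorem theorem1p1 :
  forall (k : nat) (M : C -> C) (D : Z) (Q : bqf),
    (1 <= k)%nat ->
    Hcusp k M ->
    (0 < D)%Z -> discriminant D ->
    qdisc Q = D ->
    exists I J : C,
      is_cycle_integral k (xi (2 - 2 * Z.of_nat k) M) Q I /\
      is_cycle_integral k (Dop_iter (2 * k - 1) M) Q J /\
      I = - RtoC ((4 * PI) ^ (2 * k - 1) / INR (fact (2 * k - 2)))%R * Cconj J.
Proof.
  intros k M D Q Hk HM HD _ HQ. subst D.
  destruct (shadow_tower k M Hk HM) as (psi & Hpsi & Hper & Hpsig).
  (* The shift by one makes index 0 the Eichler integral, whose (n+1)-st derivative is g; [psi 0]
     lies one step below it. *)
  destruct (holomorphic_tower k M Hk HM (fun i => psi (S i))) as (c & phi & a0 & Hphi & Hsplit).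
  { intros i Hi. apply Hpsi. lia. }
  { exact Hpsig. }
  { intros i Hi. apply Hper. lia. }
  { intros i Hi. apply Hpsi. lia. }
  assert (Hpsi1 : periodic (psi 1%nat)) by (apply Hper; lia).
  set (r := ((4 * PI) ^ (2 * k - 1) / INR (fact (2 * k - 2)))%R).
  assert (HPI := PI_RGT_0).
  assert (Hf := INR_fact_lt_0 (2 * k - 2)).
  assert (Hp : (0 < (4 * PI) ^ (2 * k - 1))%R) by (apply pow_lt; lra).
  assert (Hr : r <> 0%R) by (apply Rgt_not_eq; apply Rdiv_lt_0_compat; auto).
  assert (Hc : forall I J, J = - (dop_const k * shadow_const k * Cconj I) -> I = - RtoC r * Cconj J).
  { intros I J HJ. apply solve_proportion; auto. rewrite HJ, (const_eq k Hk). do 3 f_equal.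
    unfold r. field. split; apply Rgt_not_eq; auto. }
  destruct (classic (is_square (qdisc Q))) as [Hsq|Hsq].
  - destruct (square_cycle_integrals k M Hk HM psi phi c a0 Hpsi Hpsi1 Hpsig Hphi Hsplit Q HD)
      as (I & J & HI & HJ & E).
    exists I, J. split; [|split; [|now apply Hc]]; (split; [intros H; contradiction|auto]).
  - destruct (nonsquare_cycle_integrals k M Hk HM psi phi c a0 Hpsi Hpsig Hphi Hsplit Q HD Hsq)
      as (I & J & HI & HJ & E).
    exists I, J. split; [|split; [|now apply Hc]]; (split; [auto|intros H; contradiction]).
Qed.
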